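(* Let $h:[0,1]\to(0,\infty)$ and $f:[0,\infty)\to[0,\infty)$ be continuously differentiable, suppose there is $t_0\ge0$ with $f>0$ on $[t_0,\infty)$ and $f\in C^2([t_0,\infty))$, put $g=\log f$ on $[t_0,\infty)$, and assume condition (H1) of the context with $q\in[1,2)$. Let $(\lambda_n,\mu_n,u_n)\in(0,\infty)\times(0,\infty)\times C^2([0,1])$ satisfy $-u_n''-\frac1r u_n'=\lambda_n h(r)f(u_n)$, $u_n>0$ in $(0,1)$, $u_n(0)=\mu_n$, $u_n'(0)=0=u_n(1)$, with $\mu_n\to\infty$. Then there is a subsequence (not relabeled) and, for each $k\in\mathbb{N}$, a sequence $(r_{k,n})\subset(0,1)$ with $u_n(r_{k,n})/\mu_n\to\delta_k$, $\lambda_n r_{k,n}^2h(r_{k,n})f'(u_n(r_{k,n}))\to a_k^2/2$ and, if $q=1$, $u_n(r_{k,n})=\mu_n-(\log\frac1{\eta_k}+o(1))\frac{g(\mu_n)}{g'(\mu_n)}$, such that along this subsequence the following hold. (1) For any sequence $(r_n)\subset(0,1)$ with $u_n(r_n)/\mu_n\to0$ if $q>1$, respectively $(\mu_n-u_n(r_n))\frac{g'(\mu_n)}{g(\mu_n)}\to\infty$ if $q=1$, we have $\lim_{n\to\infty}\int_0^{r_n}\lambda_n h f'(u_n)\,r\,dr=\infty$. (2) $g'(\mu_n)u_n(r)\to\infty$ for every $r\in[0,1)$. (3) If in addition, in the case $q=1$, $\inf_{t>0} f(t)/t>0$, then for all $q\in[1,2)$, $$\lim_{n\to\infty}\frac{\log\frac1{\lambda_n}}{g(\mu_n)}=0\quad\text{and}\quad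 \lim_{n\to\infty}\frac{\log\frac1{r_{k,n}}}{g(\mu_n)}=\frac{\eta_k}{2}\ \text{ for all }k\in\mathbb{N}.$$
   Context: Condition (H1): (i) $g'(t)>0$ and $g''(t)>0$ for all $t\ge t_0$, and there is a pair $(q,p)$ with either $q=1$ and $p\in(0,\infty]$, or $q\in(1,\infty)$ and $p\in(0,\infty)$, such that $\lim_{t\to\infty}\frac{g'(t)^2}{g(t)g''(t)}=q$ and $\lim_{t\to\infty}\frac{tg'(t)}{g(t)}=p$; (ii) if $q=1$, then $tg'(t)/g(t)$ is nondecreasing on $[t_0,\infty)$ and there exist $k\in\mathbb{N}$ and $\hat g\in C^2([t_0,\infty))$ with $f=\exp_k\circ\hat g$ and $\hat g'/\hat g$ nonincreasing on $[t_0,\infty)$ ($\exp_1=\exp$, $\exp_k=\exp_{k-1}\circ\exp$). Under (H1), $1/p+1/q=1$ ($1/\infty=0$). Sequences: $a_1=2$, $\delta_1=1$, $\eta_1=1$. If $q\in(1,2)$: $\delta_{k+1}\in(0,\delta_k)$ solves $\frac{2p}{2+a_k}\big(1-\frac{\delta_{k+1}}{\delta_k}\big)-1+\big(\frac{\delta_{k+1}}{\delta_k}\big)^p=0$, $a_{k+1}=2-\big(\frac{\delta_{k+1}}{\delta_k}\big)^{p-1}(2+a_k)$, $\eta_k=\delta_k^p$. If $q=1$: $\eta_{k+1}\in(0,\eta_k)$ solves $\frac{2}{2+a_k}\log\frac{\eta_k}{\eta_{k+1}}-1+\frac{\eta_{k+1}}{\eta_k}=0$, $a_{k+1}=2-\frac{\eta_{k+1}}{\eta_k}(2+a_k)$,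 and $\delta_k=1$. These are well-defined. In integrals $h=h(r)$, $f'(u_n)=f'(u_n(r))$. *)

(* Defs.v *)
From Stdlib Require Import Reals.
From Coquelicot Require Import Coquelicot.
Open Scope R_scope.

(* u has derivative du at every point of D, relative to D
   (one-sided at endpoints of intervals). *)
Definition derive_on (D : R -> Prop) (u du : R -> R) : Prop :=
  forall x, D x ->
    filterlim (fun y => (u y - u x) / (y - x))
      (within (fun y => D y /\ y <> x) (locally x)) (locally (du x)).

Definition C1_on (D : R -> Prop) (u du : R -> R) : Prop :=
  derive_on D u du /\ continuous_on D du.

Definition C2_on (D : R -> Prop) (u du d2u : R -> R) : Prop :=
  derive_on D u du /\ derive_on D du d2u /\ continuous_on D d2u.

Definition I01 (x : R) : Prop := 0 <= x <= 1.
Definition Ici (a x : R) : Prop := a <= x.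

Definition logf (f : R -> R) (t : R) : R := ln (f t).

Definition expk (k : nat) : R -> R := Nat.iter k exp.

(* Condition (H1) for g = log f with derivatives g1, g2 on [t0,oo). *)
Definition H1 (f : R -> R) (t0 : R) (g1 g2 : R -> R) (q : R) (p : Rbar) : Prop :=
  (forall t, t0 <= t -> 0 < g1 t /\ 0 < g2 t) /\
  ((q = 1 /\ Rbar_lt 0 p) \/ (1 < q /\ exists p0 : R, p = Finite p0 /\ 0 < p0)) /\
  is_lim (fun t => (g1 t)^2 / (logf f t * g2 t)) p_infty (Finite q) /\
  is_lim (fun t => t * g1 t / logf f t) p_infty p /\
  (q = 1 ->
     (forall s t, t0 <= s -> s <= t -> s * g1 s / logf f s <= t * g1 t / logf f t) /\
     exists (k : nat) (gh gh1 gh2 : R -> R),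
       (1 <= k)%nat /\ C2_on (Ici t0) gh gh1 gh2 /\
       (forall t, t0 <= t -> f t = expk k (gh t)) /\
       (forall s t, t0 <= s -> s <= t -> gh1 t / gh t <= gh1 s / gh s)).

Definition seqs_adeta (q : R) (p : Rbar) (a delta eta : nat -> R) : Prop :=
  a 1%nat = 2 /\ delta 1%nat = 1 /\ eta 1%nat = 1 /\
  (1 < q < 2 ->
     forall k, (1 <= k)%nat ->
       0 < delta (S k) < delta k /\
       2 * real p / (2 + a k) * (1 - delta (S k) / delta k) - 1
         + Rpower (delta (S k) / delta k) (real p) = 0 /\
       a (S k) = 2 - Rpower (delta (S k) / delta k) (real p - 1) * (2 + a k) /\
       eta k = Rpower (delta k) (real p)) /\
  (q = 1 ->
     forall k, (1 <= k)%nat ->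
       0 < eta (S k) < eta k /\
       2 / (2 + a k) * ln (eta k / eta (S k)) - 1 + eta (S k) / eta k = 0 /\
       a (S k) = 2 - eta (S k) / eta k * (2 + a k) /\
       delta k = 1).

(* Main.v *)
Require Import Defs.
From Stdlib Require Import Reals Lra Lia ClassicalEpsilon.
From Coquelicot Require Import Coquelicot.
Open Scope R_scope.

(* In the variable [s = ln r], with [Y = - r u'], [z = g'(u) Y] and
   [rho = lam r^2 h f'(u)], the equation is a perturbation of the autonomous system
   [z' = rho], [rho' = rho (2 - z)], whose first integral is [Q = (z - 2)^2 / 2 + rho];
   the perturbation is governed by [g''/g'^2] and [r h'/h], which are small where [u] is large,
   and it changes [Q] little between two points whose levels [g(u)] are comparable.
   A bubble is a passage of [z] from [2 - a] to [2 + a], with [rho = a^2 / 2] at [z = 2].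
   Between two bubbles [rho] is exponentially small, so [Y] is constant and [u] is affine in [s];
   balancing [2 s + g(u)] along this neck gives the level of the next bubble
   ([Lam] below is the limit profile of [(m - u) g'(m) / g(m)] in terms of [g(u) / g(m)]),
   and [2 - a'] is the value of [z] on arrival.
   All estimates are uniform over solutions, so no subsequence is needed.
   Pohozaev's identity gives [z <= 4 + o(1)] as long as [u] is large, and, because [q < 2],
   this forces [z] to stay bounded below after the first bubble, down to a fixed value of [u].
   Hence [lam] is bounded above and below, and the mass integral diverges
   like the logarithm of [g']. *)

(** * Calculus *)

(** What makes [Q] usable is that its variation can be charged to [ln g'(U)]: as
    [(ln g'(U))' = - kap z] while [z] and [rho] stay bounded, [|Q'|] is at most [20 kap z] plus a
    weight term, and [ln g'] varies at most twice as much as [ln g]. So [Q] is conserved up to O(nu)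
    while [g(U)] drops by the factor [1 - nu]. Across a neck [g(U)] drops by a fixed factor and this
    control is lost; there the monotonicity of [Y] replaces it, which is why each cycle is cut in
    two. The cases q = 1 and q > 1 merge once (H1) is read as [g g'' / g'^2 -> beta] with beta =
    1/q: then [g'] behaves like [g^beta], and [Lam beta] is the integral this produces. The
    condition q < 2 acts decisively through the limit of [Lam beta] at 0, which is 1/(1 - beta) > 2
    (infinite for beta = 1). Estimates have the shape: for each tolerance there is a level [B] that
    serves all solutions. Bubbles can then be chained by induction on k, with tolerances chosen
    backwards, and limits in n are taken only at the end. *)

Lemma Derive_eta (F : R -> R) (x d : R) :
  is_derive F x d -> Derive (fun y : R => F y) x = d.
Proof. apply (is_derive_unique F). Qed.
Arguments Derive_eta {F x d} _.


Lemma derive_ge0_le (F dF : R -> R) (a b : R) :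
  a <= b -> (forall x, a <= x <= b -> is_derive F x (dF x)) ->
  (forall x, a <= x <= b -> 0 <= dF x) -> F a <= F b.
Proof.
intros hab hd hp.
destruct (MVT_gen F a b dF) as [c [hc he]].
- rewrite Rmin_left, Rmax_right by lra. intros x hx; apply hd; lra.
- rewrite Rmin_left, Rmax_right by lra. intros x hx.
  apply continuity_pt_filterlim, @ex_derive_continuous.
  exists (dF x); apply hd; lra.
- rewrite Rmin_left, Rmax_right in hc by lra.
  assert (0 <= dF c * (b - a)) by (apply Rmult_le_pos; [apply hp|]; lra).
  lra.
Qed.

Lemma derive_ge_incr (F dF : R -> R) (a b k : R) :
  a <= b -> (forall x, a <= x <= b -> is_derive F x (dF x)) ->
  (forall x, a <= x <= b -> k <= dF x) -> k * (b - a) <= F b - F a.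
Proof.
intros hab hd hp.
enough (F a - k * a <= F b - k * b) by lra.
apply (derive_ge0_le (fun x => F x - k * x) (fun x => dF x - k)); try easy.
- intros x hx. specialize (hd x hx). auto_derive; [now exists (dF x)|].
  rewrite (Derive_eta hd); ring.
- intros x hx. specialize (hp x hx). lra.
Qed.

Lemma derive_le_incr (F dF : R -> R) (a b k : R) :
  a <= b -> (forall x, a <= x <= b -> is_derive F x (dF x)) ->
  (forall x, a <= x <= b -> dF x <= k) -> F b - F a <= k * (b - a).
Proof.
intros hab hd hp.
enough (- k * (b - a) <= - F b - - F a) by lra.
apply (derive_ge_incr (fun x => - F x) (fun x => - dF x)); try easy.
- intros x hx. apply (is_derive_opp F). now apply hd.
- intros x hx. specialize (hp x hx). lra.
Qed.

(** The centre r = 0 is s = -oo, so initial data enter only as limits there; this is monotonicity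
    started from -oo. *)
Lemma derive_ge0_lim_le (F dF : R -> R) (b l : R) :
  (forall x, x <= b -> is_derive F x (dF x)) ->
  (forall x, x <= b -> 0 <= dF x) -> is_lim F m_infty l -> l <= F b.
Proof.
intros hd hp hl.
apply (is_lim_le_loc F (fun _ => F b) m_infty l (F b)); trivial.
- exists b. intros x hx. apply (derive_ge0_le F dF); try lra.
  + intros y hy; apply hd; lra.
  + intros y hy; apply hp; lra.
- apply is_lim_const.
Qed.

(** The point is the supremum of the set where [v <= z]; continuity excludes [z s < v] and [z s > v]
    there. *)
Lemma last_hit (z : R -> R) (a b v : R) :
  a <= b -> (forall s, a <= s <= b -> continuous z s) -> v <= z a -> z b < v ->
  exists s, a <= s < b /\ z s = v /\ forall t, s < t <= b -> z t < v.
Proof.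
intros hab hc ha hb.
destruct (completeness (fun s => a <= s <= b /\ v <= z s)) as [s [hs1 hs2]].
- exists b. intros x [hx _]; lra.
- exists a; lra.
- assert (a <= s) by (apply hs1; lra).
  assert (s <= b) by (apply hs2; intros x [hx _]; lra).
  assert (hafter : forall t, s < t <= b -> z t < v).
  { intros t ht. apply Rnot_le_lt; intros hv.
    assert (t <= s) by (apply hs1; lra). lra. }
  assert (hz : z s = v).
  { destruct (Rtotal_order (z s) v) as [hlt|[he|hgt]]; trivial; exfalso.
    - destruct (proj1 (filterlim_locally z (z s)) (hc s (conj H H0))
                  (mkposreal (v - z s) ltac:(lra))) as [e he].
      assert (s <= s - e).
      { apply hs2. intros x [hx hvx].
        apply Rnot_lt_le; intros hxs.
        assert (x <= s) by (apply hs1; lra).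
        specialize (he x). assert (hb1 : ball s e x).
        { unfold ball; simpl; unfold AbsRing_ball, abs, minus, plus, opp; simpl.
          apply Rabs_def1; lra. }
        specialize (he hb1).
        unfold ball in he; simpl in he; unfold AbsRing_ball, abs, minus, plus, opp in he; simpl in he.
        apply Rabs_def2 in he; lra. }
      destruct e as [e hepos]; simpl in *; lra.
    - assert (s < b) by (destruct (Req_dec s b); [subst; lra|lra]).
      destruct (proj1 (filterlim_locally z (z s)) (hc s (conj H H0))
                  (mkposreal (z s - v) ltac:(lra))) as [[e hepos] he]; simpl in he.
      pose (x := Rmin b (s + e / 2)).
      assert (s < x <= b /\ x <= s + e / 2).
      { unfold x; repeat split; [apply Rmin_glb_lt; lra|apply Rmin_l|apply Rmin_r]. }
      specialize (he x). assert (hb1 : ball s e x).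
      { unfold ball; simpl; unfold AbsRing_ball, abs, minus, plus, opp; simpl.
        apply Rabs_def1; lra. }
      specialize (he hb1).
      unfold ball in he; simpl in he; unfold AbsRing_ball, abs, minus, plus, opp in he; simpl in he.
      apply Rabs_def2 in he.
      specialize (hafter x ltac:(lra)). lra. }
  exists s; repeat split; trivial.
  destruct (Req_dec s b); [subst; lra|lra].
Qed.

Lemma first_hit (z : R -> R) (a b v : R) :
  a <= b -> (forall s, a <= s <= b -> continuous z s) -> v < z a -> z b <= v ->
  exists s, a < s <= b /\ z s = v /\ forall t, a <= t < s -> v < z t.
Proof.
intros hab hc ha hb.
destruct (last_hit (fun s => - z (- s)) (- b) (- a) (- v)) as [s [hs [he hafter]]].
- lra.
- intros s hs. apply (continuous_opp (fun s => z (- s))).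
  apply (continuous_comp Ropp z).
  + apply (continuous_opp (fun s : R => s)). apply continuous_id.
  + apply hc. lra.
- rewrite Ropp_involutive; lra.
- rewrite Ropp_involutive; lra.
- exists (- s). repeat split; try lra.
  intros t ht. specialize (hafter (- t) ltac:(lra)). rewrite Ropp_involutive in hafter. lra.
Qed.

Lemma derive_pos_right (F : R -> R) (x d : R) : is_derive F x d -> 0 < d ->
  exists e, 0 < e /\ forall t, x < t < x + e -> F x < F t.
Proof.
intros hd hpos. apply is_derive_Reals in hd.
destruct (hd d hpos) as [[e hepos] he]; simpl in he.
exists e. split; trivial. intros t ht.
specialize (he (t - x) ltac:(lra)). rewrite (Rabs_pos_eq (t - x)) in he by lra.
specialize (he ltac:(lra)). apply Rabs_def2 in he.
replace (x + (t - x)) with t in he by ring.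
apply Rnot_le_lt; intros hle.
assert ((F t - F x) / (t - x) <= 0).
{ apply Rmult_le_reg_r with (t - x); [lra|]. unfold Rdiv. rewrite Rmult_assoc, Rinv_l; lra. }
lra.
Qed.

Lemma last_hit_derive (z : R -> R) (a b v d : R) :
  a < b -> z a = v -> (forall t, a < t <= b -> z t < v) -> is_derive z a d -> d <= 0.
Proof.
intros hab ha hlt hd. apply Rnot_lt_le; intros hpos.
destruct (derive_pos_right z a d hd hpos) as [e [he hz]].
assert (i1 := Rmin_l (b - a) (e / 2)). assert (i2 := Rmin_r (b - a) (e / 2)).
assert (i3 : 0 < Rmin (b - a) (e / 2)) by (apply Rmin_glb_lt; lra).
specialize (hz (a + Rmin (b - a) (e / 2)) ltac:(lra)).
specialize (hlt (a + Rmin (b - a) (e / 2)) ltac:(lra)). lra.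
Qed.

(** A barrier argument: the slope is controlled only while [z] lies in the strip, but at a last
    downward crossing of a level of the strip the derivative would be nonpositive. If the end value
    were below [v2], then [z] would therefore stay in the strip throughout, and integrating [c]
    would carry it to [v2]. *)
Lemma climb (z dz : R -> R) (a b v1 v2 c : R) :
  a <= b -> 0 < c -> v1 <= v2 ->
  (forall s, a <= s <= b -> is_derive z s (dz s)) ->
  (forall s, a <= s <= b -> v1 <= z s <= v2 -> c <= dz s) ->
  v1 <= z a -> v2 - v1 <= c * (b - a) -> v2 <= z b.
Proof.
intros hab hc hv hd hr ha ht.
apply Rnot_lt_le; intros hb.
assert (hcont : forall s, a <= s <= b -> continuous z s).
{ intros s hs. apply @ex_derive_continuous. exists (dz s). now apply hd. }
assert (hbar : forall v s, v1 <= v <= v2 -> a <= s <= b -> z b < v -> v <= z s -> False).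
{ intros v s hvv hs hbv hvs.
  destruct (last_hit z s b v) as [r [hr1 [hr2 hr3]]]; try lra.
  - intros x hx; apply hcont; lra.
  - assert (dz r <= 0).
    { apply (last_hit_derive z r b v); trivial; [lra|apply hd; lra]. }
    specialize (hr r ltac:(lra) ltac:(lra)). lra. }
assert (hup : forall s, a <= s <= b -> z s < v2).
{ intros s hs. apply Rnot_le_lt; intros h. apply (hbar v2 s); lra. }
assert (hb1 : v1 <= z b).
{ apply Rnot_lt_le; intros h. apply (hbar v1 a); lra. }
assert (hlow : forall s, a <= s <= b -> v1 <= z s).
{ intros s hs. apply Rnot_lt_le; intros hlt.
  destruct (last_hit z a s v1) as [r [hr1 [hr2 hr3]]]; try lra.
  - intros x hx; apply hcont; lra.
  - assert (dz r <= 0).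
    { apply (last_hit_derive z r s v1); trivial; [lra|apply hd; lra]. }
    specialize (hr r ltac:(lra) ltac:(lra)). lra. }
assert (c * (b - a) <= z b - z a).
{ apply (derive_ge_incr z dz); trivial.
  intros x hx. apply hr; trivial. specialize (hup x hx); specialize (hlow x hx); lra. }
lra.
Qed.

Lemma IVT_decr (U : R -> R) (a b v : R) :
  a <= b -> (forall s, a <= s <= b -> continuous U s) -> v <= U a -> U b <= v ->
  exists s, a <= s <= b /\ U s = v.
Proof.
intros hab hc ha hb.
destruct (Req_dec (U a) v) as [e|ne]; [exists a; lra|].
destruct (first_hit U a b v) as [s [h1 [h2 _]]]; try easy; [lra|].
exists s; lra.
Qed.

(** * The nonlinearity *)

(** The integral of t^(-beta) over [x,1]; the test on [beta] only isolates the logarithm. *)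
Definition Lam (beta x : R) : R :=
  if Req_EM_T beta 1 then - ln x else (1 - Rpower x (1 - beta)) / (1 - beta).

Lemma Lam_1 (beta : R) : Lam beta 1 = 0.
Proof.
unfold Lam. destruct (Req_EM_T beta 1).
- rewrite ln_1; ring.
- unfold Rpower. rewrite ln_1, Rmult_0_r, exp_0. unfold Rdiv; ring.
Qed.

Lemma is_derive_ln' (x : R) : 0 < x -> is_derive ln x (/ x).
Proof. intros hx. apply is_derive_Reals. now apply derivable_pt_lim_ln. Qed.

Lemma Lam_derive (beta x : R) : 0 < x ->
  is_derive (Lam beta) x (- Rpower x (- beta)).
Proof.
intros hx. unfold Lam. destruct (Req_EM_T beta 1) as [e|ne].
- replace (- Rpower x (- beta)) with (- / x).
  + apply (is_derive_opp ln). now apply is_derive_ln'.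
  + rewrite e. rewrite Rpower_Ropp, Rpower_1 by lra. reflexivity.
- unfold Rpower. auto_derive; [lra|].
  replace (exp (- beta * ln x)) with (exp ((1 - beta) * ln x) * / x).
  + field; split; lra.
  + replace (- beta * ln x) with ((1 - beta) * ln x + - ln x) by ring.
    rewrite exp_plus, exp_Ropp, exp_ln by lra. reflexivity.
Qed.

Lemma exp_lt_1 (x : R) : x < 0 -> exp x < 1.
Proof. intros hx. rewrite <- exp_0. now apply exp_increasing. Qed.

Lemma exp_le (x y : R) : x <= y -> exp x <= exp y.
Proof. intros [h|h]; [left; now apply exp_increasing|subst; lra]. Qed.

Lemma Rpower_pos (x y : R) : 0 < Rpower x y.
Proof. apply exp_pos. Qed.

Lemma Lam_anti (beta x y : R) : 0 < x -> x <= y -> Lam beta y <= Lam beta x.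
Proof.
intros hx hxy.
enough (- Lam beta x <= - Lam beta y) by lra.
apply (derive_ge0_le (fun t => - Lam beta t) (fun t => - - Rpower t (- beta))); trivial.
- intros t ht. apply (is_derive_opp (Lam beta)). apply Lam_derive; lra.
- intros t _. pose proof (Rpower_pos t (- beta)); lra.
Qed.

Lemma Lam_ge0 (beta x : R) : 0 < x <= 1 -> 0 <= Lam beta x.
Proof. intros hx. rewrite <- (Lam_1 beta). apply Lam_anti; lra. Qed.

Lemma Rpower_neg_anti (x y b : R) : 0 <= b -> 0 < x -> x <= y ->
  Rpower y (- b) <= Rpower x (- b).
Proof.
intros hb hx hxy. unfold Rpower.
assert (ln x <= ln y) by (apply ln_le; lra).
destruct (Rle_lt_or_eq_dec (- b * ln y) (- b * ln x)) as [h|h]; [nra|..].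
- left. now apply exp_increasing.
- rewrite h. lra.
Qed.

(** The integrand t^(-beta) is strictly decreasing, so it lies below its value at the left end. The
    strictness is what later keeps bubble amplitudes positive. *)
Lemma Lam_tangent (beta x : R) : 0 < beta -> 0 < x < 1 ->
  Lam beta x < Rpower x (- beta) * (1 - x).
Proof.
intros hb hx.
  (* Splitting at the midpoint yields the strict inequality: on the right half the bound is
     [Rpower y (- beta)], strictly smaller. *)
  pose (y := (x + 1) / 2).
  assert (h1 : - (Rpower x (- beta)) * (y - x) <= Lam beta y - Lam beta x).
  { apply (derive_ge_incr (Lam beta) (fun t => - Rpower t (- beta))); [unfold y; lra|..].
    - intros t ht; apply Lam_derive; lra.
    - intros t ht. assert (h := Rpower_neg_anti x t beta). lra. }
  assert (h2 : - (Rpower y (- beta)) * (1 - y) <= Lam beta 1 - Lam beta y).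
  { apply (derive_ge_incr (Lam beta) (fun t => - Rpower t (- beta))); [unfold y; lra|..].
    - intros t ht; apply Lam_derive; unfold y in ht; lra.
    - intros t ht. assert (h := Rpower_neg_anti y t beta). unfold y in *; lra. }
  rewrite Lam_1 in h2.
  assert (h3 : Rpower y (- beta) < Rpower x (- beta)).
  { unfold Rpower. apply exp_increasing.
    assert (ln x < ln y) by (apply ln_increasing; unfold y; lra). nra. }
  unfold y in *. nra.
Qed.

(** [Lam beta] increases to 1/(1 - beta) at 0, or to infinity if beta = 1; the last hypothesis says
    that [K] is below this limit. *)
Lemma Lam_near0 (beta K : R) : beta <= 1 -> 0 < K -> K * (1 - beta) < 1 ->
  exists x0, 0 < x0 < 1 /\ forall x, 0 < x <= x0 -> K < Lam beta x.
Proof.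
intros hb hK hKb.
assert (hgen : exists x0, 0 < x0 < 1 /\ K < Lam beta x0).
{ unfold Lam. destruct (Req_EM_T beta 1) as [e|ne].
  - exists (exp (- (K + 1))). repeat split.
    + apply exp_pos.
    + apply exp_lt_1; lra.
    + rewrite ln_exp; lra.
  - set (s := 1 - beta). assert (hs : 0 < s) by (unfold s; lra).
    (* At [x = w^(1/s)] the value of [Lam] is [(1 - w) / s], and this [w] puts it halfway between
       [K] and the limit [1 / s]. *)
    pose (w := (1 - K * s) / 2).
    assert (0 < K * s) by now apply Rmult_lt_0_compat.
    assert (0 < w < 1) by (unfold w; fold s in hKb; split; lra).
    exists (exp (ln w / s)).
    assert (ln w < 0) by (rewrite <- ln_1; apply ln_increasing; lra).
    assert (0 < / s) by now apply Rinv_0_lt_compat.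
    repeat split.
    + apply exp_pos.
    + apply exp_lt_1. unfold Rdiv.
      assert (0 < - ln w * / s) by (apply Rmult_lt_0_compat; lra). lra.
    + unfold Rpower. rewrite ln_exp.
      replace (s * (ln w / s)) with (ln w) by (field; lra).
      rewrite exp_ln by lra.
      apply Rmult_lt_reg_r with s; trivial.
      unfold Rdiv. rewrite Rmult_assoc, Rinv_l by lra.
      unfold w. fold s in hKb. lra. }
destruct hgen as [x0 [h0 h1]]. exists x0; split; trivial.
intros x hx. apply Rlt_le_trans with (1 := h1). apply Lam_anti; lra.
Qed.

(** The form in which (H1) is used, with beta = 1/q. The conditions are on the open half-line, where
    the one-sided derivatives of the statement are ordinary ones. *)
Record growth (g g1 g2 : R -> R) (t0 beta : R) : Prop := {
  growth_t0 : 0 <= t0;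
  growth_d1 : forall t, t0 < t -> is_derive g t (g1 t);
  growth_d2 : forall t, t0 < t -> is_derive g1 t (g2 t);
  growth_g1 : forall t, t0 < t -> 0 < g1 t;
  growth_g2 : forall t, t0 < t -> 0 < g2 t;
  growth_beta : 1 / 2 < beta <= 1;
  growth_lim : forall eps, 0 < eps -> exists B, t0 < B /\
    forall t, B <= t -> Rabs (g t * g2 t / (g1 t) ^ 2 - beta) <= eps
}.

Arguments growth_t0 {_ _ _ _ _} _.
Arguments growth_d1 {_ _ _ _ _} _.
Arguments growth_d2 {_ _ _ _ _} _.
Arguments growth_g1 {_ _ _ _ _} _.
Arguments growth_g2 {_ _ _ _ _} _.
Arguments growth_beta {_ _ _ _ _} _.
Arguments growth_lim {_ _ _ _ _} _.

Section Growth.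
Context {g g1 g2 : R -> R} {t0 beta : R} (HG : growth g g1 g2 t0 beta).

Lemma g1_le (s t : R) : t0 < s -> s <= t -> g1 s <= g1 t.
Proof.
intros hs hst. apply (derive_ge0_le g1 g2); trivial.
- intros x hx; apply (growth_d2 HG); lra.
- intros x hx. left; apply (growth_g2 HG); lra.
Qed.

Lemma g_convex_lower (s t : R) : t0 < s -> s <= t -> g1 s * (t - s) <= g t - g s.
Proof.
intros hs hst. apply (derive_ge_incr g g1); trivial.
- intros x hx; apply (growth_d1 HG); lra.
- intros x hx. apply g1_le; lra.
Qed.

Lemma g_convex_upper (s t : R) : t0 < s -> s <= t -> g t - g s <= g1 t * (t - s).
Proof.
intros hs hst. apply (derive_le_incr g g1); trivial.
- intros x hx; apply (growth_d1 HG); lra.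
- intros x hx. apply g1_le; lra.
Qed.

Lemma g_lt (s t : R) : t0 < s -> s < t -> g s < g t.
Proof.
intros hs hst. assert (h := g_convex_lower s t hs ltac:(lra)).
assert (h1 := growth_g1 HG s hs). nra.
Qed.

Lemma g_le (s t : R) : t0 < s -> s <= t -> g s <= g t.
Proof. intros hs [h|h]; [left; now apply g_lt|subst; lra]. Qed.

Lemma g_le_inv (s t : R) : t0 < s -> t0 < t -> g s <= g t -> s <= t.
Proof.
intros hs ht h. apply Rnot_lt_le; intros hlt. assert (g t < g s) by now apply g_lt. lra.
Qed.

Lemma g_lt_inv (s t : R) : t0 < s -> t0 < t -> g s < g t -> s < t.
Proof.
intros hs ht h. apply Rnot_le_lt; intros hle. assert (g t <= g s) by now apply g_le. lra.
Qed.

Lemma g_unbounded (K : R) : exists B, t0 < B /\ forall t, B <= t -> K <= g t.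
Proof.
pose (s := t0 + 1).
assert (hs : t0 < s) by (unfold s; lra).
assert (h1 := growth_g1 HG s hs).
exists (s + Rabs (K - g s) / g1 s).
assert (0 <= Rabs (K - g s) / g1 s).
{ apply Rmult_le_pos; [apply Rabs_pos|left; now apply Rinv_0_lt_compat]. }
split; [lra|].
intros t ht. assert (h := g_convex_lower s t hs ltac:(lra)).
assert (g1 s * (Rabs (K - g s) / g1 s) <= g1 s * (t - s)) by (apply Rmult_le_compat_l; lra).
replace (g1 s * (Rabs (K - g s) / g1 s)) with (Rabs (K - g s)) in H0 by (field; lra).
assert (h2 := Rle_abs (K - g s)). lra.
Qed.

Lemma g_IVT (B m v : R) : t0 < B -> B <= m -> g B <= v <= g m ->
  exists u, B <= u <= m /\ g u = v.
Proof.
intros hB hBm hv.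
destruct (IVT_decr (fun s => - g s) B m (- v)) as [s [h1 h2]]; try lra.
- intros s hs. apply (continuous_opp g). apply @ex_derive_continuous.
  eexists; apply (growth_d1 HG); lra.
- exists s; split; lra.
Qed.

Lemma g_surj (m v : R) : t0 < m -> g m <= v -> exists u, m <= u /\ g u = v.
Proof.
intros hm hv. destruct (g_unbounded v) as [B [hB hB2]].
destruct (g_IVT m (Rmax B m) v) as [u [hu1 hu2]]; trivial.
- apply Rmax_r.
- split; trivial. apply hB2, Rmax_l.
- exists u; lra.
Qed.

Lemma g_scale_bounds (eps : R) : 0 < eps -> exists B, t0 < B /\
  forall t, B <= t -> 1 <= g t /\ Rabs (g t * g2 t / (g1 t) ^ 2 - beta) <= eps.
Proof.
intros he. destruct (growth_lim HG eps he) as [B1 [h1 h1']].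
destruct (g_unbounded 1) as [B2 [h2 h2']].
exists (Rmax B1 B2). split.
- apply Rlt_le_trans with B1; [trivial|apply Rmax_l].
- intros t ht. assert (h3 := Rmax_l B1 B2). assert (h4 := Rmax_r B1 B2).
  split; [apply h2'|apply h1']; lra.
Qed.

(** The quantity is about [beta / g], and [g] is unbounded because it is convex and increasing. *)
Lemma kap_small (eps : R) : 0 < eps -> exists B, t0 < B /\
  forall t, B <= t -> 0 < g2 t / (g1 t) ^ 2 <= eps.
Proof.
intros he. destruct (g_scale_bounds 1 ltac:(lra)) as [B1 [h1 h1']].
destruct (g_unbounded (2 / eps)) as [B2 [h2 h2']].
assert (h3 := Rmax_l B1 B2). assert (h4 := Rmax_r B1 B2).
exists (Rmax B1 B2). split; [lra|].
intros t ht. destruct (h1' t ltac:(lra)) as [ha hb].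
specialize (h2' t ltac:(lra)).
assert (hg1 := growth_g1 HG t ltac:(lra)).
assert (hg2 := growth_g2 HG t ltac:(lra)).
assert (hb1 := growth_beta HG).
assert (hp : 0 < (g1 t) ^ 2) by (apply pow_lt; lra).
set (k := g2 t / (g1 t) ^ 2).
assert (hk : 0 < k) by (apply Rmult_lt_0_compat; [lra|now apply Rinv_0_lt_compat]).
split; trivial.
replace (g t * g2 t / g1 t ^ 2) with (g t * k) in hb by (unfold k; field; lra).
assert (h5 := Rle_abs (g t * k - beta)).
assert (h6 : 2 / eps * k <= g t * k) by (apply Rmult_le_compat_r; lra).
apply Rmult_le_reg_l with (2 / eps).
- apply Rmult_lt_0_compat; [lra|now apply Rinv_0_lt_compat].
- replace (2 / eps * eps) with 2 by (field; lra). lra.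
Qed.

(** With respect to [ln g], the function [ln g1] has derivative [g g2 / g1^2], which is close to
    [beta]. *)
Lemma ln_g1_bounds (eps : R) : 0 < eps -> exists B, t0 < B /\
  (forall t, B <= t -> 1 <= g t) /\
  forall u m, B <= u <= m ->
    (beta - eps) * (ln (g m) - ln (g u)) <= ln (g1 m) - ln (g1 u)
      <= (beta + eps) * (ln (g m) - ln (g u)).
Proof.
intros he. destruct (g_scale_bounds eps he) as [B [hB hB']].
exists B. split; [trivial|]. split; [intros t ht; apply (hB' t ht)|].
assert (hd : forall k u m, B <= u <= m -> forall x, u <= x <= m ->
   is_derive (fun v => ln (g1 v) - k * ln (g v)) x
     (g1 x / g x * (g x * g2 x / (g1 x) ^ 2 - k))).
{ intros k u m hum x hx.
  assert (hg := proj1 (hB' x ltac:(lra))).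
  assert (hg1 := growth_g1 HG x ltac:(lra)).
  assert (d1 := growth_d1 HG x ltac:(lra)).
  assert (d2 := growth_d2 HG x ltac:(lra)).
  auto_derive.
  - repeat split; trivial; try lra; eexists; eassumption.
  - rewrite (Derive_eta d1), (Derive_eta d2). field. lra. }
assert (hpos : forall x, B <= x -> 0 <= g1 x / g x).
{ intros x hx. assert (hg := proj1 (hB' x ltac:(lra))).
  assert (hg1 := growth_g1 HG x ltac:(lra)).
  apply Rmult_le_pos; [lra|left; apply Rinv_0_lt_compat; lra]. }
intros u m hum. split.
- assert (h : ln (g1 u) - (beta - eps) * ln (g u) <= ln (g1 m) - (beta - eps) * ln (g m)).
  { apply (derive_ge0_le _ _ u m ltac:(lra) (hd (beta - eps) u m hum)).
    intros x hx. apply Rmult_le_pos; [apply hpos; lra|].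
    assert (h := proj2 (hB' x ltac:(lra))). apply Rabs_le_between in h. lra. }
  lra.
- assert (h : - (ln (g1 u) - (beta + eps) * ln (g u)) <= - (ln (g1 m) - (beta + eps) * ln (g m))).
  { apply (derive_ge0_le (fun v => - (ln (g1 v) - (beta + eps) * ln (g v)))
       (fun x => - (g1 x / g x * (g x * g2 x / (g1 x) ^ 2 - (beta + eps)))) u m); [lra|..].
    - intros x hx. apply (is_derive_opp (fun v => ln (g1 v) - (beta + eps) * ln (g v))).
      now apply (hd _ u m).
    - intros x hx. specialize (hpos x ltac:(lra)).
      assert (h := proj2 (hB' x ltac:(lra))). apply Rabs_le_between in h. nra. }
  lra.
Qed.

Lemma g1_unbounded (K : R) : exists B, t0 < B /\ forall t, B <= t -> K <= g1 t.
Proof.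
assert (hb1 := growth_beta HG).
destruct (ln_g1_bounds (1/4) ltac:(lra)) as [B1 [h1 [h1' h1'']]].
set (K' := Rmax K 1).
assert (hK := Rmax_l K 1). assert (hK1 := Rmax_r K 1). fold K' in hK, hK1.
destruct (g_unbounded (exp (ln (g B1) + 4 * Rabs (ln K' - ln (g1 B1))))) as [B2 [h2 h2']].
assert (h3 := Rmax_l B1 B2). assert (h4 := Rmax_r B1 B2).
exists (Rmax B1 B2). split; [lra|].
intros t ht. specialize (h2' t ltac:(lra)).
destruct (h1'' B1 t ltac:(lra)) as [h5 _].
assert (h6 : ln (g B1) + 4 * Rabs (ln K' - ln (g1 B1)) <= ln (g t)).
{ rewrite <- (ln_exp (ln (g B1) + _)). apply ln_le; [apply exp_pos|trivial]. }
assert (h7 := Rle_abs (ln K' - ln (g1 B1))).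
assert (h7' := Rabs_pos (ln K' - ln (g1 B1))).
assert (h8 : ln K' <= ln (g1 t)) by nra.
apply Rle_trans with (1 := hK).
assert (hg1 := growth_g1 HG t ltac:(lra)).
destruct (Rle_lt_dec K' (g1 t)) as [|hlt]; trivial.
assert (ln (g1 t) < ln K') by (apply ln_increasing; lra). lra.
Qed.

(** Precise form of [g1] being like [g^beta]: uniform as long as the ratio of levels stays in
    [c,1]. *)
Lemma g1_ratio (eps c : R) : 0 < eps < 1 -> 0 < c < 1 -> exists B, t0 < B /\
  (forall t, B <= t -> 1 <= g t) /\
  forall u m, B <= u <= m -> c * g m <= g u ->
    1 - eps <= g1 u / g1 m * Rpower (g u / g m) (- beta) <= 1 + eps.
Proof.
intros he hc.
assert (hlc : 0 < - ln c).
{ assert (ln c < ln 1) by (apply ln_increasing; lra). rewrite ln_1 in H; lra. }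
assert (hle : 0 < ln (1 + eps)) by (rewrite <- ln_1; apply ln_increasing; lra).
assert (hle2 : ln (1 + eps) <= eps).
{ apply Rle_trans with (ln (exp eps)); [|rewrite ln_exp; lra].
  apply ln_le; [lra|apply exp_ineq1_le]. }
(* The logarithmic error is [e] times a log-ratio of levels, itself at most [- ln c]; so it is at
   most [ln (1 + eps)]. *)
pose (e := ln (1 + eps) / (- ln c)).
assert (hepos : 0 < e) by (apply Rmult_lt_0_compat; [lra|now apply Rinv_0_lt_compat]).
destruct (ln_g1_bounds e hepos) as [B [h1 [h2 h3]]].
exists B. split; [trivial|split; [trivial|]].
intros u m hum hcu.
assert (hgm := h2 m ltac:(lra)). assert (hgu := h2 u ltac:(lra)).
assert (hg1u := growth_g1 HG u ltac:(lra)).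
assert (hg1m := growth_g1 HG m ltac:(lra)).
destruct (h3 u m hum) as [h4 h5].
set (L := ln (g m) - ln (g u)) in *.
assert (hL : 0 <= L).
{ assert (ln (g u) <= ln (g m)) by (apply ln_le; [lra|apply g_le; lra]). unfold L; lra. }
assert (hL2 : L <= - ln c).
{ assert (ln (c * g m) <= ln (g u)) by (apply ln_le; [nra|trivial]).
  rewrite ln_mult in H by lra. unfold L; lra. }
assert (heL : e * L <= ln (1 + eps)).
{ replace (ln (1 + eps)) with (e * (- ln c)) by (unfold e; field; lra).
  apply Rmult_le_compat_l; lra. }
pose (w := beta * L - (ln (g1 m) - ln (g1 u))).
assert (hw : g1 u / g1 m * Rpower (g u / g m) (- beta) = exp w).
{ unfold Rpower. rewrite ln_div by lra.
  replace w with ((ln (g1 u) + - ln (g1 m)) + (- beta * (ln (g u) - ln (g m))))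
    by (unfold w, L; ring).
  rewrite exp_plus, exp_plus, exp_Ropp, !exp_ln by lra. reflexivity. }
assert (hwl : - (e * L) <= w <= e * L) by (unfold w; split; lra).
clearbody w. rewrite hw. split.
- apply Rle_trans with (1 + w); [lra|apply exp_ineq1_le].
- rewrite <- (exp_ln (1 + eps)) by lra.
  destruct (Req_dec w (ln (1 + eps))) as [->|hne]; [lra|].
  left; apply exp_increasing. lra.
Qed.

(** As a function of [u], the difference vanishes at [u = m] and has derivative [g1 m / g m] times
    the error controlled by [g1_ratio]. Hence [Lam] is the universal profile of the distance to [m],
    in units of [g m / g1 m]. *)
Lemma g_gap (eps c : R) : 0 < eps -> 0 < c < 1 -> exists B, t0 < B /\
  (forall t, B <= t -> 1 <= g t) /\
  forall u m, B <= u <= m -> c * g m <= g u ->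
    Rabs ((m - u) * g1 m / g m - Lam beta (g u / g m)) <= eps.
Proof.
intros he hc.
assert (hLc : 0 <= Lam beta c) by (apply Lam_ge0; lra).
(* Integration only gives an error [e * T] with [T] the unknown distance; [e <= 1/2] bounds [T] by
   [2 * Lam beta c], and the second entry then makes [e * T <= eps]. *)
pose (e := Rmin (1 / 2) (eps / (2 * (Lam beta c + 1)))).
assert (hq : 0 < eps / (2 * (Lam beta c + 1))).
{ apply Rmult_lt_0_compat; [lra|apply Rinv_0_lt_compat; lra]. }
assert (he1 : 0 < e) by (apply Rmin_glb_lt; lra).
assert (he2 : e <= 1 / 2) by apply Rmin_l.
assert (he3 : e * (2 * (Lam beta c + 1)) <= eps).
{ apply Rle_trans with (eps / (2 * (Lam beta c + 1)) * (2 * (Lam beta c + 1))).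
  - apply Rmult_le_compat_r; [lra|apply Rmin_r].
  - right; field; lra. }
destruct (g1_ratio e c ltac:(lra) hc) as [B [h1 [h2 h3]]].
exists B. split; [trivial|split; [trivial|]].
intros u m hum hcu.
assert (hgm := h2 m ltac:(lra)).
assert (hg1m := growth_g1 HG m ltac:(lra)).
pose (D := fun v => (m - v) * g1 m / g m - Lam beta (g v / g m)).
pose (dD := fun v => g1 m / g m * (g1 v / g1 m * Rpower (g v / g m) (- beta) - 1)).
assert (hd : forall x, u <= x <= m -> is_derive D x (dD x)).
{ intros x hx.
  assert (hg := h2 x ltac:(lra)).
  assert (d1 := growth_d1 HG x ltac:(lra)).
  assert (d2 : is_derive (Lam beta) (g x / g m) (- Rpower (g x / g m) (- beta))).
  { apply Lam_derive. apply Rmult_lt_0_compat; [lra|apply Rinv_0_lt_compat; lra]. }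
  unfold D. auto_derive.
  - repeat split; trivial; eexists; eassumption.
  - unfold Rdiv in d2. rewrite (Derive_eta d1), (Derive_eta d2).
    unfold dD, Rdiv. field. lra. }
assert (hb : forall x, u <= x <= m -> Rabs (dD x) <= g1 m / g m * e).
{ intros x hx. unfold dD. rewrite Rabs_mult.
  assert (0 < g1 m / g m) by (apply Rmult_lt_0_compat; [lra|apply Rinv_0_lt_compat; lra]).
  rewrite (Rabs_pos_eq (g1 m / g m)) by lra.
  apply Rmult_le_compat_l; [lra|]. apply Rabs_le_between.
  assert (h := h3 x m ltac:(lra)).
  assert (g u <= g x) by (apply g_le; lra). specialize (h ltac:(lra)). lra. }
assert (hDm : D m = 0).
{ unfold D. replace (g m / g m) with 1 by (field; lra). rewrite Lam_1. unfold Rdiv; ring. }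
set (T := (m - u) * g1 m / g m).
assert (hDu : Rabs (D u) <= e * T).
{ apply Rabs_le_between.
  assert (i1 : - (g1 m / g m * e) * (m - u) <= D m - D u).
  { apply (derive_ge_incr D dD); [lra|trivial|].
    intros x hx. specialize (hb x hx). apply Rabs_le_between in hb. lra. }
  assert (i2 : D m - D u <= (g1 m / g m * e) * (m - u)).
  { apply (derive_le_incr D dD); [lra|trivial|].
    intros x hx. specialize (hb x hx). apply Rabs_le_between in hb. lra. }
  replace (g1 m / g m * e * (m - u)) with (e * T) in i2 by (unfold T; field; lra).
  replace (- (g1 m / g m * e) * (m - u)) with (- (e * T)) in i1 by (unfold T; field; lra).
  lra. }
assert (hL : Lam beta (g u / g m) <= Lam beta c).
{ apply Lam_anti; [lra|]. apply Rmult_le_reg_r with (g m); [lra|].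
  unfold Rdiv. rewrite Rmult_assoc, Rinv_l by lra. lra. }
change ((m - u) * g1 m / g m - Lam beta (g u / g m)) with (D u).
assert (hT : D u = T - Lam beta (g u / g m)) by reflexivity.
apply Rabs_le_between in hDu.
assert (hT0 : 0 <= T).
{ unfold T. apply Rmult_le_pos; [nra|left; apply Rinv_0_lt_compat; lra]. }
apply Rle_trans with (e * T); [apply Rabs_le_between; lra|].
apply Rle_trans with (2 := he3). apply Rmult_le_compat_l; nra.
Qed.

End Growth.

(** * Radial solutions and the Pohozaev bound *)

Record weight (h h1 : R -> R) (hm hM H : R) : Prop := {
  weight_hm : 0 < hm;
  weight_H : 0 <= H;
  weight_d : forall r, 0 < r < 1 -> is_derive h r (h1 r);
  weight_bounds : forall r, 0 < r < 1 -> hm <= h r <= hM;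
  weight_log : forall r, 0 < r < 1 -> Rabs (h1 r) <= H * h r
}.

Arguments weight_hm {_ _ _ _ _} _.
Arguments weight_H {_ _ _ _ _} _.
Arguments weight_d {_ _ _ _ _} _.
Arguments weight_bounds {_ _ _ _ _} _.
Arguments weight_log {_ _ _ _ _} _.

(* Radial solutions in the variable [s = ln r]: [U s = u (exp s)] and
   [Y s = - r u' r], so that the equation reads [U' = - Y],
   [Y' = lam r^2 h f(U)] on [s < 0], the origin being [s = -oo]. *)
Record sol (h f : R -> R) (lam mu : R) (U Y : R -> R) : Prop := {
  sol_lam : 0 < lam;
  sol_dU : forall s, s < 0 -> is_derive U s (- Y s);
  sol_dY : forall s, s < 0 ->
    is_derive Y s (lam * exp (2 * s) * h (exp s) * f (U s));
  sol_pos : forall s, s < 0 -> 0 < U s;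
  sol_limU : is_lim U m_infty mu;
  sol_limY : is_lim Y m_infty 0;
  sol_end : forall B, 0 < B -> exists s, s < 0 /\ U s <= B
}.

Arguments sol_lam {_ _ _ _ _ _} _.
Arguments sol_dU {_ _ _ _ _ _} _.
Arguments sol_dY {_ _ _ _ _ _} _.
Arguments sol_pos {_ _ _ _ _ _} _.
Arguments sol_limU {_ _ _ _ _ _} _.
Arguments sol_limY {_ _ _ _ _ _} _.
Arguments sol_end {_ _ _ _ _ _} _.

Definition kapf (g1 g2 : R -> R) (t : R) : R := g2 t / (g1 t) ^ 2.

Definition thf (h h1 : R -> R) (s : R) : R := exp s * h1 (exp s) / h (exp s).

Definition zf (g1 U Y : R -> R) (s : R) : R := g1 (U s) * Y s.

Definition rhof (h g g1 : R -> R) (lam : R) (U : R -> R) (s : R) : R :=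
  lam * exp (2 * s) * h (exp s) * exp (g (U s)) * g1 (U s).

(* The first integral of the limiting system [z' = rho], [rho' = rho (2 - z)]. *)
Definition Qf (h g g1 : R -> R) (lam : R) (U Y : R -> R) (s : R) : R :=
  (zf g1 U Y s - 2) ^ 2 / 2 + rhof h g g1 lam U s.

Lemma is_lim0_dom (F G : R -> R) (C b : R) :
  is_lim G m_infty 0 -> (forall t, t <= b -> Rabs (F t) <= C * G t) ->
  is_lim F m_infty 0.
Proof.
intros hG hF.
assert (hCG : is_lim (fun t => C * G t) m_infty 0).
{ replace (Finite 0) with (Rbar_mult C 0) by (simpl; f_equal; ring).
  now apply is_lim_scal_l. }
apply (is_lim_le_le_loc (fun t => - (C * G t)) (fun t => C * G t)).
- exists b. intros t ht. specialize (hF t ltac:(lra)). apply Rabs_le_between in hF. lra.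
- replace (Finite 0) with (Rbar_opp 0) by (simpl; f_equal; ring).
  now apply is_lim_opp.
- trivial.
Qed.

Lemma exp_neg_lt1 (s : R) : s < 0 -> 0 < exp s < 1.
Proof. intros hs. split; [apply exp_pos|now apply exp_lt_1]. Qed.

Section Solution.
Context {f g g1 g2 : R -> R} {t0 beta : R} (HG : growth g g1 g2 t0 beta).
Context (Hf0 : forall t, 0 <= t -> 0 <= f t).
Context (Hf : forall t, t0 < t -> f t = exp (g t)).
Context {h h1 : R -> R} {hm hM H : R} (HW : weight h h1 hm hM H).

Section Sol.
Context {lam mu : R} {U Y : R -> R} (HS : sol h f lam mu U Y).

Local Notation kap := (kapf g1 g2).
Local Notation th := (thf h h1).
Local Notation z := (zf g1 U Y).
Local Notation rho := (rhof h g g1 lam U).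
Local Notation Q := (Qf h g g1 lam U Y).

Lemma h_pos (s : R) : s < 0 -> 0 < h (exp s).
Proof.
intros hs. assert (i := weight_hm HW).
assert (j := weight_bounds HW (exp s) (exp_neg_lt1 s hs)). lra.
Qed.

Lemma th_le (s : R) : s < 0 -> Rabs (th s) <= H * exp s.
Proof.
intros hs. assert (hp := h_pos s hs).
assert (j := weight_log HW (exp s) (exp_neg_lt1 s hs)).
assert (he := exp_pos s).
unfold thf, Rdiv. rewrite !Rabs_mult, (Rabs_pos_eq (exp s)), Rabs_inv, (Rabs_pos_eq (h (exp s))) by lra.
apply Rmult_le_reg_r with (h (exp s)); trivial.
rewrite Rmult_assoc, Rinv_l, Rmult_1_r by lra.
nra.
Qed.

Lemma dY_ge0 (s : R) : s < 0 -> 0 <= lam * exp (2 * s) * h (exp s) * f (U s).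
Proof.
intros hs. assert (i := sol_lam HS).
assert (j := h_pos s hs). assert (k := exp_pos (2 * s)).
assert (l := Hf0 (U s) (Rlt_le _ _ (sol_pos HS s hs))).
apply Rmult_le_pos; trivial. apply Rmult_le_pos; [|lra]. apply Rmult_le_pos; lra.
Qed.

Lemma Y_ge0 (s : R) : s < 0 -> 0 <= Y s.
Proof.
intros hs. apply (derive_ge0_lim_le Y (fun t => lam * exp (2 * t) * h (exp t) * f (U t))).
- intros x hx. apply (sol_dY HS); lra.
- intros x hx. apply dY_ge0; lra.
- apply (sol_limY HS).
Qed.

Lemma Y_le (s t : R) : s <= t < 0 -> Y s <= Y t.
Proof.
intros hst. apply (derive_ge0_le Y (fun t => lam * exp (2 * t) * h (exp t) * f (U t))).
- lra.
- intros x hx. apply (sol_dY HS); lra.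
- intros x hx. apply dY_ge0; lra.
Qed.

Lemma U_anti (s t : R) : s <= t < 0 -> U t <= U s.
Proof.
intros hst. enough (- U s <= - U t) by lra.
apply (derive_ge0_le (fun x => - U x) (fun x => - - Y x)); [lra|..].
- intros x hx. apply (is_derive_opp U). apply (sol_dU HS); lra.
- intros x hx. assert (i := Y_ge0 x ltac:(lra)). lra.
Qed.

Lemma U_le_mu (s : R) : s < 0 -> U s <= mu.
Proof.
intros hs. enough (- mu <= - U s) by lra.
apply (derive_ge0_lim_le (fun x => - U x) (fun x => - - Y x)).
- intros x hx. apply (is_derive_opp U). apply (sol_dU HS); lra.
- intros x hx. assert (i := Y_ge0 x ltac:(lra)). lra.
- apply (is_lim_opp U m_infty mu), (sol_limU HS).
Qed.

Lemma U_drop (s t : R) : s <= t < 0 -> Y s * (t - s) <= U s - U t <= Y t * (t - s).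
Proof.
intros hst. split.
- enough (- Y t * (t - s) <= U t - U s /\ U t - U s <= - Y s * (t - s)) by lra.
  split; [apply (derive_ge_incr U (fun x => - Y x)) | apply (derive_le_incr U (fun x => - Y x))];
   try lra; intros x hx; try (apply (sol_dU HS); lra).
  + assert (i := Y_le x t ltac:(lra)). lra.
  + assert (i := Y_le s x ltac:(lra)). lra.
- enough (- Y t * (t - s) <= U t - U s) by lra.
  apply (derive_ge_incr U (fun x => - Y x));
   try lra; intros x hx; try (apply (sol_dU HS); lra).
  assert (i := Y_le x t ltac:(lra)). lra.
Qed.

Lemma U_cont (s : R) : s < 0 -> continuous U s.
Proof.
intros hs. apply @ex_derive_continuous. eexists. now apply (sol_dU HS).
Qed.

Lemma level_after (s B : R) : s < 0 -> t0 < B <= U s -> exists t, s <= t < 0 /\ U t = B.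
Proof.
intros hs hB. assert (ht0 := growth_t0 HG).
destruct (sol_end HS B ltac:(lra)) as [s2 [h2 h3]].
destruct (Rle_dec s2 s) as [hle|hgt].
- exists s. assert (i := U_anti s2 s ltac:(lra)). lra.
- destruct (IVT_decr U s s2 B) as [t [k1 k2]]; try lra.
  + intros x hx; apply U_cont; lra.
  + exists t; lra.
Qed.

Lemma level_exists (B : R) : t0 < B < mu -> exists t, t < 0 /\ U t = B.
Proof.
intros hB.
assert (i := sol_limU HS). apply is_lim_spec in i.
destruct (i (mkposreal (mu - B) ltac:(lra))) as [M hM']. simpl in hM'.
pose (s := Rmin M 0 - 1).
assert (j := Rmin_l M 0). assert (k := Rmin_r M 0).
specialize (hM' s ltac:(unfold s; lra)). apply Rabs_def2 in hM'.
destruct (level_after s B) as [t [h2 h3]]; [unfold s; lra|lra|].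
exists t; lra.
Qed.

Lemma rho_pos (s : R) : s < 0 -> t0 < U s -> 0 < rho s.
Proof.
intros hs hU. assert (i := sol_lam HS).
assert (j := h_pos s hs). assert (k := exp_pos (2 * s)).
assert (l := growth_g1 HG _ hU). assert (m := exp_pos (g (U s))).
unfold rhof. repeat apply Rmult_lt_0_compat; trivial.
Qed.

Lemma Y_derive (s : R) : s < 0 -> t0 < U s -> is_derive Y s (rho s / g1 (U s)).
Proof.
intros hs hU. assert (l := growth_g1 HG _ hU).
replace (rho s / g1 (U s)) with (lam * exp (2 * s) * h (exp s) * f (U s)).
- now apply (sol_dY HS).
- rewrite (Hf _ hU). unfold rhof. field. lra.
Qed.

Lemma Y_pos (s : R) : s < 0 -> t0 < U s -> 0 < Y s.
Proof.
intros hs hU.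
assert (i := sol_lam HS). assert (hmp := weight_hm HW).
pose (k := lam * exp (2 * (s - 1)) * hm * exp (g (U s))).
assert (hk : 0 < k).
{ unfold k. repeat apply Rmult_lt_0_compat; trivial; apply exp_pos. }
assert (hd : k * (s - (s - 1)) <= Y s - Y (s - 1)).
{ apply (derive_ge_incr Y (fun t => lam * exp (2 * t) * h (exp t) * f (U t))); [lra|..].
  - intros x hx. apply (sol_dY HS); lra.
  - intros x hx. assert (hUx := U_anti x s ltac:(lra)).
    rewrite (Hf (U x)) by lra. unfold k.
    assert (e1 : exp (2 * (s - 1)) <= exp (2 * x)) by (apply exp_le; lra).
    assert (e2 : exp (g (U s)) <= exp (g (U x))).
    { apply exp_le. apply (g_le HG); lra. }
    assert (e3 := weight_bounds HW (exp x) (exp_neg_lt1 x ltac:(lra))).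
    assert (p1 := exp_pos (2 * (s - 1))). assert (p2 := exp_pos (g (U s))).
    apply Rmult_le_compat; trivial; [|lra|].
    + apply Rmult_le_pos; [apply Rmult_le_pos|]; lra.
    + apply Rmult_le_compat; try lra; [apply Rmult_le_pos; lra|].
      apply Rmult_le_compat_l; lra. }
assert (j := Y_ge0 (s - 1) ltac:(lra)). lra.
Qed.

Lemma z_pos (s : R) : s < 0 -> t0 < U s -> 0 < z s.
Proof.
intros hs hU. apply Rmult_lt_0_compat; [now apply (growth_g1 HG)|now apply Y_pos].
Qed.

Lemma kap_pos (t : R) : t0 < t -> 0 < kap t.
Proof.
intros ht. apply Rmult_lt_0_compat; [now apply (growth_g2 HG)|].
apply Rinv_0_lt_compat, pow_lt. now apply (growth_g1 HG).
Qed.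

Lemma gU_derive (s : R) : s < 0 -> t0 < U s -> is_derive (fun t => g (U t)) s (- z s).
Proof.
intros hs hU.
assert (d1 := growth_d1 HG _ hU). assert (dU := sol_dU HS s hs).
auto_derive; [repeat split; eexists; eassumption|].
rewrite (Derive_eta d1), (Derive_eta dU). unfold zf; ring.
Qed.

Lemma lng1U_derive (s : R) : s < 0 -> t0 < U s ->
  is_derive (fun t => ln (g1 (U t))) s (- (kap (U s) * z s)).
Proof.
intros hs hU. assert (l := growth_g1 HG _ hU).
assert (d1 := growth_d2 HG _ hU). assert (dU := sol_dU HS s hs).
auto_derive; [repeat split; trivial; eexists; eassumption|].
rewrite (Derive_eta d1), (Derive_eta dU). unfold kapf, zf. field. lra.
Qed.

Lemma z_derive (s : R) : s < 0 -> t0 < U s ->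
  is_derive z s (rho s - kap (U s) * (z s) ^ 2).
Proof.
intros hs hU. assert (l := growth_g1 HG _ hU).
assert (d1 := growth_d2 HG _ hU). assert (dU := sol_dU HS s hs).
assert (dY := Y_derive s hs hU).
unfold zf at 1. auto_derive; [repeat split; trivial; eexists; eassumption|].
rewrite (Derive_eta d1), (Derive_eta dU), (Derive_eta dY).
unfold kapf, zf. field. lra.
Qed.

Lemma rho_derive (s : R) : s < 0 -> t0 < U s ->
  is_derive rho s (rho s * (2 + th s - z s - kap (U s) * z s)).
Proof.
intros hs hU. assert (l := growth_g1 HG _ hU).
assert (d1 := growth_d1 HG _ hU).
assert (d2 := growth_d2 HG _ hU). assert (dU := sol_dU HS s hs).
assert (dh := weight_d HW (exp s) (exp_neg_lt1 s hs)).
assert (hp := h_pos s hs).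
unfold rhof at 1. auto_derive; [repeat split; trivial; eexists; eassumption|].
rewrite (Derive_eta d1), (Derive_eta d2), (Derive_eta dU), (Derive_eta dh).
unfold rhof, kapf, thf, zf. field. lra.
Qed.

Lemma z_cont (s : R) : s < 0 -> t0 < U s -> continuous z s.
Proof. intros hs hU. apply @ex_derive_continuous. eexists. now apply z_derive. Qed.

Lemma Q_derive (s : R) : s < 0 -> t0 < U s ->
  is_derive Q s (rho s * th s - kap (U s) * z s * ((z s - 2) * z s + rho s)).
Proof.
intros hs hU. assert (d1 := z_derive s hs hU). assert (d2 := rho_derive s hs hU).
unfold Qf. auto_derive; [repeat split; trivial; eexists; eassumption|].
rewrite (Derive_eta d1), (Derive_eta d2). field.
Qed.

Lemma ln_rho (s : R) : s < 0 -> t0 < U s ->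
  ln (rho s) = ln lam + 2 * s + ln (h (exp s)) + g (U s) + ln (g1 (U s)).
Proof.
intros hs hU. assert (i := sol_lam HS).
assert (j := h_pos s hs). assert (k := exp_pos (2 * s)).
assert (l := growth_g1 HG _ hU). assert (m := exp_pos (g (U s))).
unfold rhof. rewrite !ln_mult; trivial; repeat apply Rmult_lt_0_compat; trivial.
rewrite !ln_exp. reflexivity.
Qed.

Lemma ln_h_diff (s t : R) : s < 0 -> t < 0 -> ln (h (exp s)) - ln (h (exp t)) <= ln hM - ln hm.
Proof.
intros hs ht. assert (i := weight_hm HW).
assert (j := weight_bounds HW (exp s) (exp_neg_lt1 s hs)).
assert (k := weight_bounds HW (exp t) (exp_neg_lt1 t ht)).
assert (ln (h (exp s)) <= ln hM) by (apply ln_le; lra).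
assert (ln hm <= ln (h (exp t))) by (apply ln_le; lra). lra.
Qed.

(** Because [U' = - Y], the derivative of [Y^2] with respect to [U] is [- 2 rho / g1 U]. Working
    with the square lets the drop of [U] replace the elapsed time, which is not controlled here. *)
Lemma Y_sq_incr (s t tau : R) : s <= t < 0 -> t0 < U t ->
  (forall x, s <= x <= t -> rho x <= tau) ->
  (Y t) ^ 2 - (Y s) ^ 2 <= 2 * tau * (U s - U t) / g1 (U t).
Proof.
intros hst hU hr. assert (l := growth_g1 HG _ hU).
assert (hUx : forall x, s <= x <= t -> U t <= U x) by (intros x hx; apply U_anti; lra).
enough (- (Y s) ^ 2 - 2 * tau / g1 (U t) * U s <= - (Y t) ^ 2 - 2 * tau / g1 (U t) * U t).
{ replace (2 * tau * (U s - U t) / g1 (U t))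
   with (2 * tau / g1 (U t) * U s - 2 * tau / g1 (U t) * U t) by (field; lra). lra. }
apply (derive_ge0_le (fun x => - (Y x) ^ 2 - 2 * tau / g1 (U t) * U x)
  (fun x => 2 * Y x * (tau / g1 (U t) - rho x / g1 (U x)))); [lra|..].
- intros x hx. assert (hUx' := hUx x hx).
  assert (dU := sol_dU HS x ltac:(lra)).
  assert (dY := Y_derive x ltac:(lra) ltac:(lra)).
  assert (l' := growth_g1 HG (U x) ltac:(lra)).
  auto_derive; [repeat split; trivial; eexists; eassumption|].
  rewrite (Derive_eta dU), (Derive_eta dY). field. lra.
- intros x hx. specialize (hUx x hx). specialize (hr x hx).
  assert (l' := growth_g1 HG (U x) ltac:(lra)).
  assert (m := Y_ge0 x ltac:(lra)).
  assert (r0 := rho_pos x ltac:(lra) ltac:(lra)).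
  assert (ll := g1_le HG (U t) (U x) hU hUx).
  apply Rmult_le_pos; [lra|].
  enough (rho x / g1 (U x) <= tau / g1 (U t)) by lra.
  apply Rmult_le_compat; try lra.
  + left; now apply Rinv_0_lt_compat.
  + now apply Rinv_le_contravar.
Qed.

Lemma lim_Y_exp : is_lim (fun t => Y t + exp t) m_infty 0.
Proof.
replace (Finite 0) with (Finite (0 + 0)) by (f_equal; ring).
apply is_lim_plus'; [apply (sol_limY HS)|apply is_lim_exp_m].
Qed.

Lemma rho_le_exp (b t : R) : t <= b < 0 -> t0 < U b ->
  rho t <= lam * hM * exp (g mu) * g1 mu * exp t.
Proof.
intros ht hU. assert (hUt := U_anti t b ltac:(lra)).
assert (hUm := U_le_mu t ltac:(lra)).
assert (i := sol_lam HS). assert (hmp := weight_hm HW).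
assert (e3 := weight_bounds HW (exp t) (exp_neg_lt1 t ltac:(lra))).
assert (e1 : exp (2 * t) <= exp t) by (apply exp_le; lra).
assert (e2 : exp (g (U t)) <= exp (g mu)) by (apply exp_le, (g_le HG); lra).
assert (e4 : g1 (U t) <= g1 mu) by (apply (g1_le HG); lra).
assert (p1 := exp_pos (2 * t)). assert (p3 := exp_pos (g (U t))).
assert (p4 := growth_g1 HG (U t) ltac:(lra)).
replace (lam * hM * exp (g mu) * g1 mu * exp t)
 with (lam * exp t * hM * exp (g mu) * g1 mu) by ring.
unfold rhof.
assert (q1 : 0 <= lam * exp (2 * t)) by (apply Rmult_le_pos; lra).
assert (q2 : 0 <= lam * exp (2 * t) * h (exp t)) by (apply Rmult_le_pos; lra).
assert (q3 : 0 <= lam * exp (2 * t) * h (exp t) * exp (g (U t))) by (apply Rmult_le_pos; lra).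
repeat (apply Rmult_le_compat; try lra).
Qed.

(* Pohozaev's identity: [Y^2/2 + lam r^2 h f/g'] grows at rate
   [(Y'/g')(2 + th + kap z)], and [1/g'(U)] is nondecreasing along the flow. *)
Lemma pohozaev (eps Th s : R) : 0 <= Th -> s < 0 -> t0 < U s ->
  (forall t, U s <= t -> kap t <= eps) -> (forall t, t <= s -> th t <= Th) ->
  (1 - eps) * (z s) ^ 2 / 2 + rho s <= (2 + Th) * z s.
Proof.
intros hTh hs hU hk hth.
assert (l := growth_g1 HG _ hU).
assert (hUx : forall x, x <= s -> U s <= U x) by (intros x hx; apply U_anti; lra).
(* [K] is the Pohozaev deficit with [g1] frozen at the endpoint, where [g1 (U t)] is smallest; the
   factor [1 - eps] absorbs [kap]. Since [K] is nondecreasing and tends to 0 at -oo, it is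
   nonnegative at [s]; multiplying by [g1 (U s) ^ 2] gives the claim. *)
pose (E := fun t => rho t / (g1 (U t)) ^ 2).
pose (K := fun t => Y t * ((2 + Th) / g1 (U s)) - (1 - eps) * (Y t) ^ 2 / 2 - E t).
assert (hK : 0 <= K s).
{ apply (derive_ge0_lim_le K (fun t => E t *
     (g1 (U t) * ((2 + Th) / g1 (U s)) - (2 + th t) + z t * (eps - kap (U t))))).
  - intros t ht. specialize (hUx t ht).
    assert (hUt : t0 < U t) by lra.
    assert (l' := growth_g1 HG _ hUt).
    assert (d2 := growth_d2 HG _ hUt).
    assert (dU := sol_dU HS t ltac:(lra)).
    assert (dY := Y_derive t ltac:(lra) hUt).
    assert (dr := rho_derive t ltac:(lra) hUt).
    unfold K, E. auto_derive.
    + repeat split; trivial; try (eexists; eassumption). nra.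
    + rewrite (Derive_eta d2), (Derive_eta dU), (Derive_eta dY), (Derive_eta dr).
      unfold zf, kapf. field. lra.
  - intros t ht. specialize (hUx t ht).
    assert (hUt : t0 < U t) by lra.
    assert (l' := growth_g1 HG _ hUt).
    assert (ll := g1_le HG (U s) (U t) hU hUx).
    apply Rmult_le_pos.
    + apply Rmult_le_pos; [left; apply rho_pos; lra|].
      left; apply Rinv_0_lt_compat, pow_lt; trivial.
    + specialize (hk (U t) hUx). specialize (hth t ht).
      assert (zp := z_pos t ltac:(lra) hUt).
      assert (i : 2 + Th <= g1 (U t) * ((2 + Th) / g1 (U s))).
      { apply Rmult_le_reg_r with (g1 (U s)); trivial.
        replace (g1 (U t) * ((2 + Th) / g1 (U s)) * g1 (U s))
          with ((2 + Th) * g1 (U t)) by (field; lra).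
        apply Rmult_le_compat_l; lra. }
      assert (j : 0 <= z t * (eps - kap (U t))) by (apply Rmult_le_pos; lra).
      lra.
  - assert (hlY := sol_limY HS). apply is_lim_spec in hlY.
    destruct (hlY (mkposreal 1 Rlt_0_1)) as [M hM1]. simpl in hM1.
    pose (C1 := (2 + Th) / g1 (U s) + Rabs (1 - eps)).
    pose (C2 := lam * hM * exp (g mu) * g1 mu / (g1 (U s)) ^ 2).
    (* Far to the left [Y < 1], so the quadratic term is dominated by a multiple of [Y], and [E] by
       a multiple of [exp t]. *)
    apply (is_lim0_dom K (fun t => Y t + exp t) (C1 + C2) (Rmin (M - 1) s) lim_Y_exp).
    intros t ht. assert (m1 := Rmin_l (M - 1) s). assert (m2 := Rmin_r (M - 1) s).
    specialize (hM1 t ltac:(lra)). apply Rabs_def2 in hM1.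
    specialize (hUx t ltac:(lra)).
    assert (Yp := Y_ge0 t ltac:(lra)).
    assert (l' := growth_g1 HG (U t) ltac:(lra)).
    assert (ll := g1_le HG (U s) (U t) hU hUx).
    assert (rp := rho_pos t ltac:(lra) ltac:(lra)).
    assert (rl := rho_le_exp s t ltac:(lra) hU).
    assert (hE : 0 <= E t <= C2 * exp t).
    { assert (0 < (g1 (U s)) ^ 2) by now apply pow_lt.
      assert ((g1 (U s)) ^ 2 <= (g1 (U t)) ^ 2) by (apply pow_incr; lra).
      split.
      - apply Rmult_le_pos; [lra|left; apply Rinv_0_lt_compat; lra].
      - unfold E, C2. apply Rle_trans with (rho t / g1 (U s) ^ 2).
        + apply Rmult_le_compat_l; [lra|]. now apply Rinv_le_contravar.
        + replace (lam * hM * exp (g mu) * g1 mu / g1 (U s) ^ 2 * exp t)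
            with (lam * hM * exp (g mu) * g1 mu * exp t / g1 (U s) ^ 2) by (field; lra).
          apply Rmult_le_compat_r; [left; now apply Rinv_0_lt_compat|trivial]. }
    assert (ep := exp_pos t).
    assert (hC1a : 0 <= (2 + Th) / g1 (U s)).
    { apply Rmult_le_pos; [lra|left; now apply Rinv_0_lt_compat]. }
    assert (hab := Rabs_pos (1 - eps)).
    assert (hC2 : 0 <= C2) by nra.
    assert (hY2 : Rabs ((1 - eps) * (Y t) ^ 2 / 2) <= Rabs (1 - eps) * Y t).
    { replace ((1 - eps) * Y t ^ 2 / 2) with ((1 - eps) * (Y t ^ 2 / 2)) by field.
      rewrite Rabs_mult. apply Rmult_le_compat_l; trivial.
      rewrite Rabs_pos_eq; nra. }
    apply Rabs_le_between in hY2. apply Rabs_le_between.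
    assert (i1 : 0 <= Y t * ((2 + Th) / g1 (U s))) by (apply Rmult_le_pos; lra).
    assert (i2 : 0 <= C2 * Y t) by (apply Rmult_le_pos; lra).
    assert (i3 : 0 <= C1 * exp t) by (apply Rmult_le_pos; [unfold C1|]; lra).
    assert (i4 : (C1 + C2) * (Y t + exp t) = Y t * ((2 + Th) / g1 (U s))
       + Rabs (1 - eps) * Y t + C2 * Y t + C1 * exp t + C2 * exp t) by (unfold C1; ring).
    rewrite i4. unfold K. split; lra. }
assert (hK2 : K s * g1 (U s) ^ 2 = (2 + Th) * z s - (1 - eps) * z s ^ 2 / 2 - rho s).
{ unfold K, E, zf. field. lra. }
assert (0 <= K s * g1 (U s) ^ 2) by (apply Rmult_le_pos; [trivial|apply pow_le; lra]).
lra.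
Qed.

End Sol.

(** Pohozaev is applied twice. A crude pass bounds [z], hence the speed at which [g (U)] decreases;
    from a high level it takes long to come down to [B0], so [s] is very negative and the weight
    term [H * exp s] is small. The second pass, with this small weight, gives the sharp bounds. *)
Lemma apriori (eps : R) : 0 < eps <= 1 -> exists B, t0 < B /\
  (forall t, B <= t -> 1 <= g t /\ 1 <= g1 t /\ 0 < kapf g1 g2 t <= eps) /\
  forall lam mu U Y, sol h f lam mu U Y -> forall s, s < 0 -> B <= U s ->
    H * exp s <= eps /\ 0 < zf g1 U Y s <= 4 + eps /\
    0 < rhof h g g1 lam U s <= 3.
Proof.
intros he.
destruct (kap_small HG (1 / 2) ltac:(lra)) as [B0 [hB0 hk0]].
destruct (kap_small HG (eps / 10) ltac:(lra)) as [B1 [hB1 hk1]].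
assert (hH := weight_H HW).
pose (Z0 := 4 * (2 + H)).
pose (L := ln (10 * (H + 1) / eps)).
destruct (g_unbounded HG (g B0 + Z0 * Rabs L)) as [B2 [hB2 hg2]].
destruct (g_unbounded HG 1) as [B3 [hB3 hg3]].
destruct (g1_unbounded HG 1) as [B4 [hB4 hg4]].
pose (B := Rmax (Rmax B0 B1) (Rmax B2 (Rmax B3 B4))).
assert (i0 : B0 <= B) by (unfold B; eapply Rle_trans; [apply Rmax_l|apply Rmax_l]).
assert (i1 : B1 <= B) by (unfold B; eapply Rle_trans; [apply Rmax_r|apply Rmax_l]).
assert (i2 : B2 <= B) by (unfold B; eapply Rle_trans; [apply Rmax_l|apply Rmax_r]).
assert (i3 : B3 <= B).
{ unfold B; eapply Rle_trans; [apply Rmax_l|]; eapply Rle_trans; [apply Rmax_r|apply Rmax_r]. }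
assert (i4 : B4 <= B).
{ unfold B; eapply Rle_trans; [apply Rmax_r|]; eapply Rle_trans; [apply Rmax_r|apply Rmax_r]. }
clearbody B.
exists B. split; [lra|]. split.
{ intros t ht. split; [apply hg3; lra|]. split; [apply hg4; lra|].
  unfold kapf. specialize (hk1 t ltac:(lra)). lra. }
intros lam mu U Y HS s hs hU.
assert (hz0 : forall t, t < 0 -> B0 <= U t -> zf g1 U Y t <= Z0).
{ intros t ht hUt. assert (hp := pohozaev HS (1 / 2) H t hH ht ltac:(lra)).
  assert (rp := rho_pos HS t ht ltac:(lra)).
  lapply hp; [clear hp; intros hp|intros x hx; apply hk0; lra].
  lapply hp; [clear hp; intros hp|].
  - unfold Z0. nra.
  - intros x hx. assert (i := th_le x ltac:(lra)). assert (j := exp_neg_lt1 x ltac:(lra)).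
    assert (k := Rle_abs (thf h h1 x)). nra. }
assert (hexp : H * exp s <= eps / 10).
{ destruct (level_after HS s B0 hs ltac:(lra)) as [t [ht hUt]].
  assert (hd : - Z0 * (t - s) <= g (U t) - g (U s)).
  { apply (derive_ge_incr (fun x => g (U x)) (fun x => - zf g1 U Y x)); [lra|..].
    - intros x hx. assert (j := U_anti HS x t ltac:(lra)). apply (gU_derive HS); lra.
    - intros x hx. assert (j := U_anti HS x t ltac:(lra)).
      assert (k := hz0 x ltac:(lra) ltac:(lra)). lra. }
  rewrite hUt in hd. specialize (hg2 (U s) ltac:(lra)).
  assert (hZ0 : 0 < Z0) by (unfold Z0; lra).
  (* A drop of [g (U)] by at least [Z0 * Rabs L] at speed at most [Z0] needs time [Rabs L], all of
     it before 0. *)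
  assert (hs2 : s <= - L).
  { assert (j := Rle_abs L).
    apply Rnot_lt_le; intros hlt. 
    nra. }
  apply Rle_trans with (H * exp (- L)).
  - apply Rmult_le_compat_l; trivial. apply exp_le; lra.
  - rewrite exp_Ropp. unfold L. rewrite exp_ln.
    + replace (/ (10 * (H + 1) / eps)) with (eps / 10 * / (H + 1)) by (field; lra).
      apply Rle_trans with (eps / 10 * ((H + 1) * / (H + 1))).
      * assert (0 < / (H + 1)) by (apply Rinv_0_lt_compat; lra). nra.
      * rewrite Rinv_r; lra.
    + apply Rmult_lt_0_compat; [lra|apply Rinv_0_lt_compat; lra]. }
assert (hp := pohozaev HS (eps / 10) (eps / 10) s ltac:(lra) hs ltac:(lra)).
assert (zp := z_pos HS s hs ltac:(lra)).
assert (rp := rho_pos HS s hs ltac:(lra)).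
lapply hp; [clear hp; intros hp|intros x hx; apply hk1; lra].
lapply hp; [clear hp; intros hp|].
- split; [lra|]. split; split; trivial.
  + apply Rnot_lt_le; intros hlt.
    set (w := zf g1 U Y s) in *. 
    assert (hw : (1 - eps / 10) * w / 2 < 2 + eps / 10).
    { apply Rmult_lt_reg_r with w; trivial.
      replace ((1 - eps / 10) * w / 2 * w) with ((1 - eps / 10) * w ^ 2 / 2) by field. lra. }
    nra.
  + set (w := zf g1 U Y s) in *. clearbody w.
    (* In the worst case [eps = 1] the bound is [2.1 w - 0.45 w^2], maximal at [w = 7/3] with value
       2.45. *)
    assert (0 <= (w - 7 / 3) ^ 2) by apply pow2_ge_0. nra.
- intros x hx. assert (i := th_le x ltac:(lra)). assert (j : exp x <= exp s) by (apply exp_le; lra).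
  assert (k := Rle_abs (thf h h1 x)). nra.
Qed.

End Solution.

(** * The first bubble *)

Lemma exists_small (c1 c2 c3 c4 c5 : R) : 0 < c1 -> 0 < c2 -> 0 < c3 -> 0 < c4 -> 0 < c5 ->
  exists e, 0 < e /\ e <= c1 /\ e <= c2 /\ e <= c3 /\ e <= c4 /\ e <= c5.
Proof.
intros h1 h2 h3 h4 h5. exists (Rmin c1 (Rmin c2 (Rmin c3 (Rmin c4 c5)))).
assert (i1 := Rmin_l c1 (Rmin c2 (Rmin c3 (Rmin c4 c5)))).
assert (j1 := Rmin_r c1 (Rmin c2 (Rmin c3 (Rmin c4 c5)))).
assert (i2 := Rmin_l c2 (Rmin c3 (Rmin c4 c5))).
assert (j2 := Rmin_r c2 (Rmin c3 (Rmin c4 c5))).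
assert (i3 := Rmin_l c3 (Rmin c4 c5)). assert (j3 := Rmin_r c3 (Rmin c4 c5)).
assert (i4 := Rmin_l c4 c5). assert (j4 := Rmin_r c4 c5).
split; [repeat apply Rmin_glb_lt; trivial|lra].
Qed.

Lemma div_pos (x y : R) : 0 < x -> 0 < y -> 0 < x / y.
Proof. intros hx hy. apply Rmult_lt_0_compat; [trivial|now apply Rinv_0_lt_compat]. Qed.

Lemma le_div_iff (x y k : R) : 0 < k -> x <= y / k -> x * k <= y.
Proof.
intros hk h. replace y with (y / k * k) by (field; lra). apply Rmult_le_compat_r; lra.
Qed.

Lemma div_le_iff (x y k : R) : 0 < k -> y / k <= x -> y <= x * k.
Proof.
intros hk h. replace y with (y / k * k) by (field; lra). apply Rmult_le_compat_r; lra.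
Qed.

Lemma neg_ln_le (x : R) : 0 <= x <= 1 / 2 -> - ln (1 - x) <= 2 * x.
Proof.
intros hx. rewrite <- ln_Rinv by lra.
apply Rle_trans with (ln (exp (2 * x))); [|rewrite ln_exp; lra].
apply ln_le; [apply Rinv_0_lt_compat; lra|].
apply Rle_trans with (1 + 2 * x); [|apply exp_ineq1_le].
apply Rmult_le_reg_r with (1 - x); [lra|]. rewrite Rinv_l by lra. nra.
Qed.

Lemma ln_sub_1_le (x : R) : 0 < x -> ln x <= x - 1.
Proof.
intros hx. apply Rle_trans with (ln (exp (x - 1))); [|rewrite ln_exp; lra].
apply ln_le; trivial. assert (i := exp_ineq1_le (x - 1)). lra.
Qed.

(** All estimates valid above the level [B], uniformly over solutions. The condition persists when
    [B] is raised, so thresholds can be merged. The exponent 2 on [ln g] is a crude substitute for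
    [beta] plus an error. *)
Definition good (f g g1 g2 h : R -> R) (t0 H eps B : R) : Prop :=
  t0 < B /\
  (forall t, B <= t -> 1 <= g t /\ 1 <= g1 t /\ 0 < kapf g1 g2 t <= eps) /\
  (forall u m, B <= u <= m -> ln (g1 m) - ln (g1 u) <= 2 * (ln (g m) - ln (g u))) /\
  forall lam mu U Y, sol h f lam mu U Y -> forall s, s < 0 -> B <= U s ->
    H * exp s <= eps /\ 0 < zf g1 U Y s <= 4 + eps /\ 0 < rhof h g g1 lam U s <= 3.

Section Bubbles.
Context {f g g1 g2 : R -> R} {t0 beta : R} (HG : growth g g1 g2 t0 beta).
Context (Hf0 : forall t, 0 <= t -> 0 <= f t).
Context (Hf : forall t, t0 < t -> f t = exp (g t)).
Context {h h1 : R -> R} {hm hM H : R} (HW : weight h h1 hm hM H).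

Lemma good_mono (eps B B' : R) : good f g g1 g2 h t0 H eps B -> B <= B' -> good f g g1 g2 h t0 H eps B'.
Proof.
intros [i1 [i2 [i3 i4]]] hB. repeat split; try lra.
- apply i2; lra.
- apply i2; lra.
- apply i2; lra.
- apply i2; lra.
- intros u m hum; apply i3; lra.
- apply (i4 _ _ _ _ H0); lra.
- apply (i4 _ _ _ _ H0); lra.
- apply (i4 _ _ _ _ H0); lra.
- apply (i4 _ _ _ _ H0); lra.
- apply (i4 _ _ _ _ H0); lra.
Qed.

Lemma exists_large (B1 B2 B3 B4 G : R) : t0 < B1 ->
  exists B, B1 <= B /\ B2 <= B /\ B3 <= B /\ B4 <= B /\ forall t, B <= t -> G <= g t.
Proof.
intros h1'. destruct (g_unbounded HG G) as [B5 [h5 h6]].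
assert (k1 := Rmax_l B1 B2). assert (k2 := Rmax_r B1 B2).
assert (k3 := Rmax_l B3 B4). assert (k4 := Rmax_r B3 B4).
assert (k5 := Rmax_l (Rmax B1 B2) (Rmax B3 B4)). assert (k6 := Rmax_r (Rmax B1 B2) (Rmax B3 B4)).
assert (k7 := Rmax_l (Rmax (Rmax B1 B2) (Rmax B3 B4)) B5).
assert (k8 := Rmax_r (Rmax (Rmax B1 B2) (Rmax B3 B4)) B5).
exists (Rmax (Rmax (Rmax B1 B2) (Rmax B3 B4)) B5). repeat split; try lra.
intros t ht. apply h6; lra.
Qed.

Lemma good_exists (eps : R) : 0 < eps <= 1 -> exists B, good f g g1 g2 h t0 H eps B.
Proof.
intros he. destruct (apriori HG Hf0 Hf HW eps he) as [B [i1 [i2 i3]]].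
destruct (ln_g1_bounds HG 1 ltac:(lra)) as [B' [j1 [j2 j3]]].
assert (hb := growth_beta HG).
destruct (exists_large B B' B B 0 i1) as [B2 [k1 [k2 _]]].
exists B2. split; [lra|]. split; [intros t ht; apply i2; lra|]. split.
- intros u m hum. specialize (j3 u m ltac:(lra)).
  assert (ln (g u) <= ln (g m)).
  { apply ln_le; [specialize (j2 u ltac:(lra)); lra|apply (g_le HG); lra]. }
  nra.
- intros lam mu U Y HS s hs hU. apply (i3 lam mu U Y HS s); lra.
Qed.

Lemma g_chord (u1 u m : R) : t0 < u1 -> u1 <= u <= m ->
  (g u - g u1) * (m - u1) <= (g m - g u1) * (u - u1).
Proof.
intros hu1 hu.
assert (i := g_convex_upper HG u1 u hu1 ltac:(lra)).
assert (j := g_convex_lower HG u m ltac:(lra) ltac:(lra)).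
nra.
Qed.

Section Sol.
Context {lam mu : R} {U Y : R -> R} (HS : sol h f lam mu U Y).
Local Notation z := (zf g1 U Y).
Local Notation rho := (rhof h g g1 lam U).
Local Notation Q := (Qf h g g1 lam U Y).
Context {eps B : R} (Heps : 0 < eps <= 1) (HB : good f g g1 g2 h t0 H eps B).

Lemma glevel (s v : R) : s < 0 -> B <= U s -> g B <= v <= g (U s) ->
  exists t, s <= t < 0 /\ B <= U t /\ g (U t) = v.
Proof.
intros hs hU hv. assert (i := proj1 HB).
destruct (g_IVT HG B (U s) v i hU hv) as [u [hu1 hu2]].
destruct (level_after HG Hf0 HW HS s u hs ltac:(lra)) as [t [ht1 ht2]].
exists t. rewrite ht2. lra.
Qed.

Lemma glevel_mu (v : R) : B <= mu -> g B <= v < g mu ->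
  exists t, t < 0 /\ B <= U t /\ g (U t) = v.
Proof.
intros hU hv. assert (i := proj1 HB).
destruct (g_IVT HG B mu v i hU ltac:(lra)) as [u [hu1 hu2]].
destruct (level_exists HG Hf0 HW HS u) as [t [ht1 ht2]].
- split; [lra|]. destruct (Req_dec u mu); [subst; lra|lra].
- exists t. rewrite ht2. lra.
Qed.

Lemma good_at (s : R) : s < 0 -> B <= U s ->
  t0 < U s /\ 0 < kapf g1 g2 (U s) <= eps /\ Rabs (thf h h1 s) <= eps /\
  0 < z s <= 4 + eps /\ 0 < rho s <= 3.
Proof.
intros hs hU. destruct HB as [i1 [i2 [_ i3]]].
destruct (i2 (U s) hU) as [_ [_ j1]]. destruct (i3 _ _ _ _ HS s hs hU) as [j2 [j3 j4]].
assert (k := th_le HW s hs).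
split; [lra|]. split; [trivial|]. split; [lra|]. split; trivial.
Qed.

Lemma g_drop_le (s t : R) : s <= t < 0 -> B <= U t -> g (U s) - g (U t) <= (4 + eps) * (t - s).
Proof.
intros hst hU.
enough (- (4 + eps) * (t - s) <= g (U t) - g (U s)) by lra.
apply (derive_ge_incr (fun x => g (U x)) (fun x => - z x)); [lra|..].
- intros x hx. assert (i := U_anti Hf0 HW HS x t ltac:(lra)).
  apply (gU_derive HG HS); [lra|]. destruct HB; lra.
- intros x hx. assert (i := U_anti Hf0 HW HS x t ltac:(lra)).
  destruct (good_at x ltac:(lra) ltac:(lra)) as [_ [_ [_ [j _]]]]. lra.
Qed.

(** [kap z] is exactly the rate at which [ln (g1 (U))] decreases, so the [kap] part of [Q']
    integrates to a multiple of the variation of [ln (g1 (U))]; the weight part integrates to at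
    most [3 * H * exp t]. *)
Lemma Q_var (s t : R) : s <= t < 0 -> B <= U t ->
  Rabs (Q t - Q s) <= 20 * (ln (g1 (U s)) - ln (g1 (U t))) + 3 * eps.
Proof.
intros hst hU.
assert (hH := weight_H HW).
assert (hUx : forall x, s <= x <= t -> B <= U x).
{ intros x hx. assert (i := U_anti Hf0 HW HS x t ltac:(lra)). lra. }
assert (hb : forall x, s <= x <= t ->
   Rabs (rho x * thf h h1 x - kapf g1 g2 (U x) * z x * ((z x - 2) * z x + rho x))
     <= 20 * (kapf g1 g2 (U x) * z x) + 3 * H * exp x).
{ intros x hx. destruct (good_at x ltac:(lra) (hUx x hx)) as [j1 [j2 [j3 [j4 j5]]]].
  assert (k := th_le HW x ltac:(lra)).
  set (kp := kapf g1 g2 (U x)) in *. set (zz := z x) in *. set (rr := rho x) in *.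
  clearbody kp zz rr.
  apply Rabs_le_between in k.
  assert (a1 : - (3 * (H * exp x)) <= rr * thf h h1 x <= 3 * (H * exp x)).
  { set (t1 := thf h h1 x) in *. set (t2 := H * exp x) in *. clearbody t1 t2. split; nra. }
  (* From [0 < z <= 5] and [0 < rho <= 3] the expression lies between -1 and 18. *)
  assert (a2 : - 20 <= (zz - 2) * zz + rr <= 20) by (split; nra).
  assert (a3 : 0 <= kp * zz) by nra.
  assert (a4 : - (20 * (kp * zz)) <= kp * zz * ((zz - 2) * zz + rr) <= 20 * (kp * zz)).
  { set (t3 := (zz - 2) * zz + rr) in *. clearbody t3. split; nra. }
  apply Rabs_le_between. lra. }
(* The sign [c] is instantiated at 1 and -1 to bound the variation of [Q] on both sides. *)
assert (hd : forall c, forall x, s <= x <= t -> is_derive (fun y => c * Q y - 20 * ln (g1 (U y)) + 3 * H * exp y) x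
   (c * (rho x * thf h h1 x - kapf g1 g2 (U x) * z x * ((z x - 2) * z x + rho x))
     + 20 * (kapf g1 g2 (U x) * z x) + 3 * H * exp x)).
{ intros c x hx. destruct (good_at x ltac:(lra) (hUx x hx)) as [j1 _].
  assert (d1 := Q_derive HG Hf HW HS x ltac:(lra) j1).
  assert (d2 := lng1U_derive HG HS x ltac:(lra) j1).
  pose (F := fun y => ln (g1 (U y))). change (is_derive F x (- (kapf g1 g2 (U x) * z x))) in d2.
  apply (is_derive_ext (fun y => c * Q y - 20 * F y + 3 * H * exp y)); [reflexivity|].
  auto_derive; [repeat split; trivial; eexists; eassumption|].
  rewrite (Derive_eta d1), (Derive_eta d2). ring. }
assert (i1 : 1 * Q s - 20 * ln (g1 (U s)) + 3 * H * exp s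
   <= 1 * Q t - 20 * ln (g1 (U t)) + 3 * H * exp t).
{ apply (derive_ge0_le _ _ s t ltac:(lra) (hd 1)).
  intros x hx. specialize (hb x hx). apply Rabs_le_between in hb. lra. }
assert (i2 : -1 * Q s - 20 * ln (g1 (U s)) + 3 * H * exp s
   <= -1 * Q t - 20 * ln (g1 (U t)) + 3 * H * exp t).
{ apply (derive_ge0_le _ _ s t ltac:(lra) (hd (-1))).
  intros x hx. specialize (hb x hx). apply Rabs_le_between in hb. lra. }
assert (hexp : H * exp t <= eps) by (apply HB with (2 := ltac:(lra) : t < 0) in HS; lra).
assert (0 <= H * exp s) by (apply Rmult_le_pos; [lra|left; apply exp_pos]).
apply Rabs_le_between. lra.
Qed.

Lemma z_rho_lim0 (b : R) : b < 0 -> B <= U b -> is_lim (fun t => z t + rho t) m_infty 0.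
Proof.
intros hb hU. assert (hB0 := proj1 HB).
pose (C := lam * hM * exp (g mu) * g1 mu).
apply (is_lim0_dom _ (fun t => Y t + exp t) (g1 mu + C) b (lim_Y_exp HS)).
intros t ht. assert (hUt := U_anti Hf0 HW HS t b ltac:(lra)).
assert (hUm := U_le_mu Hf0 HW HS t ltac:(lra)).
destruct (good_at t ltac:(lra) ltac:(lra)) as [j1 [_ [_ [j2 j3]]]].
assert (r := rho_le_exp HG Hf0 HW HS b t ltac:(lra) ltac:(lra)). fold C in r.
assert (k : g1 (U t) <= g1 mu) by (apply (g1_le HG); lra).
assert (y := Y_ge0 Hf0 HW HS t ltac:(lra)). assert (e := exp_pos t).
assert (l := growth_g1 HG (U t) j1).
assert (hC : 0 <= C) by nra.
rewrite Rabs_pos_eq by lra. unfold zf.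
nra.
Qed.

Lemma z_rho_near0 (b d : R) : b < 0 -> B <= U b -> 0 < d ->
  exists s, s <= b /\ z s <= d /\ rho s <= d.
Proof.
intros hb hU hd. assert (i := z_rho_lim0 b hb hU). apply is_lim_spec in i.
destruct (i (mkposreal d hd)) as [M hM1]. simpl in hM1.
assert (j1 := Rmin_l (M - 1) b). assert (j2 := Rmin_r (M - 1) b).
exists (Rmin (M - 1) b). split; trivial.
specialize (hM1 (Rmin (M - 1) b) ltac:(lra)). apply Rabs_def2 in hM1.
assert (hUt := U_anti Hf0 HW HS (Rmin (M - 1) b) b ltac:(lra)).
destruct (good_at (Rmin (M - 1) b) ltac:(lra) ltac:(lra)) as [_ [_ [_ [j3 j4]]]]. lra.
Qed.

(** At -oo both [z] and [rho] vanish, where [Q = 2]. This value is [a^2 / 2] with [a = 2], the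
    origin of the first amplitude. *)
Lemma Q_start (t : R) : t < 0 -> B <= U t ->
  Rabs (Q t - 2) <= 20 * (ln (g1 mu) - ln (g1 (U t))) + 3 * eps.
Proof.
intros ht hU. 
apply le_epsilon. intros e he.
destruct (z_rho_near0 t (Rmin 1 (e / 4)) ht hU) as [s [hs1 [hs2 hs3]]].
{ apply Rmin_glb_lt; lra. }
assert (m2 := Rmin_r 1 (e / 4)).
assert (hUs := U_anti Hf0 HW HS s t ltac:(lra)).
assert (hUm := U_le_mu Hf0 HW HS s ltac:(lra)).
destruct (good_at s ltac:(lra) ltac:(lra)) as [j1 [_ [_ [j3 j4]]]].
assert (i := Q_var s t ltac:(lra) hU).
assert (l : ln (g1 (U s)) <= ln (g1 mu)).
{ apply ln_le; [now apply (growth_g1 HG)|apply (g1_le HG); lra]. }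
assert (hQs : Rabs (Q s - 2) <= e).
{ unfold Qf. apply Rabs_le_between. split; nra. }
apply Rabs_le_between in i. apply Rabs_le_between in hQs. apply Rabs_le_between. lra.
Qed.

(** Since [z' = rho - kap z^2], eliminating [rho] through [Q] turns near conservation of [Q] into a
    scalar differential inequality for [z], as needed by [climb]; 25 comes from [z <= 5]. *)
Lemma z_slope (s w c : R) : s < 0 -> B <= U s -> Rabs (Q s - c) <= w ->
  c - w - (z s - 2) ^ 2 / 2 - 25 * eps <= rho s - kapf g1 g2 (U s) * (z s) ^ 2.
Proof.
intros hs hU hQ. destruct (good_at s hs hU) as [j1 [j2 [_ [j3 j4]]]].
apply Rabs_le_between in hQ. unfold Qf in hQ.
assert (kapf g1 g2 (U s) * z s ^ 2 <= eps * 25).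
{ apply Rmult_le_compat; try lra; [apply pow2_ge_0|]. nra. }
lra.
Qed.

(** Read off the formula for [rho]. The weight costs only a bounded error, harmless along a neck,
    where the other terms are of the order of [g]. *)
Lemma ln_rho_diff (s t : R) : s <= t < 0 -> B <= U t ->
  2 * (t - s) - (g (U s) - g (U t)) - (ln (g1 (U s)) - ln (g1 (U t))) - (ln hM - ln hm)
    <= ln (rho t) - ln (rho s)
    <= 2 * (t - s) - (g (U s) - g (U t)) - (ln (g1 (U s)) - ln (g1 (U t))) + (ln hM - ln hm).
Proof.
intros hst hU. assert (hB0 := proj1 HB).
assert (hUs := U_anti Hf0 HW HS s t ltac:(lra)).
rewrite !(ln_rho HG HW HS) by lra.
assert (i := ln_h_diff HW s t ltac:(lra) ltac:(lra)).
assert (j := ln_h_diff HW t s ltac:(lra) ltac:(lra)). lra.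
Qed.

End Sol.

Lemma ln_g1_level (eps B u m x : R) : good f g g1 g2 h t0 H eps B -> B <= u <= m ->
  0 < x -> x * g m <= g u -> ln (g1 m) - ln (g1 u) <= - 2 * ln x.
Proof.
intros HB hum hx hl. destruct HB as [i1 [i2 [i3 _]]].
assert (j := i3 u m hum). destruct (i2 m ltac:(lra)) as [k _].
assert (l : ln (x * g m) <= ln (g u)) by (apply ln_le; [nra|trivial]).
rewrite ln_mult in l by lra. lra.
Qed.

(** While [g (U)] stays above [(1 - nu) * g mu], [Q] is close to 2, so [z] has slope at least 1/2
    once between 1 and 2. The difficulty is that the rest point [z = rho = 0] also has [Q = 2]; one
    must show that the solution leaves it before the level has dropped noticeably. *)
Lemma first_bubble (eps : R) : 0 < eps -> exists B, t0 < B /\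
  forall lam mu U Y, sol h f lam mu U Y -> B <= mu ->
  exists s, s < 0 /\ t0 < U s /\ (1 - eps) * g mu <= g (U s) /\
    zf g1 U Y s = 2 /\ Rabs (rhof h g g1 lam U s - 2) <= eps.
Proof.
intros heps.
destruct (exists_small (eps / 200) (1 / 800) 1 1 1) as [nu [n0 [n1 [n2 _]]]]; try lra.
pose (e := nu).
assert (he : 0 < e <= 1) by (unfold e; lra).
assert (he8 : e <= 1 / 800) by (unfold e; lra).
destruct (good_exists e he) as [B1 HB]. assert (hB1 := proj1 HB).
destruct (exists_large B1 B1 B1 B1 (2 * Rabs (g B1) + 100 / nu) hB1) as [B [hB [_ [_ [_ hG]]]]].
exists B. split; [lra|]. intros lam mu U Y HS hmu.
assert (hgmu := hG mu hmu).
assert (hg1 : 0 < 100 / nu) by (apply div_pos; lra).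
assert (habs := Rle_abs (g B1)). assert (habs' := Rabs_pos (g B1)).
assert (hgn : 100 <= nu * g mu).
{ apply Rle_trans with (nu * (100 / nu)); [right; field; lra|apply Rmult_le_compat_l; lra]. }
destruct (glevel_mu HS HB ((1 - nu) * g mu)) as [sD [hD1 [hD2 hD3]]]; [lra|split; nra|].
destruct (glevel_mu HS HB ((1 - nu / 2) * g mu)) as [sE [hE1 [hE2 hE3]]]; [lra|split; nra|].
assert (hED : sE <= sD).
{ apply Rnot_lt_le; intros hlt. assert (i := U_anti Hf0 HW HS sD sE ltac:(lra)).
  assert (g (U sE) <= g (U sD)) by (apply (g_le HG); lra). nra. }
assert (hUx : forall x, x <= sD -> B1 <= U x).
{ intros x hx. assert (i := U_anti Hf0 HW HS x sD ltac:(lra)). lra. }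
assert (hmu1 : B1 <= mu) by lra.
(* Here [ln g1] varies by at most [4 * nu], which costs [80 * nu]; the remaining [3 * nu] is the
   weight term. *)
assert (hQ : forall x, x <= sD -> Rabs (Qf h g g1 lam U Y x - 2) <= 83 * nu).
{ intros x hx. assert (i := Q_start HS he HB x ltac:(lra) (hUx x hx)).
  assert (hUm := U_le_mu Hf0 HW HS x ltac:(lra)).
  assert (hxD : g (U sD) <= g (U x)).
  { apply (g_le HG); [lra|]. apply (U_anti Hf0 HW HS); lra. }
  assert (j := ln_g1_level e B1 (U x) mu (1 - nu) HB ltac:(split; [apply hUx|]; lra) ltac:(lra) ltac:(lra)).
  assert (k := neg_ln_le nu ltac:(lra)). unfold e in *. lra. }
assert (htime : 5 <= sD - sE).
{ assert (i := g_drop_le HS HB sE sD ltac:(lra) hD2). nra. }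
(* If [z < 1] up to [sE], then [rho] grows at rate at least 1/2, so going backwards [rho], and then
   [z], decay like [exp (s / 2)]. The total drop of [g (U)] would be bounded by a constant, against
   the drop [nu / 2 * g mu >= 50] at [sE]. *)
assert (hstart : exists s1, s1 <= sE /\ 1 <= zf g1 U Y s1).
{ apply Classical_Prop.NNPP. intros hno.
  assert (hz : forall x, x <= sE -> zf g1 U Y x < 1).
  { intros x hx. apply Rnot_le_lt; intros h2. apply hno. now exists x. }
  assert (hr : forall x, x <= sE -> rhof h g g1 lam U x <= 3 * exp ((x - sE) / 2)).
  { intros x hx.
    assert (i : rhof h g g1 lam U x * exp (- x / 2) <= rhof h g g1 lam U sE * exp (- sE / 2)).
    { apply (derive_ge0_le (fun y => rhof h g g1 lam U y * exp (- y / 2))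
        (fun y => rhof h g g1 lam U y * exp (- y / 2) *
           (3 / 2 + thf h h1 y - zf g1 U Y y - kapf g1 g2 (U y) * zf g1 U Y y)) x sE hx).
      - intros y hy. destruct (good_at HS HB y ltac:(lra) (hUx y ltac:(lra))) as [j1 _].
        assert (d := rho_derive HG HW HS y ltac:(lra) j1).
        auto_derive; [repeat split; trivial; eexists; eassumption|].
        rewrite (Derive_eta d). unfold Rdiv. field.
      - intros y hy. destruct (good_at HS HB y ltac:(lra) (hUx y ltac:(lra))) as [j1 [j2 [j3 [j4 j5]]]].
        specialize (hz y ltac:(lra)). apply Rabs_le_between in j3.
        assert (kapf g1 g2 (U y) * zf g1 U Y y <= e * 1) by (apply Rmult_le_compat; lra).
        apply Rmult_le_pos; [apply Rmult_le_pos; [lra|left; apply exp_pos]|]. lra. }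
    destruct (good_at HS HB sE ltac:(lra) (hUx sE ltac:(lra))) as [j1 [j2 [j3 [j4 j5]]]].
    assert (pe := exp_pos (- x / 2)). assert (pe2 := exp_pos (- sE / 2)).
    apply Rmult_le_reg_r with (exp (- x / 2)); trivial.
    rewrite Rmult_assoc, <- exp_plus. replace ((x - sE) / 2 + - x / 2) with (- sE / 2) by field.
    nra. }
  assert (hz2 : forall x, x <= sE -> zf g1 U Y x <= 6 * exp ((x - sE) / 2)).
  { intros x hx.
    enough (0 <= 6 * exp ((x - sE) / 2) - zf g1 U Y x) by lra.
    apply (derive_ge0_lim_le (fun y => 6 * exp ((y - sE) / 2) - zf g1 U Y y)
      (fun y => 3 * exp ((y - sE) / 2) - (rhof h g g1 lam U y - kapf g1 g2 (U y) * (zf g1 U Y y) ^ 2))).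
    - intros y hy. destruct (good_at HS HB y ltac:(lra) (hUx y ltac:(lra))) as [j1 _].
      assert (d := z_derive HG Hf HS y ltac:(lra) j1).
      auto_derive; [repeat split; trivial; eexists; eassumption|].
      rewrite (Derive_eta d). unfold Rdiv, Rminus. field.
    - intros y hy. destruct (good_at HS HB y ltac:(lra) (hUx y ltac:(lra))) as [j1 [j2 _]].
      specialize (hr y ltac:(lra)).
      assert (0 <= kapf g1 g2 (U y) * zf g1 U Y y ^ 2) by (apply Rmult_le_pos; [lra|apply pow2_ge_0]).
      lra.
    - replace (Finite 0) with (Finite (0 + 0)) by (f_equal; ring).
      apply (is_lim_plus' (fun y => 6 * exp ((y - sE) / 2)) (fun y => - zf g1 U Y y)).
      + apply (is_lim_comp (fun y => 6 * exp y) (fun y => (y - sE) / 2) m_infty 0 m_infty).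
        * replace (Finite 0) with (Rbar_mult 6 0) by (simpl; f_equal; ring).
          apply is_lim_scal_l, is_lim_exp_m.
        * apply is_lim_spec. intros M. exists (2 * M + sE). intros y hy. lra.
        * exists 0. intros y _. discriminate.
      + apply (is_lim0_dom _ (fun t => zf g1 U Y t + rhof h g g1 lam U t) 1 sE
          (z_rho_lim0 HS he HB sE hE1 hE2)).
        intros t ht. destruct (good_at HS HB t ltac:(lra) (hUx t ltac:(lra))) as [j1 [_ [_ [j2 j3]]]].
        rewrite Rabs_Ropp, Rabs_pos_eq; lra. }
  (* The level [g mu] itself is reached only in the limit at -oo, so the comparison starts one unit
     below it. *)
  destruct (glevel_mu HS HB (g mu - 1)) as [s0 [h01 [h02 h03]]]; [lra|split; nra|].
  assert (h0E : s0 <= sE).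
  { apply Rnot_lt_le; intros hlt. assert (i := U_anti Hf0 HW HS sE s0 ltac:(lra)).
    assert (g (U s0) <= g (U sE)) by (apply (g_le HG); lra). nra. }
  assert (i : g (U s0) + 12 * exp ((s0 - sE) / 2) <= g (U sE) + 12 * exp ((sE - sE) / 2)).
  { apply (derive_ge0_le (fun y => g (U y) + 12 * exp ((y - sE) / 2))
      (fun y => - zf g1 U Y y + 6 * exp ((y - sE) / 2)) s0 sE h0E).
    - intros y hy. destruct (good_at HS HB y ltac:(lra) (hUx y ltac:(lra))) as [j1 _].
      assert (d := gU_derive HG HS y ltac:(lra) j1).
      apply (is_derive_plus (fun y => g (U y)) (fun y => 12 * exp ((y - sE) / 2))); trivial.
      auto_derive; [trivial|]. unfold Rdiv, Rminus. field.
    - intros y hy. specialize (hz2 y ltac:(lra)). lra. }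
  replace ((sE - sE) / 2) with 0 in i by field. rewrite exp_0 in i.
  assert (ep := exp_pos ((s0 - sE) / 2)). nra. }
destruct hstart as [s1 [hs1 hz1]].
assert (hzD : 2 <= zf g1 U Y sD).
{ apply (climb (zf g1 U Y) (fun s => rhof h g g1 lam U s - kapf g1 g2 (U s) * (zf g1 U Y s) ^ 2) s1 sD 1 2 (1 / 2)); try lra.
  - intros s hs. apply (z_derive HG Hf HS); [lra|]. specialize (hUx s ltac:(lra)). lra.
  - intros s hs hzs. assert (i := z_slope HS he HB s (83 * nu) 2 ltac:(lra) (hUx s ltac:(lra)) (hQ s ltac:(lra))).
    assert ((zf g1 U Y s - 2) ^ 2 <= 1) by nra. unfold e in i. lra. }
destruct (z_rho_near0 HS he HB sD 1 hD1 hD2 ltac:(lra)) as [s0 [h01 [h02 h03]]].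
destruct (IVT_decr (fun s => - zf g1 U Y s) s0 sD (- 2)) as [s [hs2 hzs]]; try lra.
- intros x hx. apply (continuous_opp (zf g1 U Y)). apply (z_cont HG Hf HS); [lra|].
  specialize (hUx x ltac:(lra)). lra.
- exists s. assert (i := hUx s ltac:(lra)). split; [lra|]. split; [lra|]. split; [|split; [lra|]].
  + assert (g (U sD) <= g (U s)).
    { apply (g_le HG); [lra|]. apply (U_anti Hf0 HW HS); lra. }
    nra.
  + assert (j := hQ s ltac:(lra)). unfold Qf in j.
    replace (zf g1 U Y s) with 2 in j by lra.
    replace ((2 - 2) ^ 2 / 2 + rhof h g g1 lam U s - 2) with (rhof h g g1 lam U s - 2) in j by field.
    lra.
Qed.

End Bubbles.

(** * The neck *)

Lemma exp_decay (K c eta : R) : 0 < K -> 0 < c -> 0 < eta ->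
  exists G, 0 < G /\ forall x, G <= x -> K * x * exp (- c * x) <= eta.
Proof.
intros hK hc heta.
exists (4 * K / (c ^ 2 * eta)).
assert (hp : 0 < c ^ 2 * eta) by (apply Rmult_lt_0_compat; [now apply pow_lt|trivial]).
assert (hG : 0 < 4 * K / (c ^ 2 * eta)) by (apply div_pos; lra).
split; trivial. intros x hx.
assert (hx0 : 0 < x) by lra.
assert (h1 : (c * x / 2) ^ 2 <= exp (c * x)).
{ replace (c * x) with (c * x / 2 + c * x / 2) at 2 by field. rewrite exp_plus.
  assert (i := exp_ineq1_le (c * x / 2)). assert (0 < c * x) by now apply Rmult_lt_0_compat. nra. }
assert (h2 : 4 * K <= x * (c ^ 2 * eta)).
{ replace (4 * K) with (4 * K / (c ^ 2 * eta) * (c ^ 2 * eta)) by (field; lra).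
  apply Rmult_le_compat_r; lra. }
replace (- c * x) with (- (c * x)) by ring. rewrite exp_Ropp.
assert (he := exp_pos (c * x)).
apply Rmult_le_reg_r with (exp (c * x)); trivial.
rewrite Rmult_assoc, Rinv_l, Rmult_1_r by lra.
apply Rle_trans with (eta * (c * x / 2) ^ 2); [|apply Rmult_le_compat_l; lra].
replace (eta * (c * x / 2) ^ 2) with (x * (x * (c ^ 2 * eta)) / 4) by field.
nra.
Qed.

Lemma exp_le_linear (y : R) : 0 <= y <= 1 / 2 -> exp y <= 1 + 2 * y.
Proof.
intros hy. assert (i := exp_ineq1_le (- y)). assert (j := exp_pos y).
rewrite exp_Ropp in i.
assert (k : (1 + - y) * exp y <= 1).
{ apply Rle_trans with (/ exp y * exp y); [apply Rmult_le_compat_r; lra|rewrite Rinv_l; lra]. }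
nra.
Qed.

Section Step.
Context {f g g1 g2 : R -> R} {t0 beta : R} (HG : growth g g1 g2 t0 beta).
Context (Hf0 : forall t, 0 <= t -> 0 <= f t).
Context (Hf : forall t, t0 < t -> f t = exp (g t)).
Context {h h1 : R -> R} {hm hM H : R} (HW : weight h h1 hm hM H).

(** At [z = 2] one has [Q = rho], close to [a^2 / 2]. Near conservation makes [z] climb as long as
    it is below [2 + a - e], and [(z - 2)^2 / 2 <= Q] keeps it below [2 + a + e]. The drop [nu]
    remains free below [nu0], because the neck needs two exit levels. *)
Lemma bubble_exit (a e : R) : 0 < a <= 2 -> 0 < e <= a ->
  exists nu0, 0 < nu0 /\ forall nu, 0 < nu <= nu0 ->
  exists delta B, 0 < delta /\ t0 < B /\
  forall lam mu U Y, sol h f lam mu U Y -> forall s, s < 0 -> B <= U s ->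
  zf g1 U Y s = 2 -> Rabs (rhof h g g1 lam U s - a ^ 2 / 2) <= delta ->
  forall t, s <= t < 0 -> t0 < U t -> g (U t) = (1 - nu) * g (U s) ->
  Rabs (zf g1 U Y t - (2 + a)) <= e.
Proof.
intros ha he.
assert (hae : 0 < a * e) by (apply Rmult_lt_0_compat; lra).
(* The slope of [z] is at least [a * e / 2 - 109 * nu], with 84 from [Q] and 25 from [kap]; this
   must exceed [a * e / 4]. *)
destruct (exists_small (1 / 4) (a * e / 500) 1 1 1) as [nu0 [n0 [n1 [n2 _]]]]; try lra.
exists nu0. split; trivial. intros nu hnu.
assert (hnu1 : 0 < nu <= 1) by lra.
destruct (good_exists HG Hf0 Hf HW nu hnu1) as [B1 HB]. assert (hB1 := proj1 HB).
assert (han : 0 < a * e * nu) by (apply Rmult_lt_0_compat; lra).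
assert (hq : 0 < 40 / (a * e * nu)) by (apply div_pos; lra).
destruct (exists_large HG B1 B1 B1 B1 (2 * Rabs (g B1) + 40 / (a * e * nu)) hB1)
  as [B [hB [_ [_ [_ hG]]]]].
exists nu, B. split; [lra|]. split; [lra|].
intros lam mu U Y HS s hs hUs hz hrho t hst hUt ht.
assert (hgs := hG _ hUs). assert (habs := Rle_abs (g B1)). assert (habs' := Rabs_pos (g B1)).
assert (hBt : B1 <= U t) by (apply (g_le_inv HG); nra).
assert (hUx : forall y, s <= y <= t -> U t <= U y <= U s).
{ intros y hy. split; apply (U_anti Hf0 HW HS); lra. }
assert (hQ : forall y, s <= y <= t -> Rabs (Qf h g g1 lam U Y y - a ^ 2 / 2) <= 84 * nu).
{ intros y hy. assert (hUy := hUx y hy).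
  assert (i := Q_var HG Hf0 Hf HW HS hnu1 HB s y ltac:(lra) ltac:(lra)).
  assert (hg : g (U t) <= g (U y)) by (apply (g_le HG); lra).
  assert (j := ln_g1_level nu B1 (U y) (U s) (1 - nu) HB ltac:(lra) ltac:(lra) ltac:(lra)).
  assert (k := neg_ln_le nu ltac:(lra)).
  assert (l : Qf h g g1 lam U Y s = rhof h g g1 lam U s) by (unfold Qf; rewrite hz; field).
  rewrite l in i. apply Rabs_le_between in i. apply Rabs_le_between in hrho.
  apply Rabs_le_between. lra. }
assert (htime := g_drop_le HG Hf0 HW HS HB s t hst hBt).
assert (hlow : 2 + a - e <= zf g1 U Y t).
{ apply (climb (zf g1 U Y) (fun s => rhof h g g1 lam U s - kapf g1 g2 (U s) * (zf g1 U Y s) ^ 2)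
    s t 2 (2 + a - e) (a * e / 4)); try lra.
  - intros y hy. assert (hUy := hUx y hy). apply (z_derive HG Hf HS); lra.
  - intros y hy hzy. assert (hUy := hUx y hy).
    assert (i := z_slope HW HS hnu1 HB y (84 * nu) (a ^ 2 / 2) ltac:(lra) ltac:(lra) (hQ y hy)).
    assert ((zf g1 U Y y - 2) ^ 2 <= (a - e) ^ 2) by (apply pow_incr; lra).
    nra.
  - rewrite ht in htime.
    assert (j1 : nu * g (U s) <= 5 * (t - s)) by nra.
    assert (j2 : 40 <= a * e * nu * g (U s)).
    { apply Rle_trans with (a * e * nu * (40 / (a * e * nu))); [right; field; lra|].
      apply Rmult_le_compat_l; lra. }
    assert (j3 : a * e * (nu * g (U s)) <= a * e * (5 * (t - s))) by (apply Rmult_le_compat_l; lra).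
    lra. }
assert (hQt := hQ t ltac:(lra)).
destruct (good_at HW HS HB t ltac:(lra) hBt) as [_ [_ [_ [_ j5]]]].
apply Rabs_le_between in hQt. unfold Qf in hQt.
apply Rabs_le_between. split; [lra|].
apply Rnot_lt_le; intros hlt. nra.
Qed.

(** After exit, [Y] is nearly [(2 + a) / g1 m], so by [g_gap] reaching the level [x] takes time
    about [Lam beta x / (2 + a) * g m]. Then [2 s + g (U)] has changed by [- phi * g m]: [phi] is
    the decay exponent of [rho], and its zero is the level of the next bubble. At arrival
    [z = g1 (U) * Y] has been multiplied by about [x^beta]. The lower bound on [ln rho] will limit
    how long the next bubble can be delayed. *)
Lemma neck (a x e : R) : 0 < a <= 2 -> 0 < x < 1 -> 0 < e <= 1 ->
  let phi := 1 - x - 2 / (2 + a) * Lam beta x in 0 < phi ->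
  exists delta B, 0 < delta /\ t0 < B /\
  forall lam mu U Y, sol h f lam mu U Y -> forall s, s < 0 -> B <= U s ->
  zf g1 U Y s = 2 -> Rabs (rhof h g g1 lam U s - a ^ 2 / 2) <= delta ->
  exists t, s <= t < 0 /\ t0 < U t /\ Rabs (g (U t) - x * g (U s)) <= e * g (U s) /\
    Rabs (zf g1 U Y t - Rpower x beta * (2 + a)) <= e /\
    rhof h g g1 lam U t <= e /\ - (2 * phi) * g (U s) <= ln (rhof h g g1 lam U t).
Proof.
intros ha hx he phi hphi.
set (L := Lam beta x) in *. set (P := Rpower x beta).
assert (hbeta := growth_beta HG).
assert (hL : 0 <= L) by (apply Lam_ge0; lra).
assert (hP : 0 < P <= 1).
{ split; [apply Rpower_pos|]. unfold P, Rpower.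
  assert (ln x < ln 1) by (apply ln_increasing; lra). rewrite ln_1 in H0.
  left; apply exp_lt_1. nra. }
assert (hPi : 0 < 2 / P) by (apply div_pos; lra).
assert (hLP : 0 <= L * (6 + 2 / P)) by (apply Rmult_le_pos; lra).
destruct (exists_small (e / 60) (1 / 10) a (phi / (4 * (1 + L * (6 + 2 / P)))) (phi / (2 * (4 + L))))
  as [e1 [p0 [p1 [p2 [p3 [p4 p5]]]]]]; try lra; try (apply div_pos; lra).
apply le_div_iff in p4; [|lra]. apply le_div_iff in p5; [|lra].
destruct (bubble_exit a e1 ha ltac:(lra)) as [nu0 [hnu0 hexit]].
destruct (exists_small (nu0 / 2) (e1 / 16) (phi / 8) ((1 - x) / 4) e)
  as [nu [q0 [q1 [q2 [q3 [q4 q5]]]]]]; try lra.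
destruct (hexit nu ltac:(lra)) as [d1 [B1 [hd1 [hB1 hex1]]]].
destruct (hexit (2 * nu) ltac:(lra)) as [d2 [B2 [hd2 [hB2 hex2]]]].
destruct (g1_ratio HG e1 x ltac:(lra) hx) as [B3 [hB3 [_ hratio]]].
destruct (g_gap HG e1 x p0 hx) as [B4 [hB4 [_ hgap]]].
destruct (good_exists HG Hf0 Hf HW 1 ltac:(lra)) as [B5 HB5].
assert (hB5 := proj1 HB5).
destruct (exists_small d1 d2 (a ^ 2 / 4) 1 1) as [delta [r0 [r1 [r2 [r3 _]]]]]; try nra.
set (Ch := ln hM - ln hm).
pose (K0 := 3 * exp Ch). assert (hK0 : 0 < K0) by (apply Rmult_lt_0_compat; [lra|apply exp_pos]).
(* The exponent is at least [phi / 2 * gm] at the end of the neck and, by concavity, at least a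
   proportional part before; beyond [A2] that proportion is at least [nu / (L + 1)]. *)
pose (c3 := phi * nu / (2 * (L + 1))).
assert (hc3 : 0 < c3) by (apply div_pos; [apply Rmult_lt_0_compat|]; lra).
destruct (exp_decay (2 * K0 * (L + 1)) c3 (e1 ^ 2)) as [G0 [hG0 hdec]].
{ apply Rmult_lt_0_compat; lra. } { trivial. } { now apply pow_lt. }
pose (K1 := ln (a ^ 2 / 4) - 1 - 2 * Ch + 2 * ln x).
destruct (exists_large HG B5 B3 B4 B5 0 hB5) as [B6 [k5 [k3 [k4 _]]]].
(* The summands serve, in order, the exponential decay, keeping the level [x * gm] above that of
   [B6], and absorbing the bounded errors of the lower estimate. *)
pose (G := 2 * G0 + 2 * (Rabs (g B6) / x) + 2 * Rabs K1 / phi + 2).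
destruct (exists_large HG B1 B2 B6 B6 G hB1) as [B [l1 [l2 [l6 [_ hG]]]]].
exists delta, B. split; [trivial|]. split; [lra|].
intros lam mu U Y HS s hs hUs hz hrho.
set (gs := g (U s)) in *.
assert (hgs := hG _ hUs). fold gs in hgs.
assert (abs1 := Rle_abs (g B6)). assert (abs2 := Rabs_pos (g B6)).
assert (habsx : 0 <= Rabs (g B6) / x) by (apply Rmult_le_pos; [trivial|left; apply Rinv_0_lt_compat; lra]).
assert (abs3 : 0 <= 2 * Rabs K1 / phi).
{ apply Rmult_le_pos; [assert (i := Rabs_pos K1); lra|left; apply Rinv_0_lt_compat; lra]. }
assert (hgsx : 2 * g B6 <= x * gs).
{ apply Rle_trans with (x * (2 * (Rabs (g B6) / x))).
  - replace (x * (2 * (Rabs (g B6) / x))) with (2 * Rabs (g B6)) by (field; lra). lra.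
  - apply Rmult_le_compat_l; [lra|]. unfold G in hgs. lra. }
assert (hgsK : 2 * Rabs K1 <= phi * gs).
{ apply Rle_trans with (phi * (2 * Rabs K1 / phi)); [right; field; lra|].
  apply Rmult_le_compat_l; [lra|]. unfold G in hgs. lra. }
assert (hgsG : 2 * G0 + 2 <= gs) by (unfold G in hgs; lra).
clear hgs.
assert (HB6 : good f g g1 g2 h t0 H 1 B6) by (apply good_mono with B5; trivial).
set (gm := (1 - nu) * gs) in *.
assert (hgm : gs / 2 <= gm <= gs).
{ assert (0 <= (1 / 2 - nu) * gs) by (apply Rmult_le_pos; lra).
  assert (0 <= nu * gs) by (apply Rmult_le_pos; lra). unfold gm. lra. }
assert (hxgm : g B6 <= x * gm) by (clear - hgm hx hgsx; nra).
(* [A] and [A2] are both just past the bubble, with [z] near [2 + a]. Decay is measured from [A],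
   but it is effective only from [A2] on, since the exponent vanishes at [A]. [C] is the arrival. *)
destruct (glevel HG Hf0 HW HS HB6 s gm hs ltac:(lra)) as [A [hA1 [hA2 hA3]]].
{ fold gs. clear - hx hxgm hgm hgsG hG0; split; nra. }
destruct (glevel HG Hf0 HW HS HB6 A ((1 - 2 * nu) * gs) ltac:(lra) hA2) as [A2 [hA21 [hA22 hA23]]].
{ rewrite hA3. split.
  - assert (0 <= (1 - 2 * nu - x / 2) * gs) by (apply Rmult_le_pos; lra). lra.
  - unfold gm. clear - q0 hgsG hG0; nra. }
destruct (glevel HG Hf0 HW HS HB6 A2 (x * gm) ltac:(lra) hA22) as [C [hC1 [hC2 hC3]]].
{ rewrite hA23. split; [lra|].
  assert (i1 : 0 <= ((1 - x) - 2 * nu) * gs) by (apply Rmult_le_pos; lra).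
  assert (i2 : 0 <= x * nu * gs) by (apply Rmult_le_pos; [apply Rmult_le_pos|]; lra).
  unfold gm. lra. }
assert (hzA : Rabs (zf g1 U Y A - (2 + a)) <= e1).
{ apply (hex1 _ _ _ _ HS s hs ltac:(lra) hz ltac:(lra) A hA1); [lra|exact hA3]. }
assert (hzA2 : Rabs (zf g1 U Y A2 - (2 + a)) <= e1).
{ apply (hex2 _ _ _ _ HS s hs ltac:(lra) hz ltac:(lra) A2 ltac:(lra)); [lra|exact hA23]. }
apply Rabs_le_between in hzA. apply Rabs_le_between in hzA2.
set (m := U A) in *. set (uC := U C) in *.
assert (hUA2 : uC <= U A2 <= m) by (split; apply (U_anti Hf0 HW HS); lra).
assert (hms : m <= U s) by (apply (U_anti Hf0 HW HS); lra).
assert (g1m := growth_g1 HG m ltac:(lra)).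
assert (g1C := growth_g1 HG uC ltac:(lra)).
assert (g1A2 := growth_g1 HG (U A2) ltac:(lra)).
assert (hgm0 : 0 < gm) by lra.
assert (hquot : g uC / g m = x) by (rewrite hC3, hA3; field; lra).
assert (hr := hratio uC m ltac:(lra) ltac:(rewrite hA3, hC3; lra)). rewrite hquot in hr.
assert (hT := hgap uC m ltac:(lra) ltac:(rewrite hA3, hC3; lra)). rewrite hquot in hT. fold L in hT.
apply Rabs_le_between in hT. set (T := (m - uC) * g1 m / g m) in *.
assert (hTm : (m - uC) * g1 m = T * gm) by (unfold T; rewrite hA3; field; lra).
set (r := g1 uC / g1 m) in *.
assert (hr' : (1 - e1) * P <= r <= (1 + e1) * P).
{ rewrite Rpower_Ropp in hr. fold P in hr.
  replace r with (r * / P * P) by (field; lra).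
  split; apply Rmult_le_compat_r; lra. }
assert (hrpos : P / 2 <= r) by (clear - hr' hP p2; clearbody r P; nra).
assert (hrm : g1 uC = r * g1 m) by (unfold r; field; lra).
assert (YA2 := Y_ge0 Hf0 HW HS A2 ltac:(lra)).
assert (YC := Y_ge0 Hf0 HW HS C ltac:(lra)).
assert (hzAe : zf g1 U Y A = g1 m * Y A) by reflexivity.
assert (hzCe : zf g1 U Y C = g1 uC * Y C) by reflexivity.
assert (hzA2e : zf g1 U Y A2 = g1 (U A2) * Y A2) by reflexivity.
assert (YAp : 0 < Y A).
{ apply Rmult_lt_reg_l with (g1 m); trivial. rewrite Rmult_0_r, <- hzAe. lra. }
assert (hTpos : 0 <= T).
{ unfold T. rewrite hA3. apply Rmult_le_pos; [apply Rmult_le_pos; lra|left; apply Rinv_0_lt_compat; lra]. }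
(* the exponent [k] of the decay of [rho] along the neck is concave in [U] *)
assert (hkC : phi / 2 * gm <= (gm - x * gm) - 2 * (m - uC) / Y A).
{ replace (2 * (m - uC) / Y A) with (2 * T * gm / zf g1 U Y A).
  2:{ rewrite hzAe. replace (2 * T * gm) with (2 * (T * gm)) by ring. rewrite <- hTm. field. lra. }
  replace (2 * T * gm / zf g1 U Y A) with (2 * T / zf g1 U Y A * gm) by (field; lra).
  enough (hen : 2 * T / zf g1 U Y A <= 1 - x - phi / 2).
  { apply Rmult_le_compat_r with (r := gm) in hen; lra. }
  apply Rmult_le_reg_r with (zf g1 U Y A); [lra|].
  replace (2 * T / zf g1 U Y A * zf g1 U Y A) with (2 * T) by (field; lra).
  assert (i : (1 - x - phi) * (2 + a) = 2 * L) by (unfold phi; field; lra).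
  assert (i0 : 0 <= 1 - x - phi).
  { unfold phi. replace (1 - x - (1 - x - 2 / (2 + a) * L)) with (2 / (2 + a) * L) by ring.
    apply Rmult_le_pos; [left; apply div_pos; lra|trivial]. }
  assert (j : (1 - x - phi / 2) * (2 + a - e1) <= (1 - x - phi / 2) * zf g1 U Y A).
  { apply Rmult_le_compat_l; lra. }
  assert (k : (1 - x - phi) * e1 <= L * e1).
  { apply Rmult_le_compat_r; [lra|]. clear - i i0 ha; nra. }
  assert (m1 : e1 * phi <= 1 / 10 * phi) by (apply Rmult_le_compat_r; lra).
  assert (m2 : 0 <= a * phi) by (apply Rmult_le_pos; lra).
  clear - i j k p5 hT m1 m2 p0 hphi; clearbody phi; lra. }
assert (hrho_neck : forall y, A2 <= y <= C -> rhof h g g1 lam U y <= K0 * exp (- c3 * gm)).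
{ intros y hy.
  assert (hUy : uC <= U y <= U A2) by (split; apply (U_anti Hf0 HW HS); lra).
  assert (i := ln_rho_diff HG Hf0 HW HS HB6 A y ltac:(lra) ltac:(lra)).
  fold m in i. rewrite hA3 in i. fold Ch in i.
  assert (hl : ln (g1 (U y)) <= ln (g1 m)).
  { apply ln_le; [apply (growth_g1 HG); lra|apply (g1_le HG); lra]. }
  destruct (good_at HW HS HB6 A ltac:(lra) hA2) as [_ [_ [_ [_ j5]]]].
  destruct (good_at HW HS HB6 y ltac:(lra) ltac:(lra)) as [_ [_ [_ [_ j6]]]].
  assert (hl3 : ln (rhof h g g1 lam U A) <= ln 3) by (apply ln_le; lra).
  destruct (U_drop Hf0 HW HS A y ltac:(lra)) as [hdrop _]. fold m in hdrop.
  assert (hdrop2 : y - A <= (m - U y) / Y A).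
  { apply Rmult_le_reg_r with (Y A); trivial.
    replace ((m - U y) / Y A * Y A) with (m - U y) by (field; lra). lra. }
  set (k := (gm - g (U y)) - 2 * ((m - U y) / Y A)).
  assert (hchord := g_chord HG uC (U y) m ltac:(lra) ltac:(lra)).
  rewrite hA3, hC3 in hchord.
  assert (hk1 : (gm - x * gm - 2 * (m - uC) / Y A) * (m - U y) <= k * (m - uC)).
  { replace ((gm - x * gm - 2 * (m - uC) / Y A) * (m - U y))
      with ((gm - x * gm) * (m - U y) - 2 * ((m - U y) / Y A) * (m - uC)) by (field; lra).
    unfold k. clear - hchord; nra. }
  assert (hfrac : nu * (m - uC) <= (L + 1) * (m - U y)).
  { apply Rmult_le_reg_r with (g1 m); trivial.
    assert (i1 := g_convex_upper HG (U A2) m ltac:(lra) ltac:(lra)). rewrite hA3, hA23 in i1.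
    assert (i2 : g1 m * (m - U A2) <= g1 m * (m - U y)) by (apply Rmult_le_compat_l; lra).
    assert (i3 : nu * gm <= (m - U y) * g1 m) by (unfold gm; clear - i1 i2 q0 hgsG hG0; unfold gm in *; nra).
    assert (i4 : (L + 1) * (nu * gm) <= (L + 1) * ((m - U y) * g1 m)) by (apply Rmult_le_compat_l; lra).
    replace (nu * (m - uC) * g1 m) with (nu * ((m - uC) * g1 m)) by ring. rewrite hTm.
    assert (i5 : nu * (T * gm) <= nu * ((L + 1) * gm)).
    { apply Rmult_le_compat_l; [lra|]. apply Rmult_le_compat_r; lra. }
    lra. }
  assert (hmC : 0 < m - uC).
  { enough (uC < m) by lra. apply (g_lt_inv HG); [lra|lra|]. rewrite hC3, hA3. clear - hx hgm0; nra. }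
  assert (hk2 : c3 * gm <= k).
  { apply Rmult_le_reg_r with ((m - uC) * (L + 1)); [apply Rmult_lt_0_compat; lra|].
    replace (c3 * gm * ((m - uC) * (L + 1))) with (phi / 2 * gm * (nu * (m - uC)))
      by (unfold c3; field; lra).
    apply Rle_trans with (phi / 2 * gm * ((L + 1) * (m - U y))).
    - apply Rmult_le_compat_l; [|trivial]. apply Rmult_le_pos; lra.
    - replace (phi / 2 * gm * ((L + 1) * (m - U y)))
        with ((phi / 2 * gm * (m - U y)) * (L + 1)) by ring.
      replace (k * ((m - uC) * (L + 1))) with ((k * (m - uC)) * (L + 1)) by ring.
      apply Rmult_le_compat_r; [lra|].
      apply Rle_trans with (2 := hk1). apply Rmult_le_compat_r; lra. }
  assert (hfin : ln (rhof h g g1 lam U y) <= ln (K0 * exp (- c3 * gm))).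
  { unfold K0. rewrite !ln_mult, !ln_exp; try apply exp_pos; try lra.
    - unfold k in hk2. lra.
    - apply Rmult_lt_0_compat; [lra|apply exp_pos]. }
  apply exp_le in hfin. rewrite !exp_ln in hfin; try lra.
  apply Rmult_lt_0_compat; [trivial|apply exp_pos]. }
assert (hG0gm : G0 <= gm) by lra.
specialize (hdec gm hG0gm).
set (tau := K0 * exp (- c3 * gm)) in *.
assert (htau : 0 < tau) by (apply Rmult_lt_0_compat; [trivial|apply exp_pos]).
assert (hdec' : 2 * tau * (L + 1) * gm <= e1 ^ 2) by (unfold tau; lra).
set (zC := zf g1 U Y C) in *.
(* The value that [z] would have at [C] if [Y] were constant from [A2] on. *)
pose (X := g1 uC * Y A2).
assert (hX0 : 0 <= X) by (apply Rmult_le_pos; lra).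
assert (hsq : zC ^ 2 <= X ^ 2 + e1 ^ 2).
{ assert (i := Y_sq_incr HG Hf0 Hf HW HS A2 C tau ltac:(lra) ltac:(fold uC; lra) hrho_neck).
  fold uC in i.
  assert (j : (g1 uC) ^ 2 * (Y C ^ 2 - Y A2 ^ 2) <= (g1 uC) ^ 2 * (2 * tau * (U A2 - uC) / g1 uC)).
  { apply Rmult_le_compat_l; [apply pow2_ge_0|trivial]. }
  replace (g1 uC ^ 2 * (2 * tau * (U A2 - uC) / g1 uC))
    with (2 * tau * ((U A2 - uC) * g1 uC)) in j by (field; lra).
  assert (k : (U A2 - uC) * g1 uC <= (m - uC) * g1 m).
  { apply Rmult_le_compat; try lra. apply (g1_le HG); lra. }
  rewrite hTm in k.
  assert (l : 2 * tau * ((U A2 - uC) * g1 uC) <= 2 * tau * ((L + 1) * gm)).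
  { apply Rmult_le_compat_l; [lra|]. apply Rle_trans with (1 := k). apply Rmult_le_compat_r; lra. }
  unfold X. rewrite hzCe. clear - j l hdec'; nra. }
assert (hzC0 : 0 <= zC) by (rewrite hzCe; apply Rmult_le_pos; lra).
assert (hzCX : zC <= X + e1) by (clear - hzC0 hX0 hsq p0; clearbody zC X; nra).
assert (hF : g1 m <= (1 + e1) * g1 (U A2)).
{ assert (i1 : (1 - nu / (1 - nu)) * g m <= g (U A2)).
  { rewrite hA3, hA23. right. unfold gm. field. lra. }
  assert (i0 : 0 <= nu / (1 - nu) <= 2 * nu).
  { split; [left; apply div_pos; lra|].
    apply Rmult_le_reg_r with (1 - nu); [lra|].
    replace (nu / (1 - nu) * (1 - nu)) with nu by (field; lra). clear - q0 q2 p2; nra. }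
  assert (i2 := ln_g1_level 1 B6 (U A2) m (1 - nu / (1 - nu)) HB6 ltac:(lra) ltac:(lra) i1).
  assert (i3 := neg_ln_le (nu / (1 - nu)) ltac:(lra)).
  assert (i4 : ln (g1 m) <= 8 * nu + ln (g1 (U A2))) by lra.
  apply exp_le in i4. rewrite exp_plus, !exp_ln in i4 by lra.
  assert (i5 := exp_le_linear (8 * nu) ltac:(lra)).
  apply Rle_trans with (1 := i4). apply Rmult_le_compat_r; lra. }
assert (hXr : X <= (2 + a + e1) * (1 + e1) * r).
{ replace X with (zf g1 U Y A2 * r * (g1 m / g1 (U A2))).
  2:{ rewrite hzA2e, hrm || idtac. unfold X, r. rewrite hzA2e. field. lra. }
  assert (i1 : g1 m / g1 (U A2) <= 1 + e1).
  { apply Rmult_le_reg_r with (g1 (U A2)); [lra|].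
    replace (g1 m / g1 (U A2) * g1 (U A2)) with (g1 m) by (field; lra). lra. }
  assert (i2 : 0 < g1 m / g1 (U A2)) by (apply div_pos; lra).
  replace ((2 + a + e1) * (1 + e1) * r) with ((2 + a + e1) * r * (1 + e1)) by ring.
  apply Rmult_le_compat; try lra; [apply Rmult_le_pos; lra|].
  apply Rmult_le_compat_r; lra. }
assert (hzCup : zC <= P * (2 + a) + 11 * e1).
{ assert (i1 : (2 + a + e1) * (1 + e1) * r <= (2 + a + e1) * (1 + e1) * ((1 + e1) * P)).
  { apply Rmult_le_compat_l; [|lra]. apply Rmult_le_pos; lra. }
  assert (i2 : (2 + a + e1) * (1 + e1) * (1 + e1) <= 2 + a + 10 * e1) by (clear - p0 p2 ha; nra).
  assert (i3 : (2 + a + e1) * (1 + e1) * (1 + e1) * P <= (2 + a + 10 * e1) * P).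
  { apply Rmult_le_compat_r; lra. }
  assert (i4 : e1 * P <= e1) by (clear - p0 hP; nra).
  lra. }
assert (hYAC : Y A <= Y C) by (apply (Y_le Hf0 HW HS); lra).
assert (hzClow : P * (2 + a) - 5 * e1 <= zC).
{ assert (i1 : zC >= zf g1 U Y A * r).
  { rewrite hzCe, hzAe, hrm. apply Rle_ge.
    replace (g1 m * Y A * r) with (r * g1 m * Y A) by ring. apply Rmult_le_compat_l; [|trivial].
    apply Rmult_le_pos; lra. }
  assert (i2 : (2 + a - e1) * ((1 - e1) * P) <= zf g1 U Y A * r).
  { apply Rmult_le_compat; try lra. apply Rmult_le_pos; lra. }
  assert (i3 : 0 <= e1 * (2 - a) * P) by (apply Rmult_le_pos; [apply Rmult_le_pos|]; lra).
  assert (i4 : 0 <= e1 * (1 - P)) by (apply Rmult_le_pos; lra).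
  assert (i5 : 0 <= e1 * e1 * P) by (apply Rmult_le_pos; [apply Rmult_le_pos|]; lra).
  lra. }
exists C. split; [lra|]. split; [fold uC; lra|].
split; [|split; [|split]].
- fold uC. rewrite hC3. unfold gm.
  replace (x * ((1 - nu) * gs) - x * gs) with (- (x * nu * gs)) by ring.
  rewrite Rabs_Ropp, Rabs_pos_eq.
  + apply Rmult_le_compat_r; [lra|]. clear - hx q0 q5; nra.
  + apply Rmult_le_pos; [|lra]. apply Rmult_le_pos; lra.
- fold zC. apply Rabs_le_between. lra.
- apply Rle_trans with tau; [apply hrho_neck; lra|].
  assert (i1 : e1 ^ 2 <= e) by (clear - p0 p1 p2; nra).
  assert (i2 : 1 <= (L + 1) * gm) by (clear - hL hgm hgsG hG0; nra).
  clear - i1 i2 hdec' htau. clearbody tau. nra.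
(* [ln rho] starts above [ln (a^2 / 4)]. From [s] to [A] it loses little more than [gs - gm]; from
   [A] to [C] the crossing time is bounded below because [Y] never exceeds [Y C]. *)
- assert (i1 := ln_rho_diff HG Hf0 HW HS HB6 s A hA1 hA2).
  fold m gs in i1. rewrite hA3 in i1. fold Ch in i1.
  assert (i2 := ln_rho_diff HG Hf0 HW HS HB6 A C ltac:(lra) hC2).
  fold m uC in i2. rewrite hA3, hC3 in i2. fold Ch in i2.
  assert (j1 := ln_g1_level 1 B6 m (U s) (1 - nu) HB6 ltac:(lra) ltac:(lra) ltac:(fold gs; rewrite hA3; unfold gm; lra)).
  assert (j2 := neg_ln_le nu ltac:(lra)).
  assert (j3 := ln_g1_level 1 B6 uC m x HB6 ltac:(lra) ltac:(lra) ltac:(rewrite hA3, hC3; lra)).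
  assert (j4 : ln (a ^ 2 / 4) <= ln (rhof h g g1 lam U s)).
  { apply Rabs_le_between in hrho. apply ln_le; [clear - ha; nra|]. lra. }
  destruct (U_drop Hf0 HW HS A C ltac:(lra)) as [_ hdrop]. fold m uC in hdrop.
  pose (Z := 2 + a + e1 * (6 + 2 / P)).
  assert (hZ2 : 2 <= Z) by (unfold Z; assert (0 < e1 * (6 + 2 / P)) by (apply Rmult_lt_0_compat; lra); lra).
  assert (hYC : Y C * g1 m <= Z).
  { apply Rmult_le_reg_r with r; [lra|].
    replace (Y C * g1 m * r) with zC by (rewrite hzCe, hrm; ring).
    apply Rle_trans with (1 := hzCX).
    assert (k1 : e1 <= e1 * (2 / P) * r).
    { apply Rle_trans with (e1 * (2 / P) * (P / 2)); [right; field; lra|].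
      apply Rmult_le_compat_l; [|lra]. apply Rmult_le_pos; lra. }
    assert (k2 : (2 + a + e1) * (1 + e1) <= 2 + a + 6 * e1) by (clear - p0 p2 ha; nra).
    assert (k6 : (2 + a + e1) * (1 + e1) * r <= (2 + a + 6 * e1) * r) by (apply Rmult_le_compat_r; lra).
    unfold Z. lra. }
  assert (hCA : T * gm <= Z * (C - A)).
  { rewrite <- hTm.
    apply Rle_trans with (Y C * (C - A) * g1 m); [apply Rmult_le_compat_r; lra|].
    replace (Y C * (C - A) * g1 m) with (Y C * g1 m * (C - A)) by ring.
    apply Rmult_le_compat_r; lra. }
  assert (hCA2 : (1 - x - 5 / 4 * phi) * gm <= 2 * (C - A)).
  { apply Rmult_le_reg_r with Z; [lra|].
    apply Rle_trans with (2 * T * gm); [|lra].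
    enough (hen : (1 - x - 5 / 4 * phi) * Z <= 2 * T).
    { apply Rmult_le_compat_r with (r := gm) in hen; lra. }
    assert (k1 : (1 - x - phi) * (2 + a) = 2 * L) by (unfold phi; field; lra).
    assert (k2 : 1 - x - phi <= L).
    { unfold phi. replace (1 - x - (1 - x - 2 / (2 + a) * L)) with (2 / (2 + a) * L) by ring.
      rewrite <- (Rmult_1_l L) at 2. apply Rmult_le_compat_r; [trivial|].
      apply Rmult_le_reg_r with (2 + a); [lra|].
      replace (2 / (2 + a) * (2 + a)) with 2 by (field; lra). lra. }
    assert (k6 : (1 - x - phi) * (e1 * (6 + 2 / P)) <= L * (e1 * (6 + 2 / P))).
    { apply Rmult_le_compat_r; [|trivial]. apply Rmult_le_pos; lra. }
    assert (k7 : phi / 4 * Z >= phi / 2) by (clear - hphi hZ2; clearbody Z phi; nra).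
    assert (k8 : 0 <= e1 * (L * (6 + 2 / P))) by (apply Rmult_le_pos; lra).
    unfold Z in *. lra. }
  assert (habsK := Rle_abs (- K1)). rewrite Rabs_Ropp in habsK.
  assert (hK1 : - (phi / 2) * gs <= K1) by lra.
  assert (hgmphi : phi * gm <= phi * gs) by (apply Rmult_le_compat_l; lra).
  assert (hnug : gs - gm <= phi / 8 * gs) by (unfold gm; clear - q0 q3 hgsG hG0; nra).
  unfold K1 in hK1. lra.
Qed.

End Step.

(** * The next bubble *)

Lemma continuous_near (F : R -> R) (x eta : R) : continuous F x -> 0 < eta ->
  exists e, 0 < e /\ forall t, Rabs (t - x) < e -> Rabs (F t - F x) < eta.
Proof.
intros hc he.
destruct (proj1 (filterlim_locally F (F x)) hc (mkposreal eta he)) as [[e hpos] h].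
exists e. split; [trivial|]. intros t ht. apply h. exact ht.
Qed.

(** At a root of the neck equation, the strict inequality [Lam_tangent] says exactly that the
    arrival value [x^beta * (2 + a)] of [z] is below 2, so the new amplitude is positive. *)
Lemma amplitude_pos (beta a x : R) : 0 < beta -> 0 < a -> 0 < x < 1 ->
  2 / (2 + a) * Lam beta x = 1 - x -> 0 < 2 - Rpower x beta * (2 + a) < 2.
Proof.
intros hb ha hx he.
assert (i := Lam_tangent beta x hb hx). rewrite Rpower_Ropp in i.
assert (hP := Rpower_pos x beta).
set (P := Rpower x beta) in *. set (L := Lam beta x) in *. clearbody P L.
assert (j : 2 * L = (1 - x) * (2 + a)) by (rewrite <- he; field; lra).
assert (k : L * P < 1 - x).
{ apply Rmult_lt_compat_r with (r := P) in i; trivial.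
  replace (/ P * (1 - x) * P) with (1 - x) in i by (field; lra). trivial. }
assert (0 < P * (2 + a)) by (apply Rmult_lt_0_compat; lra).
split; [|lra].
apply Rmult_lt_reg_l with (1 - x); [lra|].
replace ((1 - x) * (2 - P * (2 + a))) with (2 * (1 - x) - P * ((1 - x) * (2 + a))) by ring.
rewrite <- j. lra.
Qed.

(** [neck] requires a positive exponent, so it must stop slightly before the root. The exponent is
    increasing there: its derivative is [-1 + 2 / ((2 + a) * x^beta)], positive by
    [amplitude_pos]. *)
Lemma above_root (beta a x eta : R) : 0 < beta -> 0 < a -> 0 < x < 1 -> 0 < eta ->
  2 / (2 + a) * Lam beta x = 1 - x ->
  exists y, x < y < 1 /\ y <= x + eta /\ 0 < 1 - y - 2 / (2 + a) * Lam beta y <= eta /\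
    Rabs (Rpower y beta - Rpower x beta) <= eta.
Proof.
intros hb ha hx heta he.
assert (hap := amplitude_pos beta a x hb ha hx he).
pose (F := fun y => 1 - y - 2 / (2 + a) * Lam beta y).
assert (hF : F x = 0) by (unfold F; lra).
assert (hd : is_derive F x (- 1 + 2 / (2 + a) * / Rpower x beta)).
{ assert (d := Lam_derive beta x ltac:(lra)). unfold F. auto_derive.
  - eexists; eassumption.
  - rewrite (Derive_eta d), Rpower_Ropp. ring. }
assert (hP := Rpower_pos x beta).
destruct (derive_pos_right F x _ hd) as [e1 [he1 h1]].
{ assert (i : 1 < 2 / (2 + a) * / Rpower x beta); [|lra].
  apply Rmult_lt_reg_r with ((2 + a) * Rpower x beta); [apply Rmult_lt_0_compat; lra|].
  replace (2 / (2 + a) * / Rpower x beta * ((2 + a) * Rpower x beta)) with 2 by (field; lra). lra. }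
destruct (continuous_near F x eta) as [e2 [he2 h2]]; trivial.
{ apply @ex_derive_continuous. eexists; eassumption. }
destruct (continuous_near (fun y => Rpower y beta) x eta) as [e3 [he3 h3]]; trivial.
{ apply @ex_derive_continuous. unfold Rpower. auto_derive. lra. }
destruct (exists_small (e1 / 2) (e2 / 2) (e3 / 2) eta ((1 - x) / 2)) as [e [k0 [k1 [k2 [k3 [k4 k5]]]]]]; try lra.
exists (x + e). split; [lra|]. split; [lra|].
assert (habs : Rabs (x + e - x) = e) by (rewrite Rabs_pos_eq; lra).
specialize (h2 (x + e) ltac:(lra)). specialize (h3 (x + e) ltac:(lra)).
specialize (h1 (x + e) ltac:(lra)). apply Rabs_def2 in h2.
unfold F in h1, h2, hF. split; lra.
Qed.

(** The quantification over all solutions of large height is what makes the induction on bubbles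
    possible without extracting subsequences. *)
Definition bubble_near (f g g1 h : R -> R) (t0 b et eps : R) : Prop :=
  exists B, t0 < B /\ forall lam mu U Y, sol h f lam mu U Y -> B <= mu ->
  exists s, s < 0 /\ t0 < U s /\ Rabs (g (U s) / g mu - et) <= eps /\
    zf g1 U Y s = 2 /\ Rabs (rhof h g g1 lam U s - b ^ 2 / 2) <= eps.

Section Next.
Context {f g g1 g2 : R -> R} {t0 beta : R} (HG : growth g g1 g2 t0 beta).
Context (Hf0 : forall t, 0 <= t -> 0 <= f t).
Context (Hf : forall t, t0 < t -> f t = exp (g t)).
Context {h h1 : R -> R} {hm hM H : R} (HW : weight h h1 hm hM H).

(** At a level just above [x], the neck delivers [z] near [2 - a'] with [rho] tiny, so [Q] is near
    [a'^2 / 2]. The level then drops only by a factor close to 1, so [Q] is kept and it remains to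
    see that [z] crosses 2 in that window. *)
Lemma next_bubble (a x eps : R) : 0 < a <= 2 -> 0 < x < 1 -> 0 < eps ->
  2 / (2 + a) * Lam beta x = 1 - x ->
  let a' := 2 - Rpower x beta * (2 + a) in
  exists delta B, 0 < delta /\ t0 < B /\
  forall lam mu U Y, sol h f lam mu U Y -> forall s, s < 0 -> B <= U s ->
  zf g1 U Y s = 2 -> Rabs (rhof h g g1 lam U s - a ^ 2 / 2) <= delta ->
  exists t, s <= t < 0 /\ t0 < U t /\ Rabs (g (U t) - x * g (U s)) <= eps * g (U s) /\
    zf g1 U Y t = 2 /\ Rabs (rhof h g g1 lam U t - a' ^ 2 / 2) <= eps.
Proof.
intros ha hx heps hroot a'.
assert (hbeta := growth_beta HG).
assert (ha' := amplitude_pos beta a x ltac:(lra) ltac:(lra) hx hroot). fold a' in ha'.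
assert (ha2 : 0 < a' ^ 2) by (apply pow_lt; lra).
destruct (exists_small eps (a' ^ 2 / 16) (a' / 2) 1 1) as [w [w0 [w1 [w2 [w3 [w4 _]]]]]]; try lra.
destruct (exists_small (w / 1000) (1 / 4) (eps / 4) 1 1) as [d [d0 [d1 [d2 [d3 _]]]]]; try lra.
assert (hxd : 0 < x * d) by (apply Rmult_lt_0_compat; lra).
assert (haxd : 0 < a' * (x * d)) by (apply Rmult_lt_0_compat; lra).
(* The second bound makes the deficit [2 * phi * gs] of [ln rho] at most half of the growth
   available between [C] and [E]. *)
destruct (exists_small (x * d) (a' * (x * d) / 120) (w / 128) 1 1) as [eta [t1 [t2 [t3 [t4 _]]]]]; try lra.
destruct (above_root beta a x eta ltac:(lra) ltac:(lra) hx t1 hroot) as [xC [hxC [hxC2 [hphi hPC]]]].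
destruct (exists_small (w / 64) (xC - x) (x * d) 1 1) as [e [e0 [e1 [e2 [e3 [e4 _]]]]]]; try lra.
destruct (neck HG Hf0 Hf HW a xC e ha ltac:(lra) ltac:(lra) (proj1 hphi)) as [delta [B1 [hdelta [hB1 hneck]]]].
set (phi := 1 - xC - 2 / (2 + a) * Lam beta xC) in *.
destruct (exists_small (w / 24) (a' ^ 2 / 400) (a' / 100) 1 1) as [nu [n0 [n1 [n2 [n3 [n4 _]]]]]]; try lra.
assert (hnu : 0 < nu <= 1) by lra.
destruct (good_exists HG Hf0 Hf HW nu hnu) as [B2 HB]. assert (hB2 := proj1 HB).
pose (G := 2 * Rabs (g B2) / x + 200 / (a' * (x * d))).
destruct (exists_large HG B1 B2 B2 B2 G hB1) as [B [l1 [l2 [_ [_ hG]]]]].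
exists delta, B. split; [trivial|]. split; [lra|].
intros lam mu U Y HS s hs hUs hz hrho.
destruct (hneck lam mu U Y HS s hs ltac:(lra) hz hrho) as [C [hC1 [hC2 [hC3 [hC4 [hC5 hC6]]]]]].
set (gs := g (U s)) in *.
assert (hgs := hG _ hUs). fold gs in hgs.
assert (q1 : 0 < 200 / (a' * (x * d))) by (apply div_pos; lra).
assert (q2 : 0 <= 2 * Rabs (g B2) / x).
{ apply Rmult_le_pos; [assert (i := Rabs_pos (g B2)); lra|left; apply Rinv_0_lt_compat; lra]. }
assert (habs := Rle_abs (g B2)).
assert (hgs0 : 0 < gs) by (unfold G in hgs; lra).
assert (hgx : 2 * g B2 <= x * gs).
{ apply Rle_trans with (x * (2 * Rabs (g B2) / x)).
  - replace (x * (2 * Rabs (g B2) / x)) with (2 * Rabs (g B2)) by (field; lra). lra.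
  - apply Rmult_le_compat_l; [lra|]. unfold G in hgs. lra. }
assert (hga : 200 <= a' * (x * d * gs)).
{ apply Rle_trans with (a' * (x * d) * (200 / (a' * (x * d)))); [right; field; lra|].
  replace (a' * (x * d * gs)) with (a' * (x * d) * gs) by ring.
  apply Rmult_le_compat_l; [lra|]. unfold G in hgs. lra. }
clear hgs.
assert (hxgs : 0 < x * gs) by (apply Rmult_lt_0_compat; lra).
assert (hxdgs : 0 < x * d * gs) by (apply Rmult_lt_0_compat; lra).
assert (hd4 : x * d * gs <= x * gs / 4).
{ replace (x * d * gs) with (d * (x * gs)) by ring.
  apply Rle_trans with (1 / 4 * (x * gs)); [apply Rmult_le_compat_r; lra|lra]. }
apply Rabs_le_between in hC3. apply Rabs_le_between in hC4.
assert (hgC : x * gs <= g (U C) <= x * gs + 2 * (x * d * gs)).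
{ assert (i1 : x * gs <= (xC - e) * gs) by (apply Rmult_le_compat_r; lra).
  assert (i2 : (xC + e) * gs <= (x + 2 * (x * d)) * gs) by (apply Rmult_le_compat_r; lra).
  lra. }
assert (hBC : B2 <= U C) by (apply (g_le_inv HG); lra).
destruct (glevel HG Hf0 HW HS HB C (x * gs - x * d * gs / 2) ltac:(lra) hBC) as [E [hE1 [hE2 hE3]]]; [lra|].
destruct (glevel HG Hf0 HW HS HB E (x * gs - x * d * gs) ltac:(lra) hE2) as [D [hD1 [hD2 hD3]]]; [lra|].
assert (hUx : forall y, C <= y <= D -> U D <= U y <= U C).
{ intros y hy. split; apply (U_anti Hf0 HW HS); lra. }
apply Rabs_le_between in hPC.
assert (hyb : Rabs (zf g1 U Y C - (2 - a')) <= w / 16).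
{ replace (2 - a') with (Rpower x beta * (2 + a)) by (unfold a'; ring).
  assert (i : - (w / 128) * 4 <= (Rpower xC beta - Rpower x beta) * (2 + a) <= w / 128 * 4).
  { set (v := Rpower xC beta - Rpower x beta) in *.
    assert (hv1 : 0 <= (v + w / 128) * (2 + a)) by (apply Rmult_le_pos; lra).
    assert (hv2 : 0 <= (w / 128 - v) * (2 + a)) by (apply Rmult_le_pos; lra).
    assert (hv3 : 0 <= w / 128 * (2 - a)) by (apply Rmult_le_pos; lra). lra. }
  apply Rabs_le_between. lra. }
assert (hQC : Rabs (Qf h g g1 lam U Y C - a' ^ 2 / 2) <= w / 4).
{ destruct (good_at HW HS HB C ltac:(lra) hBC) as [_ [_ [_ [_ j5]]]].
  unfold Qf. set (y := zf g1 U Y C - (2 - a')) in *.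
  replace (zf g1 U Y C - 2) with (y - a') by (unfold y; ring).
  clearbody y. apply Rabs_le_between in hyb. apply Rabs_le_between.
  clear - ha' j5 hC5 e1 hyb w0 w4.
  assert (- (w / 8) <= a' * y <= w / 8) by (split; nra).
  assert (0 <= y ^ 2 <= w / 16) by (split; [apply pow2_ge_0|nra]).
  split; lra. }
assert (hQ : forall y, C <= y <= D -> Rabs (Qf h g g1 lam U Y y - a' ^ 2 / 2) <= w).
{ intros y hy. assert (hUy := hUx y hy).
  assert (i := Q_var HG Hf0 Hf HW HS hnu HB C y ltac:(lra) ltac:(lra)).
  assert (hgy : g (U D) <= g (U y)) by (apply (g_le HG); lra).
  assert (j := ln_g1_level nu B2 (U y) (U C) (1 - 3 * d) HB ltac:(lra) ltac:(lra)).
  lapply j; [clear j; intros j|].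
  - assert (k := neg_ln_le (3 * d) ltac:(lra)).
    apply Rabs_le_between in i. apply Rabs_le_between in hQC. apply Rabs_le_between. lra.
  - assert (k : (1 - 3 * d) * g (U C) <= (1 - 3 * d) * (x * gs + 2 * (x * d * gs))).
    { apply Rmult_le_compat_l; lra. }
    assert (0 <= d * d * (x * gs)) by (apply Rmult_le_pos; [apply Rmult_le_pos|]; lra).
    lra. }
assert (hzc : forall y, C <= y <= D -> continuous (zf g1 U Y) y).
{ intros y hy. assert (i := hUx y hy). apply (z_cont HG Hf HS); lra. }
assert (hzC : zf g1 U Y C < 2) by (apply Rabs_le_between in hyb; lra).
(* Between [C] and [E], [z <= 2 - a' / 2] would make [ln rho] grow at rate [a' / 3] until [rho]
   exceeds its bound 3. So [z] passes [2 - a' / 2], and between [E] and [D] the conservation of [Q]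
   lifts it to 2. *)
assert (hex : exists y, C <= y <= D /\ 2 <= zf g1 U Y y).
{ apply NNPP. intros hno.
  assert (hz2 : forall y, C <= y <= D -> zf g1 U Y y < 2).
  { intros y hy. apply Rnot_le_lt; intros hle. apply hno. now exists y. }
  assert (hED := g_drop_le HG Hf0 HW HS HB E D hD1 hD2). rewrite hE3, hD3 in hED.
  assert (hCE := g_drop_le HG Hf0 HW HS HB C E hE1 hE2). rewrite hE3 in hCE.
  assert (hED5 : x * d * gs / 10 <= D - E) by (clear - hED hnu hxdgs hD1; nra).
  assert (hCE5 : x * d * gs / 10 <= E - C) by (clear - hCE hnu hxdgs hE1 hgC; nra).
  assert (hs1 : exists s1, C <= s1 <= E /\ 2 - a' / 2 < zf g1 U Y s1).
  { apply NNPP. intros hno2.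
    assert (hz3 : forall y, C <= y <= E -> zf g1 U Y y <= 2 - a' / 2).
    { intros y hy. apply Rnot_lt_le; intros hle. apply hno2. now exists y. }
    assert (hgr : a' / 3 * (E - C) <= ln (rhof h g g1 lam U E) - ln (rhof h g g1 lam U C)).
    { apply (derive_ge_incr (fun y => ln (rhof h g g1 lam U y))
        (fun y => 2 + thf h h1 y - zf g1 U Y y - kapf g1 g2 (U y) * zf g1 U Y y)); [lra|..].
      - intros y hy. assert (hUy := hUx y ltac:(lra)).
        assert (dr := rho_derive HG HW HS y ltac:(lra) ltac:(lra)).
        assert (rp := rho_pos HG HW HS y ltac:(lra) ltac:(lra)).
        auto_derive; [repeat split; trivial; eexists; eassumption|].
        rewrite (Derive_eta dr). field. lra.
      - intros y hy. assert (hUy := hUx y ltac:(lra)).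
        destruct (good_at HW HS HB y ltac:(lra) ltac:(lra)) as [j1 [j2 [j3 [j4 j5]]]].
        apply Rabs_le_between in j3. specialize (hz3 y hy).
        assert (kapf g1 g2 (U y) * zf g1 U Y y <= nu * 5) by (apply Rmult_le_compat; lra).
        lra. }
    destruct (good_at HW HS HB E ltac:(lra) hE2) as [_ [_ [_ [_ j5]]]].
    assert (hl3 : ln (rhof h g g1 lam U E) <= 2).
    { apply Rle_trans with (ln (exp 2)); [|rewrite ln_exp; lra].
      apply ln_le; [lra|]. assert (i := exp_ineq1_le 2). lra. }
    assert (i1 : a' / 3 * (x * d * gs / 10) <= a' / 3 * (E - C)) by (apply Rmult_le_compat_l; lra).
    assert (i2 : 2 * phi * gs <= 2 * (a' * (x * d) / 120) * gs) by (apply Rmult_le_compat_r; lra).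
    lra. }
  destruct hs1 as [s1 [hs1 hzs1]].
  apply hno. exists D. split; [lra|].
  apply (climb (zf g1 U Y) (fun s => rhof h g g1 lam U s - kapf g1 g2 (U s) * (zf g1 U Y s) ^ 2)
    s1 D (2 - a' / 2) 2 (a' ^ 2 / 4)); try lra.
  - intros y hy. assert (hUy := hUx y ltac:(lra)). apply (z_derive HG Hf HS); lra.
  - intros y hy hzy. assert (hUy := hUx y ltac:(lra)).
    assert (i := z_slope HW HS hnu HB y w (a' ^ 2 / 2) ltac:(lra) ltac:(lra) (hQ y ltac:(lra))).
    assert ((zf g1 U Y y - 2) ^ 2 <= (a' / 2) ^ 2) by (clear - hzy ha'; nra).
    lra.
  - assert (i1 : a' * (x * d * gs / 10) <= a' * (D - s1)) by (apply Rmult_le_compat_l; lra).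
    assert (i3 : a' * 20 <= a' * (a' * (D - s1))) by (apply Rmult_le_compat_l; lra).
    lra. }
destruct hex as [y [hy hzy]].
destruct (IVT_decr (fun s => - zf g1 U Y s) C y (- 2)) as [t [ht hzt]]; try lra.
{ intros v hv. apply (continuous_opp (zf g1 U Y)). apply hzc; lra. }
assert (hUt := hUx t ltac:(lra)).
exists t. split; [lra|]. split; [lra|]. split; [|split; [lra|]].
- assert (g (U D) <= g (U t)) by (apply (g_le HG); lra).
  assert (g (U t) <= g (U C)) by (apply (g_le HG); lra).
  assert (x * d * gs <= eps / 4 * gs).
  { apply Rmult_le_compat_r; [lra|]. clear - d0 d3 hx; nra. }
  apply Rabs_le_between. lra.
- assert (j := hQ t ltac:(lra)). unfold Qf in j.
  replace (zf g1 U Y t) with 2 in j by lra.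
  replace ((2 - 2) ^ 2 / 2 + rhof h g g1 lam U t - a' ^ 2 / 2)
    with (rhof h g g1 lam U t - a' ^ 2 / 2) in j by field.
  lra.
Qed.

Lemma bubble_near_next (a x et : R) : 0 < a <= 2 -> 0 < x < 1 -> 0 < et <= 1 ->
  2 / (2 + a) * Lam beta x = 1 - x ->
  (forall eps, 0 < eps -> bubble_near f g g1 h t0 a et eps) ->
  forall eps, 0 < eps -> bubble_near f g g1 h t0 (2 - Rpower x beta * (2 + a)) (x * et) eps.
Proof.
intros ha hx het hroot hb eps heps.
destruct (next_bubble a x (eps / 4) ha hx ltac:(lra) hroot) as [delta [B1 [hdelta [hB1 hnext]]]].
destruct (exists_small delta (eps / 4) (et / 2) 1 1) as [e [e0 [e1 [e2 [e3 [e4 _]]]]]]; try lra.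
destruct (hb e e0) as [B2 [hB2 hprev]].
pose (G := 2 * Rabs (g B1) / et + 1).
destruct (exists_large HG B1 B2 B2 B2 G hB1) as [B [l1 [l2 [_ [_ hG]]]]].
exists B. split; [lra|]. intros lam mu U Y HS hmu.
destruct (hprev lam mu U Y HS ltac:(lra)) as [s [hs [hUs [hgs [hz hrho]]]]].
assert (hgmu := hG mu hmu).
assert (habs := Rle_abs (g B1)). assert (habs' := Rabs_pos (g B1)).
assert (q2 : 0 <= 2 * Rabs (g B1) / et).
{ apply Rmult_le_pos; [lra|left; apply Rinv_0_lt_compat; lra]. }
assert (hgmu0 : 0 < g mu) by (unfold G in hgmu; lra).
apply Rabs_le_between in hgs.
set (v := g (U s) / g mu) in *.
assert (hv : g (U s) = v * g mu) by (unfold v; field; lra).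
assert (hBU : B1 <= U s).
{ apply (g_le_inv HG); [lra|lra|]. rewrite hv.
  assert (i : et / 2 * (2 * Rabs (g B1) / et) <= v * g mu).
  { apply Rmult_le_compat; try lra. unfold G in hgmu. lra. }
  replace (et / 2 * (2 * Rabs (g B1) / et)) with (Rabs (g B1)) in i by (field; lra). lra. }
destruct (hnext lam mu U Y HS s hs hBU hz ltac:(lra)) as [t [ht [hUt [hgt [hzt hrt]]]]].
exists t. split; [lra|]. split; [trivial|]. split; [|split; [trivial|lra]].
apply Rabs_le_between in hgt.
assert (hUm := U_le_mu Hf0 HW HS s hs).
assert (hv1 : v <= 1).
{ apply Rmult_le_reg_r with (g mu); trivial. rewrite <- hv, Rmult_1_l. apply (g_le HG); lra. }
set (v' := g (U t) / g mu).
assert (hv' : g (U t) = v' * g mu) by (unfold v'; field; lra).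
assert (hdiff : - (eps / 4) <= v' - x * v <= eps / 4).
{ rewrite hv, hv' in hgt. split; apply Rmult_le_reg_r with (g mu); trivial.
  - assert (eps / 4 * (v * g mu) <= eps / 4 * g mu).
    { apply Rmult_le_compat_l; [lra|]. rewrite <- (Rmult_1_l (g mu)) at 2. apply Rmult_le_compat_r; lra. }
    lra.
  - assert (eps / 4 * (v * g mu) <= eps / 4 * g mu).
    { apply Rmult_le_compat_l; [lra|]. rewrite <- (Rmult_1_l (g mu)) at 2. apply Rmult_le_compat_r; lra. }
    lra. }
assert (hxv : - (eps / 4) <= x * (v - et) <= eps / 4) by (clear - hgs e2 hx; split; nra).
apply Rabs_le_between. lra.
Qed.

Lemma bubble_near_first (eps : R) : 0 < eps -> bubble_near f g g1 h t0 2 1 eps.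
Proof.
intros heps.
destruct (first_bubble HG Hf0 Hf HW eps heps) as [B1 [hB1 hfirst]].
destruct (exists_large HG B1 B1 B1 B1 1 hB1) as [B [l1 [_ [_ [_ hG]]]]].
exists B. split; [lra|]. intros lam mu U Y HS hmu.
destruct (hfirst lam mu U Y HS ltac:(lra)) as [s [hs [hUs [hgs [hz hrho]]]]].
assert (hgmu := hG mu hmu).
exists s. split; [trivial|]. split; [trivial|]. split; [|split; [trivial|]].
- assert (hUm := U_le_mu Hf0 HW HS s hs).
  assert (hle : g (U s) <= g mu) by (apply (g_le HG); lra).
  set (v := g (U s) / g mu).
  assert (hv : g (U s) = v * g mu) by (unfold v; field; lra).
  rewrite hv in hgs, hle.
  apply Rabs_le_between. split.
  + apply Rmult_le_reg_r with (g mu); lra.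
  + apply Rmult_le_reg_r with (g mu); nra.
- replace (2 ^ 2 / 2) with 2 by field. trivial.
Qed.

End Next.

(** * Uniform lower bound after the first bubble *)

Lemma g1_ratio_exp (a b k : R) : 0 < a -> 0 < b -> ln a - ln b <= k -> a <= exp k * b.
Proof.
intros ha hb hk.
assert (i : exp (ln a) <= exp (k + ln b)) by (apply exp_le; lra).
rewrite exp_plus, !exp_ln in i; trivial.
Qed.

Lemma ln_ratio_le (a b : R) : 0 < b -> b <= a -> ln a - ln b <= (a - b) / b.
Proof.
intros hb hab. rewrite <- ln_div by lra.
assert (i := ln_sub_1_le (a / b) ltac:(apply div_pos; lra)).
replace ((a - b) / b) with (a / b - 1) by (field; lra). lra.
Qed.

Section Lower.
Context {f g g1 g2 : R -> R} {t0 beta : R} (HG : growth g g1 g2 t0 beta).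
Context (Hf0 : forall t, 0 <= t -> 0 <= f t).
Context (Hf : forall t, t0 < t -> f t = exp (g t)).
Context {h h1 : R -> R} {hm hM H : R} (HW : weight h h1 hm hM H).

(* If [z] drops to a small [c] at [U = u1], then, going back to the level [m] where
   [g1 m * Y] exceeds 4, [rho] stays exponentially small and [Y] constant:
   this contradicts [z <= 4 + o(1)] at [m]. It is here that [q < 2] enters. *)
Lemma z_lower : exists c B, 0 < c /\ t0 < B /\
  forall lam mu U Y, sol h f lam mu U Y -> forall sp, sp < 0 -> t0 < U sp ->
  zf g1 U Y sp = 2 -> 1 <= rhof h g g1 lam U sp ->
  forall s, sp <= s < 0 -> B <= U s -> c <= zf g1 U Y s.
Proof.
assert (hbeta := growth_beta HG).
(* [zt] is the room left by [beta > 1/2]: it is small enough that [2 + zt] is still below the limit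
   of [Lam beta] at 0. *)
destruct (exists_small (1 / 2) ((2 * beta - 1) / 2) 1 1 1) as [zt [zt0 [zt1 [zt2 _]]]]; try lra.
pose (Z := 4 + 2 * zt). assert (hZ : 4 < Z <= 5) by (unfold Z; lra).
destruct (Lam_near0 beta (2 + zt) ltac:(lra) ltac:(lra)) as [x0 [hx0 hLam]].
{ assert (zt * (1 - beta) <= zt * (1 / 2)) by (apply Rmult_le_compat_l; lra). lra. }
(* As [beta > 1/2], the bound 1/100 gives [P <= 1/10], hence [c <= 1/2]. *)
destruct (exists_small x0 (1 / 100) 1 1 1) as [x1 [x10 [x11 [x12 _]]]]; try lra.
set (P := Rpower x1 beta). set (L := Lam beta x1).
assert (hL : 2 + zt < L) by (apply hLam; lra).
assert (hP : 0 < P <= 1 / 10).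
{ split; [apply Rpower_pos|]. unfold P, Rpower.
  assert (hl1 : ln x1 <= ln (1 / 100)) by (apply ln_le; lra).
  assert (hl2 : ln (1 / 100) = - (2 * ln 10)).
  { replace (1 / 100) with (/ (10 * 10)) by field. rewrite ln_Rinv, ln_mult by lra. ring. }
  assert (hl3 : 0 < ln 10) by (rewrite <- ln_1; apply ln_increasing; lra).
  apply Rle_trans with (exp (- ln 10)).
  - apply exp_le. nra.
  - rewrite exp_Ropp, exp_ln by lra. lra. }
(* If [Y] is constant between [u1] and the level [m] with [g u1 = x1 * g m], then [z = c] at [u1]
   means [z] close to [c / P = Z > 4] at [m]. *)
pose (c := Z * P). assert (hc : 0 < c <= 1 / 2) by (unfold c; split; nra).
pose (dd := 2 * L / Z - 1).
assert (hdd : 0 < dd).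
{ enough (1 < 2 * L / Z) by (unfold dd; lra). apply Rmult_lt_reg_r with Z; [lra|].
  replace (2 * L / Z * Z) with (2 * L) by (field; lra). unfold Z; lra. }
assert (hLdd : 2 * L = Z * (1 + dd)) by (unfold dd; field; lra).
destruct (exists_small (zt / 20) (1 / 2) (dd / (L + 1)) 1 1) as [e1 [p0 [p1 [p2 [p3 _]]]]]; try lra.
{ apply div_pos; lra. }
apply le_div_iff in p3; [|lra].
pose (nu := x1 * zt / 80).
assert (hnu : 0 < nu < 1) by (unfold nu; split; nra).
set (Ch := ln hM - ln hm).
pose (K := ln 3 + Ch - 2 * ln x1).
pose (c3 := dd * nu / 2). assert (hc3 : 0 < c3) by (unfold c3; nra).
pose (K0 := exp K * (4 * (L + 1) / P)).
assert (hK0 : 0 < K0).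
{ apply Rmult_lt_0_compat; [apply exp_pos|apply div_pos; lra]. }
destruct (exp_decay K0 c3 zt hK0 hc3 zt0) as [G0 [hG0 hdec]].
destruct (good_exists HG Hf0 Hf HW (zt / 2) ltac:(lra)) as [B1 HB1]. assert (hB1 := proj1 HB1).
destruct (g1_ratio HG e1 x1 ltac:(lra) ltac:(lra)) as [B3 [hB3 [_ hratio]]].
destruct (g_gap HG e1 x1 p0 ltac:(lra)) as [B4 [hB4 [_ hgap]]].
pose (G := G0 + 4 * Rabs K / (dd * ln 2) + 1).
destruct (exists_large HG B1 B3 B4 B1 G hB1) as [B [l1 [l3 [l4 [_ hG]]]]].
exists c, B. split; [lra|]. split; [lra|].
intros lam mu U Y HS sp hsp hUsp hzp hrp s hs hUs.
apply Rnot_lt_le; intros hzs.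
assert (HB : good f g g1 g2 h t0 H (zt / 2) B) by (apply good_mono with B1; trivial).
destruct (first_hit (zf g1 U Y) sp s c) as [s1 [hs1 [hz1 hzbefore]]]; try lra.
{ intros t ht. assert (i := U_anti Hf0 HW HS t s ltac:(lra)). apply (z_cont HG Hf HS); lra. }
set (u1 := U s1).
assert (hu1 : B <= u1) by (assert (i := U_anti Hf0 HW HS s1 s ltac:(lra)); unfold u1; lra).
assert (hgu1 := hG u1 hu1).
assert (hln2 : 0 < ln 2) by (rewrite <- ln_1; apply ln_increasing; lra).
assert (habsK : 0 <= 4 * Rabs K / (dd * ln 2)).
{ apply Rmult_le_pos; [assert (i := Rabs_pos K); lra|].
  left; apply Rinv_0_lt_compat, Rmult_lt_0_compat; trivial. }
assert (hgu0 : 1 <= g u1) by (unfold G in hgu1; lra).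
assert (hx1i : g u1 <= g u1 / x1).
{ apply Rmult_le_reg_r with x1; trivial. replace (g u1 / x1 * x1) with (g u1) by (field; lra). clear - hgu0 x10 x12; nra. }
destruct (g_surj HG u1 (g u1 / x1)) as [m [hm1 hm2]]; [lra|trivial|].
set (gm := g m) in *.
assert (hgx : g u1 = x1 * gm) by (rewrite hm2; field; lra).
assert (g1m := growth_g1 HG m ltac:(lra)).
assert (g1u := growth_g1 HG u1 ltac:(lra)).
assert (hquot : g u1 / gm = x1) by (rewrite hgx; field; lra).
assert (hr := hratio u1 m ltac:(lra) ltac:(fold gm; lra)).
assert (hT := hgap u1 m ltac:(lra) ltac:(fold gm; lra)). fold gm in hr, hT. rewrite hquot in hr, hT.
fold L in hT. rewrite Rpower_Ropp in hr. fold P in hr.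
apply Rabs_le_between in hT. set (T := (m - u1) * g1 m / gm) in *.
assert (hTm : (m - u1) * g1 m = T * gm) by (unfold T; field; lra).
set (r := g1 u1 / g1 m) in *.
assert (hrP : (1 - e1) * P <= r <= (1 + e1) * P).
{ replace r with (r * / P * P) by (field; lra). split; apply Rmult_le_compat_r; lra. }
assert (hr0 : 0 < r) by (apply div_pos; trivial).
assert (hum : u1 < m) by (apply (g_lt_inv HG); [lra|lra|]; fold gm; clear - hgx x10 x12 hgu0; nra).
set (y1 := Y s1) in *.
assert (hzy1 : g1 u1 * y1 = c) by (rewrite <- hz1; reflexivity).
assert (hy1 : 0 < y1) by (apply (Y_pos HG Hf0 Hf HW HS); [lra|fold u1; lra]).
(* The backward exponent at [m]: the time term is about [2 * L / Z * gm = (1 + dd) * gm], which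
   beats the gain of [g]. *)
assert (hkm : dd / 2 * gm <= 2 * (m - u1) / y1 - (gm - g u1)).
{ replace (2 * (m - u1) / y1) with (2 * T * gm * r / c).
  2:{ rewrite <- hzy1. unfold r. replace (2 * T * gm) with (2 * (T * gm)) by ring.
      rewrite <- hTm. field. lra. }
  assert (i : 1 + dd / 2 <= 2 * T * r / c).
  { apply Rmult_le_reg_r with Z; [lra|].
    replace (2 * T * r / c * Z) with (2 * T * (r / P)) by (unfold c; field; lra).
    assert (i1 : 1 - e1 <= r / P).
    { apply Rmult_le_reg_r with P; [lra|]. replace (r / P * P) with r by (field; lra). lra. }
    assert (i2 : 2 * (L - e1) * (1 - e1) <= 2 * T * (r / P)) by (apply Rmult_le_compat; lra).
    assert (i3 : 0 <= e1 * e1) by (apply Rmult_le_pos; lra).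
    assert (i4 : 4 * dd <= Z * dd) by (apply Rmult_le_compat_r; lra).
    lra. }
  replace (2 * T * gm * r / c) with (2 * T * r / c * gm) by (field; lra).
  assert (i2 : (1 + dd / 2) * gm <= 2 * T * r / c * gm) by (apply Rmult_le_compat_r; lra).
  lra. }
assert (hrho : forall t, sp <= t <= s1 -> U t <= m ->
   ln (rhof h g g1 lam U t) * (m - u1) <= K * (m - u1) - dd / 2 * gm * (U t - u1)).
{ intros t ht hUt.
  assert (hu : u1 <= U t) by (apply (U_anti Hf0 HW HS); lra).
  assert (i := ln_rho_diff HG Hf0 HW HS HB t s1 ltac:(lra) hu1).
  fold u1 Ch in i.
  destruct (good_at HW HS HB s1 ltac:(lra) hu1) as [_ [_ [_ [_ j5]]]].
  assert (hl3 : ln (rhof h g g1 lam U s1) <= ln 3) by (apply ln_le; lra).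
  assert (j := ln_g1_level (zt / 2) B u1 m x1 HB ltac:(lra) x10 ltac:(fold gm; lra)).
  assert (j' : ln (g1 (U t)) <= ln (g1 m)).
  { apply ln_le; [apply (growth_g1 HG); lra|apply (g1_le HG); lra]. }
  destruct (U_drop Hf0 HW HS t s1 ltac:(lra)) as [_ hdrop]. fold u1 y1 in hdrop.
  assert (hdrop2 : (U t - u1) / y1 <= s1 - t).
  { apply Rmult_le_reg_r with y1; trivial.
    replace ((U t - u1) / y1 * y1) with (U t - u1) by (field; lra). lra. }
  assert (hchord := g_chord HG u1 (U t) m ltac:(lra) ltac:(lra)). fold gm in hchord.
  assert (k1 : ln (rhof h g g1 lam U t) <= K - (2 * ((U t - u1) / y1) - (g (U t) - g u1))).
  { unfold K. lra. }
  apply Rle_trans with ((K - (2 * ((U t - u1) / y1) - (g (U t) - g u1))) * (m - u1)).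
  - apply Rmult_le_compat_r; lra.
  - assert (k2 : dd / 2 * gm * (U t - u1) <= (2 * (m - u1) / y1 - (gm - g u1)) * (U t - u1)).
    { apply Rmult_le_compat_r; lra. }
    replace ((2 * (m - u1) / y1 - (gm - g u1)) * (U t - u1))
      with (2 * ((U t - u1) / y1) * (m - u1) - (gm - g u1) * (U t - u1)) in k2 by (field; lra).
    lra. }
(* If the bubble lies below the level [m], then [rho >= 1] at [sp] forces [U sp] so close to [u1]
   that [g1] at most doubles; then [z <= 2 * c <= 1] at [sp], whereas [z = 2] there. *)
destruct (Rle_lt_dec (U sp) m) as [hpm|hpm].
- assert (hu : u1 <= U sp) by (apply (U_anti Hf0 HW HS); lra).
  assert (i := hrho sp ltac:(lra) hpm).
  assert (i0 : 0 <= ln (rhof h g g1 lam U sp)) by (rewrite <- ln_1; apply ln_le; lra).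
  assert (i1 : 0 <= ln (rhof h g g1 lam U sp) * (m - u1)) by (apply Rmult_le_pos; lra).
  assert (hchord := g_chord HG u1 (U sp) m ltac:(lra) ltac:(lra)). fold gm in hchord.
  assert (i2 : dd * (g (U sp) - g u1) <= 2 * K).
  { apply Rmult_le_reg_r with (m - u1); [lra|].
    assert (i3 : dd * ((g (U sp) - g u1) * (m - u1)) <= dd * (gm * (U sp - u1))).
    { apply Rmult_le_compat_l; [lra|]. apply Rle_trans with (1 := hchord).
      apply Rmult_le_compat_r; lra. }
    lra. }
  assert (i4 : 4 * Rabs K <= dd * ln 2 * g u1).
  { apply Rle_trans with (dd * ln 2 * (4 * Rabs K / (dd * ln 2))); [right; field; lra|].
    apply Rmult_le_compat_l; [left; now apply Rmult_lt_0_compat|]. unfold G in hgu1. lra. }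
  assert (habs := Rle_abs K).
  assert (i5 : 2 * (g (U sp) - g u1) <= ln 2 * g u1).
  { apply Rmult_le_reg_l with dd; trivial. lra. }
  assert (hgup : g u1 <= g (U sp)) by (apply (g_le HG); lra).
  assert (i6 := ln_ratio_le (g (U sp)) (g u1) ltac:(lra) hgup).
  assert (i7 : 2 * ((g (U sp) - g u1) / g u1) <= ln 2).
  { apply Rmult_le_reg_r with (g u1); [lra|].
    replace (2 * ((g (U sp) - g u1) / g u1) * g u1) with (2 * (g (U sp) - g u1)) by (field; lra). lra. }
  destruct HB as [_ [_ [hln _]]]. assert (i8 := hln u1 (U sp) ltac:(lra)).
  assert (g1p := growth_g1 HG (U sp) hUsp).
  assert (i9 := g1_ratio_exp (g1 (U sp)) (g1 u1) (ln 2) g1p g1u ltac:(lra)).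
  rewrite exp_ln in i9 by lra.
  assert (i10 : Y sp <= y1) by (apply (Y_le Hf0 HW HS); lra).
  assert (i11 : g1 (U sp) * Y sp <= 2 * g1 u1 * y1).
  { apply Rmult_le_compat; trivial; [lra|]. apply (Y_ge0 Hf0 HW HS); lra. }
  unfold zf in hzp. lra.
- 
  destruct (level_after HG Hf0 HW HS sp m hsp ltac:(lra)) as [sm [hsm hUm]].
  assert (hsm1 : sm < s1).
  { apply Rnot_le_lt; intros hle. assert (i := U_anti Hf0 HW HS s1 sm ltac:(lra)). fold u1 in i. lra. }
  (* The decay exponent vanishes at [u1], so smallness of [rho] is used only from [m] down to [un],
     a small fraction above [u1]. At [un] one still has [z > c] because [s1] is the first hit, and
     [g1 un] is close to [g1 u1]. *)
  pose (un := u1 + nu * (m - u1)).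
  assert (hun : u1 < un < m).
  { assert (0 < nu * (m - u1)) by (apply Rmult_lt_0_compat; lra).
    assert (0 < (1 - nu) * (m - u1)) by (apply Rmult_lt_0_compat; lra). unfold un. lra. }
  destruct (level_after HG Hf0 HW HS sm un ltac:(lra) ltac:(lra)) as [sn [hsn hUn]].
  assert (hsn1 : sn < s1).
  { apply Rnot_le_lt; intros hle. assert (i := U_anti Hf0 HW HS s1 sn ltac:(lra)). fold u1 in i. lra. }
  set (tau := exp (K - c3 * gm)).
  assert (htau : 0 < tau) by apply exp_pos.
  assert (hrt : forall t, sm <= t <= sn -> rhof h g g1 lam U t <= tau).
  { intros t ht.
    assert (j1 := U_anti Hf0 HW HS sm t ltac:(lra)). assert (j2 := U_anti Hf0 HW HS t sn ltac:(lra)).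
    assert (i := hrho t ltac:(lra) ltac:(lra)).
    assert (rp := rho_pos HG HW HS t ltac:(lra) ltac:(lra)).
    rewrite <- (exp_ln _ rp). apply exp_le.
    apply Rmult_le_reg_r with (m - u1); [lra|]. apply Rle_trans with (1 := i).
    assert (i1 : dd / 2 * gm * (nu * (m - u1)) <= dd / 2 * gm * (U t - u1)).
    { apply Rmult_le_compat_l; [apply Rmult_le_pos; lra|]. unfold un in hUn. lra. }
    unfold c3. lra. }
  assert (hsq := Y_sq_incr HG Hf0 Hf HW HS sm sn tau ltac:(lra) ltac:(lra) hrt).
  rewrite hUm, hUn in hsq.
  assert (g1n := growth_g1 HG un ltac:(lra)).
  assert (hun_le : g1 u1 <= g1 un) by (apply (g1_le HG); lra).
  assert (j : (g1 m) ^ 2 * (Y sn ^ 2 - Y sm ^ 2) <= 2 * tau * (T * gm) * / r).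
  { replace (2 * tau * (T * gm) * / r) with ((g1 m) ^ 2 * (2 * tau * (m - u1) / g1 u1)).
    2:{ rewrite <- hTm. unfold r. field. lra. }
    apply Rmult_le_compat_l; [apply pow2_ge_0|]. apply Rle_trans with (1 := hsq).
    apply Rmult_le_compat.
    - apply Rmult_le_pos; lra.
    - left; now apply Rinv_0_lt_compat.
    - apply Rmult_le_compat_l; lra.
    - now apply Rinv_le_contravar. }
  assert (hsmall : 2 * tau * (T * gm) * / r <= zt).
  { apply Rle_trans with (2 := hdec gm ltac:(unfold G in hgu1; lra)).
    replace (K0 * gm * exp (- c3 * gm)) with (2 * tau * ((L + 1) * gm) * (2 / P)).
    2:{ unfold K0, tau. replace (K - c3 * gm) with (K + - c3 * gm) by ring. rewrite exp_plus. field. lra. }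
    assert (hri : / r <= 2 / P).
    { replace (2 / P) with (/ (P / 2)) by (field; lra). apply Rinv_le_contravar; [lra|].
      clear - hrP p2 hP. clearbody r P. nra. }
    apply Rmult_le_compat; trivial.
    - apply Rmult_le_pos; [lra|]. apply Rmult_le_pos; lra.
    - left; now apply Rinv_0_lt_compat.
    - apply Rmult_le_compat_l; [lra|]. apply Rmult_le_compat_r; lra. }
  destruct (good_at HW HS HB sm ltac:(lra) ltac:(lra)) as [_ [_ [_ [j4 _]]]].
  unfold zf in j4. rewrite hUm in j4.
  assert (hzn := hzbefore sn ltac:(lra)). unfold zf in hzn. rewrite hUn in hzn.
  assert (hgn : g1 un <= (1 + zt / 20) * g1 u1).
  { destruct HB as [_ [_ [hln _]]]. assert (i8 := hln u1 un ltac:(lra)).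
    assert (hgup : g u1 <= g un) by (apply (g_le HG); lra).
    assert (i6 := ln_ratio_le (g un) (g u1) ltac:(lra) hgup).
    assert (hchord := g_chord HG u1 un m ltac:(lra) ltac:(lra)). fold gm in hchord.
    replace (un - u1) with (nu * (m - u1)) in hchord by (unfold un; ring).
    assert (i7 : g un - g u1 <= nu * gm).
    { apply Rmult_le_reg_r with (m - u1); [lra|]. apply Rle_trans with (1 := hchord).
      replace (nu * gm * (m - u1)) with (gm * (nu * (m - u1))) by ring.
      apply Rmult_le_compat_r; [apply Rmult_le_pos; lra|lra]. }
    assert (i9 : (g un - g u1) / g u1 <= zt / 80).
    { apply Rmult_le_reg_r with (g u1); [lra|].
      replace ((g un - g u1) / g u1 * g u1) with (g un - g u1) by (field; lra).
      rewrite hgx at 2. unfold nu in i7. lra. }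
    assert (i10 := g1_ratio_exp (g1 un) (g1 u1) (zt / 40) g1n g1u ltac:(lra)).
    assert (i11 := exp_le_linear (zt / 40) ltac:(lra)).
    apply Rle_trans with (1 := i10). apply Rmult_le_compat_r; lra. }
  assert (Yn := Y_ge0 Hf0 HW HS sn ltac:(lra)).
  assert (hbig : 4 + zt <= g1 m * Y sn).
  { assert (k1 : c <= (1 + zt / 20) * g1 u1 * Y sn).
    { apply Rle_trans with (g1 un * Y sn); [lra|]. apply Rmult_le_compat_r; trivial. }
    assert (k2 : g1 u1 <= (1 + e1) * P * g1 m).
    { replace (g1 u1) with (r * g1 m) by (unfold r; field; lra). apply Rmult_le_compat_r; lra. }
    assert (k3 : (1 + zt / 20) * g1 u1 * Y sn <= (1 + zt / 20) * ((1 + zt / 20) * P * g1 m) * Y sn).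
    { apply Rmult_le_compat_r; trivial. apply Rmult_le_compat_l; [lra|].
      apply Rle_trans with (1 := k2). apply Rmult_le_compat_r; [lra|].
      apply Rmult_le_compat_r; lra. }
    assert (k4 : Z <= (1 + zt / 20) ^ 2 * (g1 m * Y sn)).
    { apply Rmult_le_reg_r with P; [lra|].
      replace ((1 + zt / 20) ^ 2 * (g1 m * Y sn) * P)
        with ((1 + zt / 20) * ((1 + zt / 20) * P * g1 m) * Y sn) by ring.
      fold c. lra. }
    apply Rnot_lt_le; intros hlt.
    assert (k5 : (1 + zt / 20) ^ 2 * (g1 m * Y sn) <= (1 + zt / 20) ^ 2 * (4 + zt)).
    { apply Rmult_le_compat_l; [apply pow2_ge_0|lra]. }
    unfold Z in k4. clear - k4 k5 zt0 zt1. nra. }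
  assert (hsqm : (g1 m * Y sm) ^ 2 <= (4 + zt / 2) ^ 2) by (apply pow_incr; lra).
  assert (hsqn : (4 + zt) ^ 2 <= (g1 m * Y sn) ^ 2) by (apply pow_incr; lra).
  replace (g1 m ^ 2 * (Y sn ^ 2 - Y sm ^ 2)) with ((g1 m * Y sn) ^ 2 - (g1 m * Y sm) ^ 2) in j by ring.
  clear - hsqm hsqn j hsmall zt0. nra.
Qed.

(** At the fixed level [Bt], [z >= c] bounds [Y] below by [y0], and [Y] is nondecreasing. Since [U]
    must stay positive up to s = 0, this keeps it above [y0 * (- s)] and fixes the position of that
    level up to a bounded error; [rho <= 3] there bounds [lam] above. The lower bound comes from the
    growth that [Y] needs between two fixed levels. *)
Lemma tail : exists Bt c0 y0 c1 C1 M, t0 < Bt /\ 0 < c0 /\ 0 < y0 /\ 0 < c1 /\ t0 < M /\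
  forall lam mu U Y, sol h f lam mu U Y -> M <= mu ->
  c1 <= lam <= C1 /\ (forall s, s < 0 -> Bt <= U s \/ y0 * (- s) <= U s) /\
  exists sp, sp < 0 /\ Bt <= U sp /\ zf g1 U Y sp = 2 /\ 1 / 2 * g mu <= g (U sp) /\
    forall s, sp <= s < 0 -> Bt <= U s -> c0 <= zf g1 U Y s.
Proof.
destruct z_lower as [c [Bz [hc [hBz hzlow]]]].
destruct (good_exists HG Hf0 Hf HW (1 / 20) ltac:(lra)) as [Bg HBg].
destruct (first_bubble HG Hf0 Hf HW (1 / 2) ltac:(lra)) as [Bf [hBf hfirst]].
destruct (exists_large HG Bz Bg Bz Bz 0 hBz) as [Bt [l1 [l2 _]]].
assert (HB : good f g g1 g2 h t0 H (1 / 20) Bt) by (apply good_mono with Bg; trivial).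
assert (hBt : t0 < Bt) by lra.
assert (g1B := growth_g1 HG Bt hBt).
assert (ht0 := growth_t0 HG).
pose (y0 := c / g1 Bt). assert (hy0 : 0 < y0) by (apply div_pos; trivial).
(* At a level [m] where [g1] is this large, [z <= 4.05] gives [Y <= 0.81 * y0]. *)
destruct (g1_unbounded HG (5 * g1 Bt / c)) as [B7 [hB7 hg1]].
destruct (exists_large HG Bt B7 Bt Bt 0 hBt) as [m [k1 [k2 [_ [_ hgm0]]]]].
destruct (exists_large HG Bf Bf Bf Bf (2 * g m) hBf) as [M [k3 [_ [_ [_ hM1]]]]].
assert (hhm := weight_hm HW).
assert (hhM : 0 < hM).
{ assert (i := weight_bounds HW (1 / 2) ltac:(lra)). lra. }
pose (S := Bt / y0).
pose (C1 := 3 * exp (2 * S) / (hm * exp (g Bt) * g1 Bt)).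
pose (F := hM * exp (g m) / 2).
assert (hF : 0 < F).
{ unfold F. apply div_pos; [|lra]. apply Rmult_lt_0_compat; [trivial|apply exp_pos]. }
pose (c1 := 19 / 100 * y0 / F).
exists Bt, c, y0, c1, C1, M.
assert (hc1 : 0 < c1) by (apply div_pos; lra).
split; [trivial|]. split; [trivial|]. split; [trivial|]. split; [trivial|]. split; [lra|].
intros lam mu U Y HS hmu.
destruct (hfirst lam mu U Y HS ltac:(lra)) as [sp [hsp [hUsp [hgsp [hzsp hrsp]]]]].
assert (hgmu := hM1 mu hmu).
assert (hUm : m <= U sp) by (apply (g_le_inv HG); lra).
assert (hlam := sol_lam HS).
apply Rabs_le_between in hrsp.
assert (hz : forall s, sp <= s < 0 -> Bt <= U s -> c <= zf g1 U Y s).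
{ intros s hs hUs. apply (hzlow lam mu U Y HS sp); trivial; lra. }
destruct (level_after HG Hf0 HW HS sp Bt hsp ltac:(lra)) as [sB [hsB hUB]].
destruct (level_after HG Hf0 HW HS sp m hsp ltac:(lra)) as [sm [hsm hUsm]].
assert (hYB : y0 <= Y sB).
{ assert (i := hz sB hsB ltac:(lra)). unfold zf in i. rewrite hUB in i.
  apply Rmult_le_reg_l with (g1 Bt); trivial.
  replace (g1 Bt * y0) with c by (unfold y0; field; lra). trivial. }
assert (hUlow : forall s, sB <= s < 0 -> y0 * (- s) <= U s).
{ intros s hs. apply Rnot_lt_le; intros hlt.
  assert (hY := Y_le Hf0 HW HS sB s ltac:(lra)).
  assert (hUp := sol_pos HS s ltac:(lra)).
  (* Halfway between 0 and the time [s + U s / y0] by which a descent at speed [y0] would have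
     exhausted [U]. *)
  pose (t := - ((- s) - U s / y0) / 2).
  assert (hq : U s / y0 < - s).
  { apply Rmult_lt_reg_r with y0; trivial. replace (U s / y0 * y0) with (U s) by (field; lra). lra. }
  assert (hq0 : 0 < U s / y0) by (apply div_pos; trivial).
  assert (ht : s <= t < 0) by (unfold t; lra).
  destruct (U_drop Hf0 HW HS s t ht) as [hd _].
  assert (hUt := sol_pos HS t ltac:(lra)).
  assert (y0 * (t - s) <= Y s * (t - s)) by (apply Rmult_le_compat_r; lra).
  assert (y0 * (U s / y0) < y0 * (t - s)) by (apply Rmult_lt_compat_l; [trivial|unfold t; lra]).
  replace (y0 * (U s / y0)) with (U s) in H1 by (field; lra). lra. }
split; [split|split].
- (* Between the levels [m] and [Bt], [Y] grows by at least [0.19 y0]. *)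
  assert (hsmB : sm <= sB).
  { apply Rnot_lt_le; intros hlt. assert (i := U_anti Hf0 HW HS sB sm ltac:(lra)).
    assert (m = Bt) by lra. assert (j := hg1 m ltac:(lra)). rewrite H0 in j.
    destruct (good_at HW HS HB sB ltac:(lra) ltac:(lra)) as [_ [_ [_ [j4 _]]]].
    assert (k := hz sB hsB ltac:(lra)). assert (c <= 4 + 1 / 20) by lra.
    assert (5 * g1 Bt <= g1 Bt * c) by (apply div_le_iff; trivial). nra. }
  assert (hYm : Y sm <= 81 / 100 * y0).
  { destruct (good_at HW HS HB sm ltac:(lra) ltac:(lra)) as [_ [_ [_ [j4 _]]]].
    unfold zf in j4. rewrite hUsm in j4.
    assert (j := hg1 m ltac:(lra)).
    assert (Ym := Y_ge0 Hf0 HW HS sm ltac:(lra)).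
    assert (5 * g1 Bt / c * Y sm <= g1 m * Y sm) by (apply Rmult_le_compat_r; trivial).
    apply Rmult_le_reg_l with (5 * g1 Bt / c); [apply div_pos; lra|].
    replace (5 * g1 Bt / c * (81 / 100 * y0)) with (4 + 1 / 20) by (unfold y0; field; lra). lra. }
  assert (hgrow : lam * F * exp (2 * sm) - Y sm <= lam * F * exp (2 * sB) - Y sB).
  { apply (derive_ge0_le (fun x => lam * F * exp (2 * x) - Y x)
      (fun x => 2 * (lam * F) * exp (2 * x) - lam * exp (2 * x) * h (exp x) * f (U x))); [lra|..].
    - intros x hx. assert (d := sol_dY HS x ltac:(lra)).
      auto_derive; [eexists; eassumption|]. rewrite (Derive_eta d). ring.
    - intros x hx. assert (i1 := U_anti Hf0 HW HS sm x ltac:(lra)).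
      assert (i2 := U_anti Hf0 HW HS x sB ltac:(lra)).
      rewrite (Hf (U x)) by lra.
      assert (i3 := weight_bounds HW (exp x) (exp_neg_lt1 x ltac:(lra))).
      assert (i4 : exp (g (U x)) <= exp (g m)) by (apply exp_le, (g_le HG); lra).
      assert (i5 := exp_pos (g (U x))). assert (i6 := exp_pos (2 * x)).
      assert (i7 : h (exp x) * exp (g (U x)) <= hM * exp (g m)) by (apply Rmult_le_compat; lra).
      assert (i8 : lam * exp (2 * x) * (h (exp x) * exp (g (U x))) <= lam * exp (2 * x) * (hM * exp (g m))).
      { apply Rmult_le_compat_l; [apply Rmult_le_pos; lra|trivial]. }
      unfold F. lra. }
  assert (e1 : exp (2 * sB) <= 1) by (left; apply exp_lt_1; lra).
  assert (e2 := exp_pos (2 * sm)).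
  assert (hlF : 0 < lam * F) by (apply Rmult_lt_0_compat; trivial).
  assert (hfin : 19 / 100 * y0 <= lam * F) by (clear - hYB hYm hgrow e1 e2 hlF; nra).
  unfold c1. apply Rmult_le_reg_r with F; trivial.
  replace (19 / 100 * y0 / F * F) with (19 / 100 * y0) by (field; lra). trivial.
- destruct (good_at HW HS HB sB ltac:(lra) ltac:(lra)) as [_ [_ [_ [_ j5]]]].
  unfold rhof in j5. rewrite hUB in j5. destruct j5 as [_ j5].
  assert (i := hUlow sB ltac:(lra)). rewrite hUB in i.
  assert (hS : - sB <= S).
  { unfold S. apply Rmult_le_reg_l with y0; trivial. replace (y0 * (Bt / y0)) with Bt by (field; lra). lra. }
  assert (e1 : exp (- (2 * S)) <= exp (2 * sB)) by (apply exp_le; lra).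
  assert (i3 := weight_bounds HW (exp sB) (exp_neg_lt1 sB ltac:(lra))).
  assert (e2 := exp_pos (g Bt)). assert (e3 := exp_pos (- (2 * S))). 
  assert (k : lam * exp (- (2 * S)) * hm * exp (g Bt) * g1 Bt <= 3).
  { apply Rle_trans with (2 := j5).
    apply Rmult_le_compat_r; [lra|]. apply Rmult_le_compat_r; [lra|].
    apply Rmult_le_compat; try lra; [apply Rmult_le_pos; lra|].
    apply Rmult_le_compat_l; lra. }
  assert (hD : 0 < hm * exp (g Bt) * g1 Bt) by (apply Rmult_lt_0_compat; [apply Rmult_lt_0_compat|]; trivial).
  unfold C1. apply Rmult_le_reg_r with (hm * exp (g Bt) * g1 Bt); trivial.
  replace (3 * exp (2 * S) / (hm * exp (g Bt) * g1 Bt) * (hm * exp (g Bt) * g1 Bt))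
    with (3 * exp (2 * S)) by (field; repeat split; lra).
  apply Rmult_le_reg_r with (exp (- (2 * S))); trivial.
  replace (3 * exp (2 * S) * exp (- (2 * S))) with 3.
  + lra.
  + rewrite Rmult_assoc, <- exp_plus. replace (2 * S + - (2 * S)) with 0 by ring. rewrite exp_0. ring.
- intros s hs. destruct (Rle_lt_dec s sB) as [hle|hlt].
  + left. assert (i := U_anti Hf0 HW HS s sB ltac:(lra)). lra.
  + right. apply hUlow; lra.
- exists sp. split; [trivial|]. split; [lra|]. split; [trivial|]. split; [lra|]. exact hz.
Qed.

End Lower.

(** * Passage to the logarithmic variable *)

Lemma derive_on_eps (D : R -> Prop) (u du : R -> R) (x : R) : derive_on D u du -> D x ->
  forall eps, 0 < eps -> exists d, 0 < d /\ forall y, D y -> y <> x -> Rabs (y - x) < d ->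
    Rabs ((u y - u x) / (y - x) - du x) < eps.
Proof.
intros hd hx eps he.
destruct (proj1 (filterlim_locally _ (du x)) (hd x hx) (mkposreal eps he)) as [[d hpos] hb].
exists d. split; [trivial|]. intros y hy hne hyd. apply (hb y); [exact hyd|split; trivial].
Qed.

Lemma derive_on_is_derive (D : R -> Prop) (u du : R -> R) (x d : R) : derive_on D u du ->
  0 < d -> (forall y, Rabs (y - x) < d -> D y) -> is_derive u x (du x).
Proof.
intros hd hpos hD.
assert (hx : D x) by (apply hD; rewrite Rminus_diag, Rabs_R0; trivial).
apply is_derive_Reals. intros eps he.
destruct (derive_on_eps D u du x hd hx eps he) as [d' [hd' hb]].
assert (i1 := Rmin_l d d'). assert (i2 := Rmin_r d d').
exists (mkposreal (Rmin d d') ltac:(apply Rmin_glb_lt; trivial)). simpl.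
intros k hk hkd.
specialize (hb (x + k)). replace (x + k - x) with k in hb by ring.
apply hb; try lra.
apply hD. replace (x + k - x) with k by ring. lra.
Qed.

Lemma derive_on_continuous_on (D : R -> Prop) (u du : R -> R) :
  derive_on D u du -> continuous_on D u.
Proof.
intros hd x hx. apply filterlim_locally. intros [eps he].
destruct (derive_on_eps D u du x hd hx 1 Rlt_0_1) as [d [hd0 hb]].
assert (hq : 0 < Rabs (du x) + 1) by (assert (i := Rabs_pos (du x)); lra).
assert (hq2 : 0 < eps / (Rabs (du x) + 1)) by (apply div_pos; trivial).
assert (i1 := Rmin_l d (eps / (Rabs (du x) + 1))). assert (i2 := Rmin_r d (eps / (Rabs (du x) + 1))).
exists (mkposreal (Rmin d (eps / (Rabs (du x) + 1))) ltac:(apply Rmin_glb_lt; trivial)).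
intros y hy hDy. change (Rabs (u y - u x) < eps).
change (Rabs (y - x) < Rmin d (eps / (Rabs (du x) + 1))) in hy.
destruct (Req_dec y x) as [->|hne]; [rewrite Rminus_diag, Rabs_R0; trivial|].
specialize (hb y hDy hne ltac:(lra)).
assert (hb2 : Rabs ((u y - u x) / (y - x)) < Rabs (du x) + 1).
{ assert (j := Rabs_triang ((u y - u x) / (y - x) - du x) (du x)).
  replace ((u y - u x) / (y - x) - du x + du x) with ((u y - u x) / (y - x)) in j by ring. lra. }
replace (u y - u x) with ((u y - u x) / (y - x) * (y - x)) by (field; lra).
rewrite Rabs_mult.
apply Rlt_le_trans with ((Rabs (du x) + 1) * (eps / (Rabs (du x) + 1))).
- assert (Rabs (y - x) < eps / (Rabs (du x) + 1)) by lra.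
  assert (0 < Rabs (y - x)) by (apply Rabs_pos_lt; lra).
  apply Rle_lt_trans with ((Rabs (du x) + 1) * Rabs (y - x)).
  + apply Rmult_le_compat_r; lra.
  + apply Rmult_lt_compat_l; trivial.
- right. field. lra.
Qed.

Lemma continuous_on_eps (D : R -> Prop) (F : R -> R) (x : R) : continuous_on D F -> D x ->
  forall eps, 0 < eps -> exists d, 0 < d /\ forall y, D y -> Rabs (y - x) < d -> Rabs (F y - F x) < eps.
Proof.
intros hc hx eps he.
destruct (proj1 (filterlim_locally _ (F x)) (hc x hx) (mkposreal eps he)) as [[d hpos] hb].
exists d. split; [trivial|]. intros y hy hyd. apply (hb y); trivial.
Qed.

(** A 1-Lipschitz retraction onto the interval: composing with it turns relative continuity into
    continuity on the line, as the extremum and integral lemmas require. *)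
Definition clamp (a b x : R) : R := Rmax a (Rmin b x).

Lemma clamp_in (a b x : R) : a <= b -> a <= clamp a b x <= b.
Proof.
intros hab. unfold clamp. split; [apply Rmax_l|]. apply Rmax_lub; [trivial|apply Rmin_l].
Qed.

Lemma clamp_id (a b x : R) : a <= x <= b -> clamp a b x = x.
Proof. intros hx. unfold clamp. rewrite Rmin_right, Rmax_right; lra. Qed.

Lemma clamp_lip (a b x y : R) : Rabs (clamp a b y - clamp a b x) <= Rabs (y - x).
Proof.
unfold clamp, Rmax, Rmin.
repeat destruct Rle_dec; unfold Rabs; repeat destruct Rcase_abs; lra.
Qed.

Lemma clamp_continuous (D : R -> Prop) (F : R -> R) (a b x : R) : a <= b ->
  continuous_on D F -> (forall y, a <= y <= b -> D y) ->
  continuous (fun y => F (clamp a b y)) x.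
Proof.
intros hab hc hD. apply filterlim_locally. intros [eps he].
destruct (continuous_on_eps D F (clamp a b x) hc (hD _ (clamp_in a b x hab)) eps he) as [d [hd hb]].
exists (mkposreal d hd). intros y hy. apply hb; [now apply hD, clamp_in|].
apply Rle_lt_trans with (1 := clamp_lip a b x y). exact hy.
Qed.

Lemma continuous_on_bounds (D : R -> Prop) (F : R -> R) (a b : R) : a <= b ->
  continuous_on D F -> (forall y, a <= y <= b -> D y) ->
  exists x y, a <= x <= b /\ a <= y <= b /\ forall t, a <= t <= b -> F x <= F t <= F y.
Proof.
intros hab hc hD.
assert (hcc : forall c, a <= c <= b -> continuity_pt (fun y => F (clamp a b y)) c).
{ intros c hcab. apply continuity_pt_filterlim. now apply (clamp_continuous D). }
destruct (continuity_ab_min _ a b hab hcc) as [x [hx1 hx2]].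
destruct (continuity_ab_maj _ a b hab hcc) as [y [hy1 hy2]].
exists x, y. split; [trivial|]. split; [trivial|]. intros t ht.
specialize (hx1 t ht). specialize (hy1 t ht). simpl in *.
rewrite !clamp_id in hx1, hy1 by trivial. lra.
Qed.

Lemma growth_of_H1 (f : R -> R) (t0 : R) (g1 g2 : R -> R) (q : R) (p : Rbar) :
  0 <= t0 -> derive_on (Ici t0) (logf f) g1 -> derive_on (Ici t0) g1 g2 ->
  H1 f t0 g1 g2 q p -> 1 <= q < 2 -> growth (logf f) g1 g2 t0 (/ q).
Proof.
intros ht0 hd1 hd2 [hpos [_ [hlim _]]] hq.
assert (hin : forall t, t0 < t -> forall y, Rabs (y - t) < t - t0 -> Ici t0 y).
{ intros t ht y hy. apply Rabs_def2 in hy. unfold Ici. lra. }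
split; trivial.
- intros t ht. apply (derive_on_is_derive (Ici t0)) with (t - t0); trivial; [lra|now apply hin].
- intros t ht. apply (derive_on_is_derive (Ici t0)) with (t - t0); trivial; [lra|now apply hin].
- intros t ht. apply hpos; lra.
- intros t ht. apply hpos; lra.
- split.
  + apply Rmult_lt_reg_r with q; [lra|]. rewrite Rinv_l; lra.
  + rewrite <- Rinv_1. apply Rinv_le_contravar; lra.
- intros eps he.
  apply is_lim_spec in hlim.
  (* The tolerance 1/2 keeps [A * q >= 1/2], since [q >= 1], so that inverting the limit costs at
     most a factor 2. *)
  assert (hm : 0 < Rmin (1 / 2) (eps / 2)) by (apply Rmin_glb_lt; lra).
  destruct (hlim (mkposreal _ hm)) as [M hM]. simpl in hM.
  assert (i1 := Rmin_l (1 / 2) (eps / 2)). assert (i2 := Rmin_r (1 / 2) (eps / 2)).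
  assert (i3 := Rmax_l M t0). assert (i4 := Rmax_r M t0).
  exists (Rmax M t0 + 1). split; [lra|]. intros t ht.
  specialize (hM t ltac:(lra)).
  replace (logf f t * g2 t / g1 t ^ 2) with (/ (g1 t ^ 2 / (logf f t * g2 t))) by (apply Rinv_div).
  replace (g1 t * (g1 t * 1)) with (g1 t ^ 2) in hM by ring.
  set (A := g1 t ^ 2 / (logf f t * g2 t)) in *. clearbody A.
  apply Rabs_def2 in hM.
  replace (/ A - / q) with ((q - A) * / (A * q)) by (field; lra).
  rewrite Rabs_mult, (Rabs_pos_eq (/ (A * q))).
  2:{ left; apply Rinv_0_lt_compat; nra. }
  assert (hAq : / (A * q) <= 2).
  { replace 2 with (/ (1 / 2)) by field. apply Rinv_le_contravar; nra. }
  assert (hqA : Rabs (q - A) <= eps / 2) by (apply Rabs_le_between; lra).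
  apply Rle_trans with (eps / 2 * 2); [|lra].
  apply Rmult_le_compat; trivial; [apply Rabs_pos|left; apply Rinv_0_lt_compat; nra].
Qed.

Lemma weight_of_C1 (h h1 : R -> R) : (forall r, I01 r -> 0 < h r) -> C1_on I01 h h1 ->
  exists hm hM H, weight h h1 hm hM H.
Proof.
intros hpos [hd hc].
assert (hch := derive_on_continuous_on _ _ _ hd).
destruct (continuous_on_bounds I01 h 0 1 ltac:(lra) hch (fun y hy => hy)) as [x [y [hx [hy hb]]]].
destruct (continuous_on_bounds I01 h1 0 1 ltac:(lra) hc (fun y hy => hy)) as [x' [y' [hx' [hy' hb']]]].
assert (hhx := hpos x hx).
pose (A := Rabs (h1 x') + Rabs (h1 y')).
assert (hA : 0 <= A) by (unfold A; assert (i := Rabs_pos (h1 x')); assert (j := Rabs_pos (h1 y')); lra).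
exists (h x), (h y), (A / h x).
split; trivial.
- apply Rmult_le_pos; [trivial|left; now apply Rinv_0_lt_compat].
- intros r hr. pose (d := Rmin r (1 - r)).
  assert (i1 := Rmin_l r (1 - r)). assert (i2 := Rmin_r r (1 - r)). fold d in i1, i2.
  apply (derive_on_is_derive I01) with d; trivial.
  + apply Rmin_glb_lt; lra.
  + intros v hv. apply Rabs_def2 in hv. unfold I01. lra.
- intros r hr. apply hb; lra.
- intros r hr. specialize (hb r ltac:(lra)). specialize (hb' r ltac:(lra)).
  apply Rle_trans with A.
  + unfold A. assert (i := Rle_abs (h1 y')). assert (j := Rle_abs (- h1 x')). rewrite Rabs_Ropp in j.
    assert (k := Rabs_pos (h1 x')). assert (l := Rabs_pos (h1 y')). apply Rabs_le_between. lra.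
  + replace A with (A / h x * h x) at 1 by (field; lra).
    apply Rmult_le_compat_l; [|lra].
    apply Rmult_le_pos; [trivial|left; now apply Rinv_0_lt_compat].
Qed.

Lemma exp_m_infty_near (d : R) : 0 < d -> exists M, M < 0 /\ forall s, s < M -> 0 < exp s < d.
Proof.
intros hd. exists (Rmin (-1) (ln d)).
assert (i1 := Rmin_l (-1) (ln d)). assert (i2 := Rmin_r (-1) (ln d)).
split; [lra|]. intros s hs. split; [apply exp_pos|].
rewrite <- (exp_ln d) by trivial. apply exp_increasing. lra.
Qed.

Lemma sol_of_radial (h f : R -> R) (lam mu : R) (u u1 u2 : R -> R) :
  0 < lam -> C2_on I01 u u1 u2 ->
  (forall r, 0 < r < 1 -> - u2 r - u1 r / r = lam * h r * f (u r) /\ 0 < u r) ->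
  u 0 = mu -> u1 0 = 0 -> u 1 = 0 ->
  sol h f lam mu (fun s => u (exp s)) (fun s => - (exp s * u1 (exp s))).
Proof.
intros hlam [hd1 [hd2 hc2]] heq hu0 hu10 hu1.
assert (hd : forall v dv, derive_on I01 v dv -> forall r, 0 < r < 1 -> is_derive v r (dv r)).
{ intros v dv hv r hr.
  assert (i1 := Rmin_l r (1 - r)). assert (i2 := Rmin_r r (1 - r)).
  apply (derive_on_is_derive I01) with (Rmin r (1 - r)); trivial.
  - apply Rmin_glb_lt; lra.
  - intros y hy. apply Rabs_def2 in hy. unfold I01. lra. }
assert (hc := derive_on_continuous_on _ _ _ hd1).
assert (hc1 := derive_on_continuous_on _ _ _ hd2).
split; trivial.
- intros s hs. assert (d := hd u u1 hd1 (exp s) (exp_neg_lt1 s hs)).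
  auto_derive; [repeat split; eexists; eassumption|].
  rewrite (Derive_eta d). ring.
- intros s hs. assert (hr := exp_neg_lt1 s hs).
  assert (d := hd u1 u2 hd2 (exp s) hr).
  auto_derive; [repeat split; eexists; eassumption|].
  rewrite (Derive_eta d). destruct (heq (exp s) hr) as [e _].
  replace (2 * s) with (s + s) by ring. rewrite exp_plus.
  replace (lam * (exp s * exp s) * h (exp s) * f (u (exp s)))
    with (exp s * exp s * (lam * h (exp s) * f (u (exp s)))) by ring.
  rewrite <- e. field. lra.
- intros s hs. now apply heq, exp_neg_lt1.
- apply is_lim_spec. intros [eps he]. simpl.
  destruct (continuous_on_eps I01 u 0 hc ltac:(unfold I01; lra) eps he) as [d [hd0 hb]].
  destruct (exp_m_infty_near d hd0) as [M [hM hM2]].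
  exists M. intros s hs. specialize (hM2 s hs). assert (hr := exp_neg_lt1 s ltac:(lra)).
  rewrite <- hu0. apply hb; [unfold I01; lra|]. rewrite Rminus_0_r, Rabs_pos_eq; lra.
- apply is_lim_spec. intros [eps he]. simpl.
  destruct (continuous_on_eps I01 u1 0 hc1 ltac:(unfold I01; lra) eps he) as [d [hd0 hb]].
  destruct (exp_m_infty_near d hd0) as [M [hM hM2]].
  exists M. intros s hs. specialize (hM2 s hs). assert (hr := exp_neg_lt1 s ltac:(lra)).
  specialize (hb (exp s) ltac:(unfold I01; lra)).
  rewrite Rminus_0_r, hu10, Rminus_0_r in hb. rewrite Rabs_pos_eq in hb by lra.
  specialize (hb ltac:(lra)).
  rewrite Rminus_0_r, Rabs_Ropp, Rabs_mult, (Rabs_pos_eq (exp s)) by lra.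
  nra.
- intros B hB.
  destruct (continuous_on_eps I01 u 1 hc ltac:(unfold I01; lra) B hB) as [d [hd0 hb]].
  pose (r := 1 - Rmin (1 / 2) (d / 2)).
  assert (i1 := Rmin_l (1 / 2) (d / 2)). assert (i2 := Rmin_r (1 / 2) (d / 2)).
  assert (i3 : 0 < Rmin (1 / 2) (d / 2)) by (apply Rmin_glb_lt; lra).
  exists (ln r). split.
  + rewrite <- ln_1. apply ln_increasing; unfold r; lra.
  + rewrite exp_ln by (unfold r; lra).
    specialize (hb r ltac:(unfold I01, r; lra)). rewrite hu1, Rminus_0_r in hb.
    assert (j : Rabs (u r) < B).
    { apply hb. unfold r. replace (1 - Rmin (1 / 2) (d / 2) - 1) with (- Rmin (1 / 2) (d / 2)) by ring.
      rewrite Rabs_Ropp, Rabs_pos_eq; lra. }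
    assert (k := Rle_abs (u r)). lra.
Qed.

(** * Conjugate exponents and the unified recursion *)

Section Ratio.
Context {g g1 g2 : R -> R} {t0 beta : R} (HG : growth g g1 g2 t0 beta).

(** [g / g1] has derivative [1 - g g2 / g1^2], which tends to [1 - beta]; integrate and divide by
    [t]. *)
Lemma g_over_tg1_lim : is_lim (fun t => g t / (t * g1 t)) p_infty (1 - beta).
Proof.
apply is_lim_spec. intros [eps he]. simpl.
assert (ht0 := growth_t0 HG).
destruct (growth_lim HG (eps / 4) ltac:(lra)) as [B [hB hb]].
assert (hder : forall t, B <= t -> is_derive (fun t => g t / g1 t) t (1 - g t * g2 t / g1 t ^ 2)).
{ intros t ht. assert (d1 := growth_d1 HG t ltac:(lra)).
  assert (d2 := growth_d2 HG t ltac:(lra)).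
  assert (p1 := growth_g1 HG t ltac:(lra)).
  auto_derive; [repeat split; try lra; eexists; eassumption|].
  rewrite (Derive_eta d1), (Derive_eta d2). field. lra. }
pose (GB := g B / g1 B).
pose (K := Rabs GB + Rabs (1 - beta) * B).
assert (hK : 0 <= K).
{ unfold K. assert (i := Rabs_pos GB). assert (j := Rabs_pos (1 - beta)).
  assert (0 <= Rabs (1 - beta) * B) by (apply Rmult_le_pos; lra). lra. }
assert (hKe : 0 <= 4 * K / eps) by (apply Rmult_le_pos; [lra|left; now apply Rinv_0_lt_compat]).
exists (B + 4 * K / eps). intros t ht.
assert (htB : B <= t) by lra. assert (ht1 : 0 < t) by lra.
assert (i1 : (1 - beta - eps / 4) * (t - B) <= g t / g1 t - GB).
{ apply (derive_ge_incr (fun t => g t / g1 t) (fun t => 1 - g t * g2 t / g1 t ^ 2)); trivial.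
  - intros x hx. apply hder; lra.
  - intros x hx. specialize (hb x ltac:(lra)). apply Rabs_le_between in hb. lra. }
assert (i2 : g t / g1 t - GB <= (1 - beta + eps / 4) * (t - B)).
{ apply (derive_le_incr (fun t => g t / g1 t) (fun t => 1 - g t * g2 t / g1 t ^ 2)); trivial.
  - intros x hx. apply hder; lra.
  - intros x hx. specialize (hb x ltac:(lra)). apply Rabs_le_between in hb. lra. }
assert (p1 := growth_g1 HG t ltac:(lra)).
replace (g t / (t * g1 t)) with (g t / g1 t / t) by (field; lra).
set (Gt := g t / g1 t) in *.
assert (hKt : 4 * K <= eps * t).
{ apply Rle_trans with (eps * (4 * K / eps)); [right; field; lra|].
  apply Rmult_le_compat_l; lra. }
assert (a1 := Rle_abs GB). assert (a2 := Rle_abs (- GB)). rewrite Rabs_Ropp in a2.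
assert (a3 : - (Rabs (1 - beta) * B) <= (1 - beta) * B <= Rabs (1 - beta) * B).
{ apply Rabs_le_between. rewrite Rabs_mult, (Rabs_pos_eq B); lra. }
assert (a4 : 0 < eps * t) by (apply Rmult_lt_0_compat; lra).
assert (a5 : 0 <= eps * B) by (apply Rmult_le_pos; lra).
replace (Gt / t - (1 - beta)) with ((Gt - (1 - beta) * t) / t) by (field; lra).
apply Rabs_def1.
- apply Rmult_lt_reg_r with t; trivial.
  replace ((Gt - (1 - beta) * t) / t * t) with (Gt - (1 - beta) * t) by (field; lra). unfold K in hKt. lra.
- apply Rmult_lt_reg_r with t; trivial.
  replace ((Gt - (1 - beta) * t) / t * t) with (Gt - (1 - beta) * t) by (field; lra). unfold K in hKt. lra.
Qed.

(** The relation 1/p + 1/q = 1 for finite p, obtained by multiplying the two reciprocal limits. *)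
Lemma conjugate_exponent (p : R) :
  is_lim (fun t => t * g1 t / g t) p_infty p -> p * (1 - beta) = 1.
Proof.
intros hp.
assert (i : is_lim (fun t => t * g1 t / g t * (g t / (t * g1 t))) p_infty (p * (1 - beta))).
{ apply (is_lim_mult _ _ p_infty p (1 - beta)); [trivial|apply g_over_tg1_lim|exact I]. }
assert (j : is_lim (fun t => t * g1 t / g t * (g t / (t * g1 t))) p_infty 1).
{ apply (is_lim_ext_loc (fun _ => 1)); [|apply is_lim_const].
  destruct (g_unbounded HG 1) as [B [hB hg]].
  assert (ht0 := growth_t0 HG).
  exists B. intros t ht. specialize (hg t ltac:(lra)).
  assert (p1 := growth_g1 HG t ltac:(lra)). field. lra. }
apply is_lim_unique in i. apply is_lim_unique in j. rewrite i in j.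
injection j. trivial.
Qed.

End Ratio.

(** With [x = eta (S k) / eta k], which is the p-th power of the ratio of the [delta] when q > 1,
    both recursions become the neck equation and the amplitude rule. The last identity reads
    [delta k = eta k ^ (1/p)] for q > 1 and 1 for q = 1. *)
Lemma seqs_adeta_unified (f : R -> R) (t0 : R) (g1 g2 : R -> R) (q : R) (p : Rbar)
  (a delta eta : nat -> R) :
  growth (logf f) g1 g2 t0 (/ q) -> H1 f t0 g1 g2 q p -> 1 <= q < 2 ->
  seqs_adeta q p a delta eta ->
  a 1%nat = 2 /\ eta 1%nat = 1 /\
  forall k, (1 <= k)%nat -> 0 < eta (S k) < eta k /\
    2 / (2 + a k) * Lam (/ q) (eta (S k) / eta k) = 1 - eta (S k) / eta k /\
    a (S k) = 2 - Rpower (eta (S k) / eta k) (/ q) * (2 + a k) /\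
    1 - (1 - / q) * Lam (/ q) (eta k) = delta k.
Proof.
intros HG [_ [hpq [_ [hp _]]]] hq [ha1 [_ [he1 [hs1 hs2]]]].
split; [trivial|]. split; [trivial|]. intros k hk.
destruct (Req_dec q 1) as [e1|ne].
- destruct (hs2 e1 k hk) as [i1 [i2 [i3 i4]]]. rewrite e1, Rinv_1.
  assert (hx : 0 < eta (S k) / eta k) by (apply div_pos; lra).
  split; [trivial|]. split; [|split].
  + unfold Lam. destruct (Req_EM_T 1 1) as [_|n]; [|lra].
    assert (hl : ln (eta k / eta (S k)) = - ln (eta (S k) / eta k)).
    { rewrite <- ln_Rinv by trivial. rewrite Rinv_div. reflexivity. }
    rewrite hl in i2. lra.
  + rewrite Rpower_1 by trivial. trivial.
  + rewrite i4. ring.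
- assert (hq1 : 1 < q < 2) by lra.
  destruct hpq as [[e _]|[_ [p0 [hp0 hp0pos]]]]; [lra|]. rewrite hp0 in *.
  assert (hconj := conjugate_exponent HG p0 hp). simpl in hs1.
  set (b := / q) in *.
  assert (hb1 : b <> 1) by (intros e; rewrite e in hconj; lra).
  assert (hb2 : 1 - b = / p0) by (apply Rmult_eq_reg_l with p0; [rewrite hconj, Rinv_r; lra|lra]).
  destruct (hs1 hq1 k hk) as [i1 [i2 [i3 i4]]].
  destruct (hs1 hq1 (S k) ltac:(lia)) as [j1 [_ [_ j4]]].
  assert (hd : 0 < delta (S k) / delta k < 1).
  { split; [apply div_pos; lra|]. apply Rmult_lt_reg_r with (delta k); [lra|].
    replace (delta (S k) / delta k * delta k) with (delta (S k)) by (field; lra). lra. }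
  assert (hx : eta (S k) / eta k = Rpower (delta (S k) / delta k) p0).
  { rewrite i4, j4. unfold Rpower. rewrite ln_div by lra.
    unfold Rdiv. rewrite <- exp_Ropp, <- exp_plus. f_equal. ring. }
  assert (hx1 : Rpower (eta (S k) / eta k) (1 - b) = delta (S k) / delta k).
  { rewrite hx, Rpower_mult, hb2, Rinv_r, Rpower_1 by lra. reflexivity. }
  assert (hx2 : Rpower (eta (S k) / eta k) b = Rpower (delta (S k) / delta k) (p0 - 1)).
  { rewrite hx, Rpower_mult. f_equal. lra. }
  assert (heS : 0 < eta (S k)) by (rewrite j4; apply Rpower_pos).
  split; [split; trivial|split; [|split]].
  + rewrite i4, j4. unfold Rpower. apply exp_increasing.
    apply Rmult_lt_compat_l; [trivial|]. apply ln_increasing; lra.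
  + unfold Lam. destruct (Req_EM_T b 1) as [e|_]; [lra|]. rewrite hx1, hx.
    replace ((1 - delta (S k) / delta k) / (1 - b)) with (p0 * (1 - delta (S k) / delta k)).
    * unfold Rdiv in *. lra.
    * rewrite hb2. field. lra.
  + rewrite hx2. trivial.
  + unfold Lam. destruct (Req_EM_T b 1) as [e|_]; [lra|].
    assert (hdk : Rpower (eta k) (1 - b) = delta k).
    { rewrite i4, Rpower_mult, hb2, Rinv_r, Rpower_1 by lra. reflexivity. }
    rewrite hdk. field. lra.
Qed.

(** * Limits along the sequence *)

Lemma lim_seq_ev (v : nat -> R) (l : R) : is_lim_seq v l ->
  forall e, 0 < e -> exists N, forall n, (N <= n)%nat -> Rabs (v n - l) < e.
Proof. intros hv e he. apply is_lim_seq_spec in hv. exact (hv (mkposreal e he)). Qed.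

Lemma lim_seq_intro (v : nat -> R) (l : R) :
  (forall e, 0 < e -> exists N, forall n, (N <= n)%nat -> Rabs (v n - l) <= e) -> is_lim_seq v l.
Proof.
intros hv. apply is_lim_seq_spec. intros [e he]. simpl.
destruct (hv (e / 2) ltac:(lra)) as [N hN]. exists N. intros n hn. specialize (hN n hn). lra.
Qed.

Lemma inf_seq_ev (v : nat -> R) : is_lim_seq v p_infty ->
  forall K, exists N, forall n, (N <= n)%nat -> K < v n.
Proof. intros hv K. apply is_lim_seq_spec in hv. exact (hv K). Qed.

Lemma inf_seq_intro (v : nat -> R) :
  (forall K, exists N, forall n, (N <= n)%nat -> K <= v n) -> is_lim_seq v p_infty.
Proof.
intros hv. apply is_lim_seq_spec. intros K.
destruct (hv (K + 1)) as [N hN]. exists N. intros n hn. specialize (hN n hn). lra.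
Qed.

Lemma bounded_over_inf (x v : nat -> R) (C : R) (N : nat) :
  (forall n, (N <= n)%nat -> Rabs (x n) <= C) -> is_lim_seq v p_infty ->
  is_lim_seq (fun n => x n / v n) 0.
Proof.
intros hx hv. apply lim_seq_intro. intros e he.
assert (hC : 0 <= C) by (specialize (hx N ltac:(lia)); assert (i := Rabs_pos (x N)); lra).
destruct (inf_seq_ev v hv (C / e)) as [N1 hN1].
exists (N + N1)%nat. intros n hn. specialize (hx n ltac:(lia)). specialize (hN1 n ltac:(lia)).
assert (0 <= C / e) by (apply Rmult_le_pos; [lra|left; now apply Rinv_0_lt_compat]).
rewrite Rminus_0_r. unfold Rdiv. rewrite Rabs_mult, Rabs_inv, (Rabs_pos_eq (v n)) by lra.
apply Rmult_le_reg_r with (v n); [lra|]. rewrite Rmult_assoc, Rinv_l, Rmult_1_r by lra.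
assert (e * (C / e) <= e * v n) by (apply Rmult_le_compat_l; lra).
replace (e * (C / e)) with C in H0 by (field; lra). lra.
Qed.

Lemma choice_fun {A B : Type} (P : A -> B -> Prop) :
  (forall x, exists y, P x y) -> exists F, forall x, P x (F x).
Proof.
intros hP. exists (fun x => proj1_sig (constructive_indefinite_description _ (hP x))).
intros x. apply proj2_sig.
Qed.

(** A diagonal choice: term n satisfies [P] at every tolerance [1 / (m + 1)] with [m <= n] that is
    attainable for that n. The default [d0] serves the indices where none is, so that [D] holds for
    all n. *)
Lemma choose_seq (P : nat -> R -> R -> Prop) (D : R -> Prop) (d0 : R) : D d0 ->
  (forall n e e' s, P n e s -> e <= e' -> P n e' s) -> (forall n e s, P n e s -> D s) ->
  (forall e, 0 < e -> exists N, forall n, (N <= n)%nat -> exists s, P n e s) ->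
  exists sq : nat -> R, (forall n, D (sq n)) /\
    forall e, 0 < e -> exists N, forall n, (N <= n)%nat -> P n e (sq n).
Proof.
intros hd0 hmono hD hex.
(* By monotonicity in the tolerance, a witness for the finest attainable one serves the coarser ones
   too. *)
assert (hkey : forall n j, exists s, D s /\ forall m, (m <= j)%nat ->
   (exists s', P n (/ INR (S m)) s') -> P n (/ INR (S m)) s).
{ intros n. assert (hstep : forall j s, D s ->
    (forall m, (m < j)%nat -> (exists s', P n (/ INR (S m)) s') -> P n (/ INR (S m)) s) ->
    exists s, D s /\ forall m, (m <= j)%nat -> (exists s', P n (/ INR (S m)) s') -> P n (/ INR (S m)) s).
  { intros j s hs hj.
    destruct (classic (exists s', P n (/ INR (S j)) s')) as [[s' hs']|hno].
    - exists s'. split; [now apply (hD n (/ INR (S j)))|]. intros m hm _.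
      apply (hmono n (/ INR (S j))); trivial.
      apply Rinv_le_contravar; [apply lt_0_INR; lia|apply le_INR; lia].
    - exists s. split; [trivial|]. intros m hm hm'.
      destruct (Nat.eq_dec m j) as [->|hne]; [contradiction|]. apply hj; trivial. lia. }
  induction j as [|j [s [hs hj]]].
  - apply (hstep 0%nat d0 hd0). intros m hm. lia.
  - apply (hstep (S j) s hs). intros m hm. apply hj. lia. }
destruct (choice_fun _ (fun n => hkey n n)) as [sq hsq].
exists sq. split; [intros n; apply hsq|]. intros e he.
destruct (archimed_cor1 e he) as [[|m] [hm1 hm2]]; [lia|].
destruct (hex (/ INR (S m)) ltac:(apply Rinv_0_lt_compat, lt_0_INR; lia)) as [N hN].
exists (N + m)%nat. intros n hn.
apply (hmono n (/ INR (S m))); [|lra]. apply hsq; [lia|]. apply hN. lia.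
Qed.

Section Limits.
Context {g g1 g2 : R -> R} {t0 beta : R} (HG : growth g g1 g2 t0 beta).
Context {mu : nat -> R} (Hmu : is_lim_seq mu p_infty).

Lemma g_mu_lim : is_lim_seq (fun n => g (mu n)) p_infty.
Proof.
apply inf_seq_intro. intros K. destruct (g_unbounded HG K) as [B [_ hB]].
destruct (inf_seq_ev mu Hmu B) as [N hN]. exists N. intros n hn. apply hB.
specialize (hN n hn). lra.
Qed.

Lemma g1_mu_lim : is_lim_seq (fun n => g1 (mu n)) p_infty.
Proof.
apply inf_seq_intro. intros K. destruct (g1_unbounded HG K) as [B [_ hB]].
destruct (inf_seq_ev mu Hmu B) as [N hN]. exists N. intros n hn. apply hB.
specialize (hN n hn). lra.
Qed.

Lemma gap_lim (v : nat -> R) (et : R) (N0 : nat) : 0 < et <= 1 ->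
  (forall n, (N0 <= n)%nat -> t0 < v n <= mu n) ->
  is_lim_seq (fun n => g (v n) / g (mu n)) et ->
  is_lim_seq (fun n => (mu n - v n) * g1 (mu n) / g (mu n)) (Lam beta et).
Proof.
intros het hv hl.
assert (hL : is_lim_seq (fun n => Lam beta (g (v n) / g (mu n))) (Lam beta et)).
{ apply (is_lim_seq_continuous (Lam beta)); trivial.
  apply continuity_pt_filterlim, @ex_derive_continuous. eexists. apply Lam_derive; lra. }
apply (is_lim_seq_ext (fun n => ((mu n - v n) * g1 (mu n) / g (mu n) - Lam beta (g (v n) / g (mu n)))
   + Lam beta (g (v n) / g (mu n)))); [intros n; ring|].
replace (Lam beta et) with (0 + Lam beta et) by ring.
apply is_lim_seq_plus'; [|trivial].
apply lim_seq_intro. intros e he.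
destruct (g_gap HG e (et / 2) he ltac:(lra)) as [B [hB [_ hgap]]].
destruct (inf_seq_ev _ g_mu_lim (2 * Rabs (g B) / et)) as [N1 hN1].
destruct (lim_seq_ev _ _ hl (et / 2) ltac:(lra)) as [N2 hN2].
exists (N0 + N1 + N2)%nat. intros n hn.
specialize (hN1 n ltac:(lia)). specialize (hN2 n ltac:(lia)). specialize (hv n ltac:(lia)).
apply Rabs_def2 in hN2. rewrite Rminus_0_r.
assert (hp : 0 <= 2 * Rabs (g B) / et).
{ apply Rmult_le_pos; [assert (i := Rabs_pos (g B)); lra|left; apply Rinv_0_lt_compat; lra]. }
set (w := g (v n) / g (mu n)) in *.
assert (hw : g (v n) = w * g (mu n)) by (unfold w; field; lra).
assert (hle : et / 2 * g (mu n) <= g (v n)) by (rewrite hw; apply Rmult_le_compat_r; lra).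
assert (hBv : B <= v n).
{ apply (g_le_inv HG); [lra|lra|]. assert (i := Rle_abs (g B)).
  assert (et / 2 * (2 * Rabs (g B) / et) <= et / 2 * g (mu n)) by (apply Rmult_le_compat_l; lra).
  replace (et / 2 * (2 * Rabs (g B) / et)) with (Rabs (g B)) in H by (field; lra). lra. }
apply hgap; lra.
Qed.

(** [1 - v / mu] is the product of [g / (mu * g1)], with limit [1 - beta], and the normalized gap,
    with limit [Lam beta et]. *)
Lemma quotient_lim (v : nat -> R) (et : R) (N0 : nat) : 0 < et <= 1 ->
  (forall n, (N0 <= n)%nat -> t0 < v n <= mu n) ->
  is_lim_seq (fun n => g (v n) / g (mu n)) et ->
  is_lim_seq (fun n => v n / mu n) (1 - (1 - beta) * Lam beta et).
Proof.
intros het hv hl.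
assert (h1 := gap_lim v et N0 het hv hl).
assert (h2 : is_lim_seq (fun n => g (mu n) / (mu n * g1 (mu n))) (1 - beta)).
{ apply (is_lim_comp_seq (fun t => g t / (t * g1 t)) mu p_infty (1 - beta)).
  - apply (g_over_tg1_lim HG).
  - exists 0%nat. intros n _. discriminate.
  - trivial. }
assert (h3 := is_lim_seq_minus' _ _ _ _ (is_lim_seq_const 1) (is_lim_seq_mult' _ _ _ _ h2 h1)).
revert h3. apply is_lim_seq_ext_loc.
destruct (inf_seq_ev _ g_mu_lim 0) as [N1 hN1]. destruct (inf_seq_ev mu Hmu t0) as [N2 hN2].
assert (ht0 := growth_t0 HG).
exists (N1 + N2)%nat. intros n hn. specialize (hN1 n ltac:(lia)). specialize (hN2 n ltac:(lia)).
assert (p1 := growth_g1 HG (mu n) hN2). field. lra.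
Qed.

(** Both hypotheses of claim (1) become one statement about levels: for [v / mu] small, compare [g]
    with its chord; for an infinite gap, [Lam beta] is bounded on [c,1]. The guard [B <= v n] keeps
    [v n] where [g] is controlled. *)
Lemma level_to_0 (v : nat -> R) : (forall n, v n <= mu n) ->
  is_lim_seq (fun n => v n / mu n) 0 \/
  (is_lim_seq (fun n => (mu n - v n) * g1 (mu n) / g (mu n)) p_infty) ->
  forall B c, t0 < B -> 0 < c < 1 ->
  exists N, forall n, (N <= n)%nat -> B <= v n -> g (v n) <= c * g (mu n).
Proof.
intros hv hcase B c hB hc.
assert (ht0 := growth_t0 HG).
destruct hcase as [hlim|hinf].
- destruct (lim_seq_ev _ _ hlim (c / 4) ltac:(lra)) as [N1 hN1].
  destruct (inf_seq_ev _ g_mu_lim (2 * Rabs (g B) / c)) as [N2 hN2].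
  destruct (inf_seq_ev mu Hmu (2 * B)) as [N3 hN3].
  exists (N1 + N2 + N3)%nat. intros n hn hBv.
  specialize (hN1 n ltac:(lia)). specialize (hN2 n ltac:(lia)). specialize (hN3 n ltac:(lia)).
  specialize (hv n). apply Rabs_def2 in hN1.
  assert (hvc : v n <= c / 4 * mu n).
  { replace (v n) with (v n / mu n * mu n) by (field; lra). apply Rmult_le_compat_r; lra. }
  assert (hp : 0 <= 2 * Rabs (g B) / c).
  { apply Rmult_le_pos; [assert (i := Rabs_pos (g B)); lra|left; apply Rinv_0_lt_compat; lra]. }
  assert (hgB : Rabs (g B) <= c / 2 * g (mu n)).
  { assert (c / 2 * (2 * Rabs (g B) / c) <= c / 2 * g (mu n)) by (apply Rmult_le_compat_l; lra).
    replace (c / 2 * (2 * Rabs (g B) / c)) with (Rabs (g B)) in H by (field; lra). lra. }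
  assert (habs := Rle_abs (g B)). assert (habs2 := Rle_abs (- g B)). rewrite Rabs_Ropp in habs2.
  assert (hch := g_chord HG B (v n) (mu n) hB ltac:(lra)).
  apply Rmult_le_reg_r with (mu n - B); [lra|].
  assert (hgBm : g B <= g (mu n)) by (apply (g_le HG); lra).
  assert (i1 : (g (mu n) - g B) * (v n - B) <= (g (mu n) - g B) * (c / 4 * mu n - B)).
  { apply Rmult_le_compat_l; lra. }
  set (G := g (mu n)) in *. set (M := mu n) in *. set (b := g B) in *.
  assert (j1 : 0 <= (c / 2 * G - b) * (M - c / 4 * M)).
  { apply Rmult_le_pos; [lra|]. assert (0 <= (1 - c / 4) * M) by (apply Rmult_le_pos; lra). lra. }
  assert (j2 : 0 <= G * c * (M / 2 - B)).
  { apply Rmult_le_pos; [apply Rmult_le_pos|]; lra. }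
  assert (j3 : 0 <= G * c * c * M).
  { repeat apply Rmult_le_pos; lra. }
  assert (j5 : 0 <= G * B * c) by (repeat apply Rmult_le_pos; lra).
  nra.
- destruct (g_gap HG 1 c ltac:(lra) hc) as [B1 [hB1 [hg1 hgap]]].
  destruct (inf_seq_ev _ hinf (1 + Lam beta c)) as [N1 hN1].
  destruct (inf_seq_ev _ g_mu_lim (Rabs (g B1) / c)) as [N2 hN2].
  exists (N1 + N2)%nat. intros n hn hBv.
  specialize (hN1 n ltac:(lia)). specialize (hN2 n ltac:(lia)). specialize (hv n).
  assert (hp : 0 <= Rabs (g B1) / c).
  { apply Rmult_le_pos; [apply Rabs_pos|left; apply Rinv_0_lt_compat; lra]. }
  apply Rnot_lt_le; intros hlt.
  assert (hBv1 : B1 <= v n).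
  { apply (g_le_inv HG); [lra|lra|]. assert (i := Rle_abs (g B1)).
    assert (c * (Rabs (g B1) / c) <= c * g (mu n)) by (apply Rmult_le_compat_l; lra).
    replace (c * (Rabs (g B1) / c)) with (Rabs (g B1)) in H by (field; lra). lra. }
  assert (j := hgap (v n) (mu n) ltac:(lra) ltac:(lra)). apply Rabs_le_between in j.
  assert (k : Lam beta (g (v n) / g (mu n)) <= Lam beta c).
  { apply Lam_anti; [lra|]. apply Rmult_le_reg_r with (g (mu n)); [lra|].
    replace (g (v n) / g (mu n) * g (mu n)) with (g (v n)) by (field; lra). lra. }
  lra.
Qed.

(** [ln g1] is at most a constant plus [2 * ln g], which is negligible against [g]. *)
Lemma ln_g1_over_g_lim (v : nat -> R) (B : R) (N0 : nat) : t0 < B ->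
  (forall n, (N0 <= n)%nat -> B <= v n <= mu n) ->
  is_lim_seq (fun n => ln (g1 (v n)) / g (mu n)) 0.
Proof.
intros hB hv.
destruct (ln_g1_bounds HG 1 ltac:(lra)) as [B1 [hB1 [hg hln]]].
assert (hbeta := growth_beta HG).
destruct (inf_seq_ev mu Hmu B1) as [N1 hN1].
pose (C := Rabs (ln (g1 B)) + Rabs (ln (g1 B1))).
assert (hC0 : 0 <= C).
{ unfold C. assert (i := Rabs_pos (ln (g1 B))). assert (j := Rabs_pos (ln (g1 B1))). lra. }
assert (hlnx : is_lim_seq (fun n => C / g (mu n) + 2 * (ln (g (mu n)) / g (mu n))) (0 + 2 * 0)).
{ apply is_lim_seq_plus'.
  - apply (bounded_over_inf (fun _ => C) _ C 0); [|apply g_mu_lim].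
    intros n _. rewrite Rabs_pos_eq; lra.
  - apply (is_lim_seq_mult' (fun _ => 2)); [apply is_lim_seq_const|].
    apply (is_lim_comp_seq (fun x => ln x / x) (fun n => g (mu n)) p_infty 0).
    + apply is_lim_div_ln_p.
    + exists 0%nat. intros n _. discriminate.
    + apply g_mu_lim. }
rewrite Rmult_0_r, Rplus_0_r in hlnx.
apply lim_seq_intro. intros e he.
destruct (lim_seq_ev _ _ hlnx e he) as [N2 hN2].
exists (N0 + N1 + N2)%nat. intros n hn.
specialize (hv n ltac:(lia)). specialize (hN1 n ltac:(lia)). specialize (hN2 n ltac:(lia)).
assert (hgm := hg (mu n) ltac:(lra)).
destruct (hln B1 (mu n) ltac:(lra)) as [_ hup].
assert (p0 := growth_g1 HG B hB).
assert (p2 := growth_g1 HG (v n) ltac:(lra)).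
assert (l1 : ln (g1 B) <= ln (g1 (v n))) by (apply ln_le; [trivial|apply (g1_le HG); lra]).
assert (l2 : ln (g1 (v n)) <= ln (g1 (mu n))) by (apply ln_le; [trivial|apply (g1_le HG); lra]).
assert (l3 : 0 <= ln (g B1)) by (rewrite <- ln_1; apply ln_le; [lra|apply hg; lra]).
assert (l4 : 0 <= ln (g (mu n))) by (rewrite <- ln_1; apply ln_le; lra).
assert (l5 : (beta + 1) * (ln (g (mu n)) - ln (g B1)) <= 2 * ln (g (mu n))) by nra.
assert (a1 := Rle_abs (ln (g1 B1))). assert (a2 := Rle_abs (- ln (g1 B))). rewrite Rabs_Ropp in a2.
assert (a3 := Rabs_pos (ln (g1 B))). assert (a4 := Rabs_pos (ln (g1 B1))).
assert (hb : Rabs (ln (g1 (v n))) <= C + 2 * ln (g (mu n))).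
{ unfold C. apply Rabs_le_between. lra. }
rewrite Rminus_0_r in *. apply Rabs_def2 in hN2. unfold Rdiv. rewrite Rabs_mult, Rabs_inv, (Rabs_pos_eq (g (mu n))) by lra.
apply Rle_trans with ((C + 2 * ln (g (mu n))) * / g (mu n)).
- apply Rmult_le_compat_r; [left; apply Rinv_0_lt_compat; lra|trivial].
- unfold Rdiv in hN2. lra.
Qed.

End Limits.

Lemma f1_logf (f f1 : R -> R) (t0 : R) (g1 : R -> R) : 0 <= t0 ->
  (forall t, t0 <= t -> 0 < f t) -> derive_on (Ici 0) f f1 -> derive_on (Ici t0) (logf f) g1 ->
  forall t, t0 < t -> f1 t = exp (logf f t) * g1 t.
Proof.
intros ht0 hf hd1 hd2 t ht.
assert (hin : forall b, 0 <= b <= t0 -> forall y, Rabs (y - t) < t - t0 -> Ici b y).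
{ intros b hb y hy. apply Rabs_def2 in hy. unfold Ici. lra. }
assert (d1 := derive_on_is_derive _ _ _ t (t - t0) hd1 ltac:(lra) (hin 0 ltac:(lra))).
assert (d2 := derive_on_is_derive _ _ _ t (t - t0) hd2 ltac:(lra) (hin t0 ltac:(lra))).
assert (hft := hf t ltac:(lra)).
assert (d3 : is_derive (logf f) t (f1 t / f t)).
{ unfold logf. auto_derive; [repeat split; trivial; eexists; eassumption|].
  rewrite (Derive_eta d1). field. lra. }
apply is_derive_unique in d2. apply is_derive_unique in d3.
unfold logf at 1. rewrite exp_ln by trivial. rewrite <- d2, d3. field. lra.
Qed.

(** * The mass integral in the logarithmic variable *)

Section Mass.
Context {f f1 g g1 g2 : R -> R} {t0 beta : R} (HG : growth g g1 g2 t0 beta).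
Context (Hf0 : forall t, 0 <= t -> 0 <= f t).
Context (Hf : forall t, t0 < t -> f t = exp (g t)).
Context (Hf1 : forall t, t0 < t -> f1 t = exp (g t) * g1 t).
Context (Hf1c : continuous_on (Ici 0) f1).
Context {h h1 : R -> R} {hm hM H : R} (HW : weight h h1 hm hM H) (Hhc : continuous_on I01 h).
Context {lam mu : R} {u u1 : R -> R} (Huc : continuous_on I01 u) (Hu : forall r, I01 r -> 0 <= u r).
Local Notation U := (fun s => u (exp s)).
Local Notation Y := (fun s => - (exp s * u1 (exp s))).
Context (HS : sol h f lam mu U Y).

Definition mass (r : R) : R := RInt (fun r => lam * h r * f1 (u r) * r) 0 r.

(** The clamped integrand is continuous on the whole line, so its primitive is differentiable
    everywhere, also at 0 and 1. *)
Let F (x : R) : R := lam * h (clamp 0 1 x) * f1 (u (clamp 0 1 x)) * clamp 0 1 x.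

Lemma F_continuous (x : R) : continuous F x.
Proof.
assert (hfu : continuous_on I01 (fun r => f1 (u r))).
{ intros r hr. apply filterlim_locally. intros [e he].
  destruct (continuous_on_eps _ _ (u r) Hf1c (Hu r hr) e he) as [d [hd hb]].
  destruct (continuous_on_eps _ _ r Huc hr d hd) as [d' [hd' hb']].
  exists (mkposreal d' hd'). intros y hy hDy. apply hb; [now apply Hu|]. now apply hb'. }
assert (hid : continuous_on I01 (fun r => r)).
{ intros r hr. apply filterlim_locally. intros [e he].
  exists (mkposreal e he). intros y hy _. exact hy. }
unfold F.
apply (continuous_mult (fun x => lam * h (clamp 0 1 x) * f1 (u (clamp 0 1 x))) (fun x => clamp 0 1 x)).
- apply (continuous_mult (fun x => lam * h (clamp 0 1 x)) (fun x => f1 (u (clamp 0 1 x)))).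
  + apply (continuous_mult (fun _ => lam) (fun x => h (clamp 0 1 x))).
    * apply continuous_const.
    * apply (clamp_continuous I01); trivial; lra.
  + apply (clamp_continuous I01 (fun r => f1 (u r))); trivial; lra.
- apply (clamp_continuous I01 (fun r => r)); trivial; lra.
Qed.

Lemma mass_derive (x : R) : is_derive (RInt F 0) x (F x).
Proof.
apply (is_derive_RInt F (RInt F 0) 0 x).
- exists (mkposreal 1 Rlt_0_1). intros y _. apply (RInt_correct (V := R_CompleteNormedModule)).
  apply (ex_RInt_continuous (V := R_CompleteNormedModule)). intros v _. apply F_continuous.
- apply F_continuous.
Qed.

Lemma mass_F (r : R) : 0 <= r <= 1 -> mass r = RInt F 0 r.
Proof.
intros hr. unfold mass. apply RInt_ext. rewrite Rmin_left, Rmax_right by lra.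
intros x hx. unfold F. rewrite clamp_id by lra. reflexivity.
Qed.

Lemma F_exp (s : R) : s < 0 -> t0 < U s -> F (exp s) * exp s = rhof h g g1 lam U s.
Proof.
intros hs hU. assert (i := exp_neg_lt1 s hs). unfold F. rewrite clamp_id by lra.
rewrite (Hf1 _ hU). unfold rhof. replace (2 * s) with (s + s) by ring. rewrite exp_plus. ring.
Qed.

(** In the variable s the mass has derivative [rho = z' + kap z^2]. With [z >= c0] this is at least
    [z' + c0 * kap z], and [kap z] is minus the derivative of [ln (g1 (U))]; integration from [sp],
    where [z = 2], gives the bound. *)
Lemma mass_lower (Bt c0 sp s : R) : t0 < Bt -> sp <= s < 0 -> Bt <= U s ->
  zf g1 U Y sp = 2 -> (forall x, sp <= x <= s -> c0 <= zf g1 U Y x) ->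
  - 2 + c0 * (ln (g1 (U sp)) - ln (g1 (U s))) <= mass (exp s).
Proof.
intros hBt hs hUs hzsp hz.
assert (es := exp_neg_lt1 s ltac:(lra)). assert (esp := exp_neg_lt1 sp ltac:(lra)).
rewrite mass_F by lra.
assert (hUx : forall x, x <= s -> Bt <= U x).
{ intros x hx. assert (i := U_anti Hf0 HW HS x s ltac:(lra)). simpl in *. lra. }
assert (h0 : 0 <= RInt F 0 (exp sp)).
{ assert (e0 : RInt F 0 0 = 0) by exact (RInt_point 0 F).
  apply Rle_trans with (RInt F 0 0); [lra|].
  apply (derive_ge0_le (RInt F 0) F); [lra|..].
  - intros x _. apply mass_derive.
  - intros x hx. destruct (Req_dec x 0) as [->|hne].
    + unfold F. rewrite clamp_id by lra. lra.
    + replace x with (exp (ln x)) by (rewrite exp_ln; lra).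
      assert (hln : ln x <= sp).
      { rewrite <- (ln_exp sp). apply ln_le; lra. }
      assert (hUl := hUx (ln x) ltac:(lra)).
      assert (rp := rho_pos HG HW HS (ln x) ltac:(lra) ltac:(simpl in *; lra)).
      rewrite <- F_exp in rp; [|lra|simpl in *; lra].
      assert (ep := exp_pos (ln x)). nra. }
assert (hmon : RInt F 0 (exp sp) - zf g1 U Y sp + c0 * ln (g1 (U sp))
  <= RInt F 0 (exp s) - zf g1 U Y s + c0 * ln (g1 (U s))).
{ pose (A := fun x => RInt F 0 (exp x)). pose (B := fun x => ln (g1 (U x))).
  apply (derive_ge0_le (fun x => A x - zf g1 U Y x + c0 * B x)
    (fun x => kapf g1 g2 (U x) * zf g1 U Y x * (zf g1 U Y x - c0))); [lra|..].
  - intros x hx. assert (hUxx := hUx x ltac:(lra)).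
    assert (hU0 : t0 < U x) by (simpl in *; lra).
    assert (d1 := z_derive HG Hf HS x ltac:(lra) hU0).
    assert (d2 := lng1U_derive HG HS x ltac:(lra) hU0).
    change (is_derive B x (- (kapf g1 g2 (U x) * zf g1 U Y x))) in d2.
    assert (d3 : is_derive A x (rhof h g g1 lam U x)).
    { rewrite <- F_exp by (trivial; lra).
      assert (dF := mass_derive (exp x)). unfold A.
      replace (F (exp x) * exp x) with (exp x * F (exp x)) by ring.
      apply (is_derive_comp (RInt F 0) exp); trivial. apply is_derive_exp. }
    auto_derive; [repeat split; trivial; eexists; eassumption|].
    rewrite (Derive_eta d1), (Derive_eta d2), (Derive_eta d3). ring.
  - intros x hx. assert (hUxx := hUx x ltac:(lra)).
    assert (hU0 : t0 < U x) by (simpl in *; lra).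
    assert (kp := kap_pos HG (U x) hU0). assert (zp := z_pos HG Hf0 Hf HW HS x ltac:(lra) hU0).
    specialize (hz x hx).
    apply Rmult_le_pos; [apply Rmult_le_pos; lra|lra]. }
assert (zp := z_pos HG Hf0 Hf HW HS s ltac:(lra) ltac:(simpl in *; lra)).
simpl in *. lra.
Qed.

(** At low values of [u] the derivative of [f] may be negative, so the mass can decrease there; [K]
    bounds this loss. *)
Lemma mass_tail (s s' K : R) : s <= s' < 0 -> 0 <= K ->
  (forall x, exp s <= x <= exp s' -> - K <= lam * h x * f1 (u x) * x) ->
  mass (exp s) - K <= mass (exp s').
Proof.
intros hs hK hF.
assert (es := exp_neg_lt1 s ltac:(lra)). assert (es' := exp_neg_lt1 s' ltac:(lra)).
assert (ele : exp s <= exp s') by (apply exp_le; lra).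
rewrite !mass_F by lra.
assert (i : - K * (exp s' - exp s) <= RInt F 0 (exp s') - RInt F 0 (exp s)).
{ apply (derive_ge_incr (RInt F 0) F); trivial.
  - intros x _. apply mass_derive.
  - intros x hx. unfold F. rewrite clamp_id by lra. now apply hF. }
nra.
Qed.

End Mass.

Theorem theorem1p3
  (h h1 f f1 f2 : R -> R) (t0 : R) (g1 g2 : R -> R) (q : R) (p : Rbar)
  (a delta eta : nat -> R)
  (lam mu : nat -> R) (u u1 u2 : nat -> R -> R) :
  (* h : [0,1] -> (0,oo), C^1 *)
  (forall r, I01 r -> 0 < h r) -> C1_on I01 h h1 ->
  (* f : [0,oo) -> [0,oo), C^1 *)
  (forall t, 0 <= t -> 0 <= f t) -> C1_on (Ici 0) f f1 ->
  (* f > 0 and C^2 on [t0,oo) *)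
  0 <= t0 -> (forall t, t0 <= t -> 0 < f t) -> C2_on (Ici t0) f f1 f2 ->
  (* g = log f, with derivatives g1, g2 on [t0,oo) *)
  derive_on (Ici t0) (logf f) g1 -> derive_on (Ici t0) g1 g2 ->
  (* (H1) with q in [1,2) *)
  H1 f t0 g1 g2 q p -> 1 <= q < 2 ->
  seqs_adeta q p a delta eta ->
  (* the solutions *)
  (forall n, 0 < lam n /\ 0 < mu n /\
     C2_on I01 (u n) (u1 n) (u2 n) /\
     (forall r, 0 < r < 1 ->
        - u2 n r - u1 n r / r = lam n * h r * f (u n r) /\ 0 < u n r) /\
     u n 0 = mu n /\ u1 n 0 = 0 /\ u n 1 = 0) ->
  is_lim_seq mu p_infty ->
  exists (phi : nat -> nat) (rk : nat -> nat -> R),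
    (forall n, (phi n < phi (S n))%nat) /\
    (forall k, (1 <= k)%nat ->
       (forall n, 0 < rk k n < 1) /\
       is_lim_seq (fun n => u (phi n) (rk k n) / mu (phi n)) (delta k) /\
       is_lim_seq (fun n => lam (phi n) * (rk k n)^2 * h (rk k n)
                             * f1 (u (phi n) (rk k n))) (a k ^ 2 / 2) /\
       (q = 1 ->
          is_lim_seq (fun n => (mu (phi n) - u (phi n) (rk k n))
                                * g1 (mu (phi n)) / logf f (mu (phi n)))
                     (ln (1 / eta k)))) /\
    (* (1) *)
    (forall rn : nat -> R, (forall n, 0 < rn n < 1) ->
       (1 < q -> is_lim_seq (fun n => u (phi n) (rn n) / mu (phi n)) 0) ->
       (q = 1 -> is_lim_seq (fun n => (mu (phi n) - u (phi n) (rn n))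
                                      * g1 (mu (phi n)) / logf f (mu (phi n)))
                            p_infty) ->
       is_lim_seq (fun n => RInt (fun r => lam (phi n) * h r
                                    * f1 (u (phi n) r) * r) 0 (rn n)) p_infty) /\
    (* (2) *)
    (forall r, 0 <= r < 1 ->
       is_lim_seq (fun n => g1 (mu (phi n)) * u (phi n) r) p_infty) /\
    (* (3) *)
    ((q = 1 -> exists c, 0 < c /\ forall t, 0 < t -> c <= f t / t) ->
       is_lim_seq (fun n => ln (1 / lam (phi n)) / logf f (mu (phi n))) 0 /\
       forall k, (1 <= k)%nat ->
         is_lim_seq (fun n => ln (1 / rk k n) / logf f (mu (phi n))) (eta k / 2)).
Proof.
intros hh hhC hf hfC ht0 hfpos hfC2 hg1 hg2 HH hq hseqs hsol hmu.
assert (HG := growth_of_H1 f t0 g1 g2 q p ht0 hg1 hg2 HH hq).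
destruct (weight_of_C1 h h1 hh hhC) as [hm [hM [H HW]]].
set (g := logf f) in *. set (beta := / q) in *.
assert (Hf : forall t, t0 < t -> f t = exp (g t)).
{ intros t ht. unfold g, logf. rewrite exp_ln; [reflexivity|apply hfpos; lra]. }
assert (Hf1 := f1_logf f f1 t0 g1 ht0 hfpos (proj1 hfC) hg1). fold g in Hf1.
assert (Hf1c := proj2 hfC).
assert (Hhc := derive_on_continuous_on _ _ _ (proj1 hhC)).
pose (U := fun n s => u n (exp s)). pose (Y := fun n s => - (exp s * u1 n (exp s))).
assert (HS : forall n, sol h f (lam n) (mu n) (U n) (Y n)).
{ intros n. destruct (hsol n) as [i1 [i2 [i3 [i4 [i5 [i6 i7]]]]]].
  now apply (sol_of_radial h f (lam n) (mu n) (u n) (u1 n) (u2 n)). }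
assert (Huc : forall n, continuous_on I01 (u n)).
{ intros n. destruct (hsol n) as [_ [_ [[i3 _] _]]]. exact (derive_on_continuous_on _ _ _ i3). }
assert (Hu : forall n r, I01 r -> 0 <= u n r).
{ intros n r hr. destruct (hsol n) as [i1 [i2 [i3 [i4 [i5 [i6 i7]]]]]]. unfold I01 in hr.
  destruct (Req_dec r 0) as [->|n0]; [lra|]. destruct (Req_dec r 1) as [->|n1]; [lra|].
  left. apply i4. lra. }
destruct (seqs_adeta_unified f t0 g1 g2 q p a delta eta HG HH hq hseqs) as [ha1 [heta1 hstep]].
fold beta in hstep.
assert (hbeta := growth_beta HG).
assert (hbub : forall k, (1 <= k)%nat -> 0 < a k <= 2 /\ 0 < eta k <= 1 /\
   forall eps, 0 < eps -> bubble_near f g g1 h t0 (a k) (eta k) eps).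
{ induction k as [|k IH]; [lia|]. intros _.
  destruct (Nat.eq_dec k 0) as [->|hk].
  - rewrite ha1, heta1. split; [lra|]. split; [lra|]. exact (bubble_near_first HG hf Hf HW).
  - destruct (IH ltac:(lia)) as [j1 [j2 j3]]. destruct (hstep k ltac:(lia)) as [i1 [i2 [i3 _]]].
    assert (hx : 0 < eta (S k) / eta k < 1).
    { split; [apply div_pos; lra|]. apply Rmult_lt_reg_r with (eta k); [lra|].
      replace (eta (S k) / eta k * eta k) with (eta (S k)) by (field; lra). lra. }
    assert (hap := amplitude_pos beta (a k) _ ltac:(lra) ltac:(lra) hx i2). rewrite <- i3 in hap.
    split; [lra|]. split; [lra|]. intros eps he. rewrite i3.
    replace (eta (S k)) with (eta (S k) / eta k * eta k) by (field; lra).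
    replace (eta (S k) / eta k * eta k / eta k) with (eta (S k) / eta k) by (field; lra).
    now apply (bubble_near_next HG hf Hf HW). }
(* Since [z = 2] is not asked of the points of the theorem, only the level and the value of [rho]
   are recorded. *)
pose (P := fun k n e s => s < 0 /\ t0 < U n s /\ Rabs (g (U n s) / g (mu n) - eta k) <= e /\
   Rabs (rhof h g g1 (lam n) (U n) s - a k ^ 2 / 2) <= e).
assert (hsk : forall k, exists sq : nat -> R, (forall n, sq n < 0) /\ ((1 <= k)%nat ->
   forall e, 0 < e -> exists N, forall n, (N <= n)%nat -> P k n e (sq n))).
{ intros k. destruct (Nat.eq_dec k 0) as [->|hk].
  - exists (fun _ => -1). split; [intros; lra|lia].
  - destruct (choose_seq (P k) (fun s => s < 0) (-1)) as [sq [hsq1 hsq2]].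
    + lra.
    + intros n e e' s [i1 [i2 [i3 i4]]] hee. unfold P. repeat split; trivial; lra.
    + intros n e s [i1 _]. exact i1.
    + intros e he. destruct (hbub k ltac:(lia)) as [_ [_ hb]].
      destruct (hb e he) as [B [hB hb']]. destruct (inf_seq_ev mu hmu B) as [N hN].
      exists N. intros n hn. destruct (hb' (lam n) (mu n) (U n) (Y n) (HS n)) as [s [i1 [i2 [i3 [_ i5]]]]].
      * specialize (hN n hn). lra.
      * now exists s.
    + exists sq. split; [trivial|]. intros _. exact hsq2. }
destruct (choice_fun _ hsk) as [sk hsk']. clear hsk.
destruct (tail HG hf Hf HW) as [Bt [c0 [y0 [c1 [C1 [M [hBt [hc0 [hy0 [hc1 [hM0 htail]]]]]]]]]]].
destruct (inf_seq_ev mu hmu M) as [NM hNM].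
assert (htail' : forall n, (NM <= n)%nat -> _) by
  (intros n hn; exact (htail _ _ _ _ (HS n) (Rlt_le _ _ (hNM n hn)))).
clear htail.
assert (hgmu := g_mu_lim HG hmu). assert (hg1mu := g1_mu_lim HG hmu).
assert (hlev : forall k, (1 <= k)%nat -> (exists N, forall n, (N <= n)%nat -> t0 < U n (sk k n) <= mu n) /\
   is_lim_seq (fun n => g (U n (sk k n)) / g (mu n)) (eta k) /\
   is_lim_seq (fun n => rhof h g g1 (lam n) (U n) (sk k n)) (a k ^ 2 / 2)).
{ intros k hk. destruct (hsk' k) as [i1 i2]. specialize (i2 hk). split; [|split].
  - destruct (i2 1 Rlt_0_1) as [N hN]. exists N. intros n hn. destruct (hN n hn) as [j1 [j2 _]].
    split; [trivial|]. now apply (U_le_mu hf HW (HS n)).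
  - apply lim_seq_intro. intros e he. destruct (i2 e he) as [N hN]. exists N. intros n hn. apply (hN n hn).
  - apply lim_seq_intro. intros e he. destruct (i2 e he) as [N hN]. exists N. intros n hn. apply (hN n hn). }
(* The identity is the subsequence, all estimates being uniform in the solution. *)
exists (fun n => n), (fun k n => exp (sk k n)).
split; [intros n; lia|]. split; [|split; [|split]].
- intros k hk. destruct (hlev k hk) as [[N hN] [hl1 hl2]]. destruct (hbub k hk) as [hak [hek _]].
  split; [|split; [|split]].
  + intros n. apply exp_neg_lt1. apply (hsk' k).
  + destruct (hstep k hk) as [_ [_ [_ <-]]].
    exact (quotient_lim HG hmu (fun n => U n (sk k n)) (eta k) N hek hN hl1).
  + revert hl2. apply is_lim_seq_ext_loc. exists N. intros n hn. specialize (hN n hn).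
    change (u n (exp (sk k n))) with (U n (sk k n)). rewrite Hf1 by lra.
    unfold rhof. replace (2 * sk k n) with (sk k n + sk k n) by ring. rewrite exp_plus. ring.
  + intros e1. assert (i := gap_lim HG hmu (fun n => U n (sk k n)) (eta k) N hek hN hl1).
    replace (ln (1 / eta k)) with (Lam beta (eta k)); [exact i|].
    unfold Lam, beta. rewrite e1, Rinv_1. destruct (Req_EM_T 1 1) as [_|n]; [|lra].
    unfold Rdiv. rewrite Rmult_1_l, ln_Rinv by lra. reflexivity.
- intros rn hrn hlim1 hlim2.
  destruct (ln_g1_bounds HG (1 / 4) ltac:(lra)) as [B2 [hB2 [hg1B2 hlnB2]]].
  destruct (exists_large HG Bt B2 Bt Bt 1 hBt) as [B [k1 [k2 [_ [_ hgB]]]]].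
  assert (hrnU : forall n, u n (rn n) = U n (ln (rn n))).
  { intros n. unfold U. rewrite exp_ln; [reflexivity|apply hrn]. }
  assert (hln : forall n, ln (rn n) < 0).
  { intros n. rewrite <- ln_1. apply ln_increasing; specialize (hrn n); lra. }
  assert (hzero : forall c, 0 < c < 1 -> exists N, forall n, (N <= n)%nat ->
     B <= U n (ln (rn n)) -> g (U n (ln (rn n))) <= c * g (mu n)).
  { intros c hc. apply (level_to_0 HG hmu (fun n => U n (ln (rn n)))); trivial; [| |lra].
    - intros n. apply (U_le_mu hf HW (HS n)). apply hln.
    - destruct (Req_dec q 1) as [e1|ne].
      + right. specialize (hlim2 e1). revert hlim2. apply is_lim_seq_ext. intros n. now rewrite hrnU.
      + left. specialize (hlim1 ltac:(lra)). revert hlim1. apply is_lim_seq_ext. intros n. now rewrite hrnU. }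
  destruct (continuous_on_bounds (Ici 0) f1 0 B ltac:(lra) Hf1c (fun y hy => proj1 hy)) as [b1 [b2 [hb1 [hb2 hb]]]].
  pose (K1 := Rabs (f1 b1)). assert (hK1 : 0 <= K1) by apply Rabs_pos.
  assert (hhM : 0 < hM).
  { assert (i := weight_bounds HW (1 / 2) ltac:(lra)).
    assert (j := weight_hm HW). lra. }
  assert (hC1 : 0 < C1).
  { destruct (htail' NM (le_n _)) as [j _]. lra. }
  pose (K2 := C1 * hM * K1). assert (hK2 : 0 <= K2) by (repeat apply Rmult_le_pos; lra).
  apply inf_seq_intro. intros K.
  (* [g1] grows at least like [g^(1/4)], so a logarithmic drop [KL] of the level yields mass at
     least [Rabs K + K2], where 2 pays for the initial [z] and [K2] for the loss below level [B].
     The factor 4 in [c] leaves room for the bubble being only above [1/2 * g mu]. *)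
  pose (KL := 4 * (Rabs K + K2 + 2) / c0).
  assert (hKL : 0 < KL).
  { apply div_pos; [|trivial]. assert (i := Rabs_pos K). lra. }
  pose (c := exp (- KL) / 4).
  assert (hc : 0 < c < 1 / 2).
  { unfold c. assert (i := exp_pos (- KL)). assert (j := exp_lt_1 (- KL) ltac:(lra)). lra. }
  destruct (hzero c ltac:(lra)) as [N1 hN1].
  destruct (inf_seq_ev _ hgmu (g B / c)) as [N2 hN2].
  exists (NM + N1 + N2)%nat. intros n hn.
  destruct (htail' n ltac:(lia)) as [hlam [_ [sp [hsp [hUsp [hzsp [hgsp hz]]]]]]].
  specialize (hN1 n ltac:(lia)). specialize (hN2 n ltac:(lia)).
  set (s := ln (rn n)) in *. assert (hs : s < 0) by apply hln.
  assert (hgB0 := hgB B ltac:(lra)).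
  assert (hgmu0 : g B < c * g (mu n)).
  { apply Rmult_lt_reg_r with (/ c); [apply Rinv_0_lt_compat; lra|].
    replace (c * g (mu n) * / c) with (g (mu n)) by (field; lra). exact hN2. }
  assert (hcase : forall t, sp <= t < 0 -> B <= U n t -> g (U n t) <= c * g (mu n) -> K + K2 <= mass (f1 := f1) (h := h) (lam := lam n) (u := u n) (exp t)).
  { intros t ht hUt hgt.
    assert (i := mass_lower HG hf Hf Hf1 Hf1c HW Hhc (Huc n) (Hu n) (HS n) Bt c0 sp t hBt ht
       ltac:(fold (U n); lra) hzsp).
    lapply i; [clear i; intros i|].
    2:{ intros x hx. apply hz; [lra|]. assert (j := U_anti hf HW (HS n) x t ltac:(lra)). lra. }
    apply Rle_trans with (2 := i).
    assert (hUle : U n t <= U n sp) by (apply (U_anti hf HW (HS n)); lra).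
    destruct (hlnB2 (U n t) (U n sp) ltac:(lra)) as [j _].
    assert (gt1 := hg1B2 (U n t) ltac:(lra)).
    assert (gle : g (U n t) <= g (U n sp)) by (apply (g_le HG); lra).
    assert (j2 : KL <= ln (g (U n sp)) - ln (g (U n t))).
    { rewrite <- ln_div by lra. rewrite <- (ln_exp KL). apply ln_le; [apply exp_pos|].
      apply Rmult_le_reg_r with (g (U n t)); [lra|].
      replace (g (U n sp) / g (U n t) * g (U n t)) with (g (U n sp)) by (field; lra).
      apply Rle_trans with (exp KL * (c * g (mu n))).
      - apply Rmult_le_compat_l; [left; apply exp_pos|trivial].
      - unfold c. rewrite exp_Ropp.
        replace (exp KL * (/ exp KL / 4 * g (mu n))) with (1 / 4 * g (mu n)) by (field; apply Rgt_not_eq, exp_pos).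
        lra. }
    assert (j3 : 1 / 4 * KL <= (beta - 1 / 4) * (ln (g (U n sp)) - ln (g (U n t)))).
    { apply Rmult_le_compat; lra. }
    assert (j4 : c0 * (1 / 4 * KL) <= c0 * (ln (g1 (U n sp)) - ln (g1 (U n t)))).
    { apply Rmult_le_compat_l; lra. }
    replace (c0 * (1 / 4 * KL)) with (Rabs K + K2 + 2) in j4 by (unfold KL; field; lra).
    assert (j5 := Rle_abs K).
    change (K + K2 <= - 2 + c0 * (ln (g1 (U n sp)) - ln (g1 (U n t)))). lra. }
  change (K <= mass (f1 := f1) (h := h) (lam := lam n) (u := u n) (rn n)).
  replace (rn n) with (exp s) by (unfold s; rewrite exp_ln; [reflexivity|apply hrn]).
  assert (hgspc : c * g (mu n) < g (U n sp)).
  { assert (gB : 0 < g (mu n)) by (apply Rmult_lt_reg_l with c; lra). assert (c * g (mu n) < 1 / 2 * g (mu n)) by (apply Rmult_lt_compat_r; lra). lra. }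
  (* If [rn] lies below the fixed level [B], the mass is estimated up to that level and [mass_tail]
     covers the rest. *)
  destruct (Rle_lt_dec B (U n s)) as [hUs|hUs].
  + specialize (hN1 hUs).
    assert (hsps : sp <= s).
    { apply Rnot_lt_le; intros hlt. assert (i := U_anti hf HW (HS n) s sp ltac:(lra)).
      assert (g (U n sp) <= g (U n s)) by (apply (g_le HG); lra). lra. }
    assert (i := hcase s ltac:(lra) hUs hN1). lra.
  + assert (hBU : B <= U n sp) by (apply (g_le_inv HG); lra).
    destruct (level_after HG hf HW (HS n) sp B hsp ltac:(lra)) as [sB [hsB hUB]].
    assert (hsBs : sB <= s).
    { apply Rnot_lt_le; intros hlt. assert (i := U_anti hf HW (HS n) s sB ltac:(lra)). lra. }
    assert (i := hcase sB hsB ltac:(lra) ltac:(rewrite hUB; lra)).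
    assert (j := mass_tail Hf1c Hhc (Huc n) (Hu n) (lam := lam n) sB s K2 ltac:(lra) hK2).
    lapply j; [clear j; intros j; lra|].
    intros x hx.
    assert (hx01 : 0 < x < 1).
    { assert (e1 := exp_pos sB). assert (e2 := exp_neg_lt1 s hs). lra. }
    assert (hux : 0 <= u n x <= B).
    { split; [apply (Hu n); unfold I01; lra|].
      assert (hlx : sB <= ln x).
      { rewrite <- (ln_exp sB). apply ln_le; [apply exp_pos|lra]. }
      assert (hlx0 : ln x < 0) by (rewrite <- ln_1; apply ln_increasing; lra).
      assert (k := U_anti hf HW (HS n) sB (ln x) ltac:(lra)).
      unfold U in k at 1. rewrite exp_ln in k by lra. lra. }
    assert (hfx : - K1 <= f1 (u n x)).
    { specialize (hb (u n x) hux). unfold K1. assert (k := Rle_abs (- f1 b1)). rewrite Rabs_Ropp in k. lra. }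
    assert (hhx := weight_bounds HW x hx01). assert (hhm := weight_hm HW).
    assert (q1 : 0 <= lam n * h x * x <= C1 * hM).
    { split; [repeat apply Rmult_le_pos; lra|].
      rewrite <- (Rmult_1_r (C1 * hM)). apply Rmult_le_compat; try lra; [apply Rmult_le_pos; lra|].
      apply Rmult_le_compat; lra. }
    assert (q2 : lam n * h x * x * - K1 <= lam n * h x * x * f1 (u n x)) by (apply Rmult_le_compat_l; lra).
    assert (q3 : lam n * h x * x * K1 <= C1 * hM * K1) by (apply Rmult_le_compat_r; lra).
    unfold K2. lra.
- intros r hr. apply inf_seq_intro. intros K.
  (* For fixed r < 1, [tail] bounds [u n r] below by a positive constant, and [g1 (mu n)] alone then
     diverges. *)
  assert (hlow : exists w, 0 < w /\ exists N, forall n, (N <= n)%nat -> w <= u n r).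
  { destruct (Req_dec r 0) as [->|hr0].
    - exists 1. split; [lra|]. destruct (inf_seq_ev mu hmu 1) as [N hN]. exists N. intros n hn.
      specialize (hN n hn). destruct (hsol n) as [_ [_ [_ [_ [-> _]]]]]. lra.
    - assert (hl : ln r < 0) by (rewrite <- ln_1; apply ln_increasing; lra).
      assert (hy : 0 < y0 * - ln r) by (apply Rmult_lt_0_compat; lra).
      exists (Rmin Bt (y0 * - ln r)). split; [apply Rmin_glb_lt; lra|].
      exists NM. intros n hn. destruct (htail' n hn) as [_ [hU _]].
      assert (i1 := Rmin_l Bt (y0 * - ln r)). assert (i2 := Rmin_r Bt (y0 * - ln r)).
      specialize (hU (ln r) hl). unfold U in hU. rewrite exp_ln in hU by lra. lra. }
  destruct hlow as [w [hw [N hN]]].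
  destruct (inf_seq_ev _ hg1mu (Rabs K / w)) as [N1 hN1].
  exists (N + N1)%nat. intros n hn. specialize (hN n ltac:(lia)). specialize (hN1 n ltac:(lia)).
  assert (hK : 0 <= Rabs K / w) by (apply Rmult_le_pos; [apply Rabs_pos|left; now apply Rinv_0_lt_compat]).
  assert (i : Rabs K / w * w <= g1 (mu n) * u n r) by (apply Rmult_le_compat; lra).
  replace (Rabs K / w * w) with (Rabs K) in i by (field; lra).
  assert (j := Rle_abs K). lra.
- intros _.
  assert (hlamb : exists C, forall n, (NM <= n)%nat -> Rabs (ln (lam n)) <= C).
  { exists (Rabs (ln c1) + Rabs (ln C1)). intros n hn. destruct (htail' n hn) as [hl _].
    assert (ln c1 <= ln (lam n)) by (apply ln_le; lra).
    assert (ln (lam n) <= ln C1) by (apply ln_le; lra).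
    assert (i1 := Rle_abs (ln C1)). assert (i2 := Rle_abs (- ln c1)). rewrite Rabs_Ropp in i2.
    assert (i3 := Rabs_pos (ln C1)). assert (i4 := Rabs_pos (ln c1)).
    apply Rabs_le_between. lra. }
  destruct hlamb as [CL hCL].
  assert (hlam0 := bounded_over_inf (fun n => ln (lam n)) _ CL NM hCL hgmu).
  split.
  + assert (i : is_lim_seq (fun n => ln (/ lam n) / g (mu n)) 0).
    { apply (bounded_over_inf (fun n => ln (/ lam n)) _ CL NM); [|exact hgmu].
      intros n hn. rewrite ln_Rinv by apply (hsol n). rewrite Rabs_Ropp. now apply hCL. }
    revert i. apply is_lim_seq_ext. intros n. unfold Rdiv. now rewrite Rmult_1_l.
  + intros k hk. destruct (hlev k hk) as [[N hN] [hl1 hl2]]. destruct (hbub k hk) as [hak [hek _]].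
    assert (hak2 : 0 < a k ^ 2 / 2) by (apply div_pos; [apply pow_lt|]; lra).
    assert (hlr : is_lim_seq (fun n => ln (rhof h g g1 (lam n) (U n) (sk k n)) / g (mu n)) 0).
    { assert (i : is_lim_seq (fun n => ln (rhof h g g1 (lam n) (U n) (sk k n))) (ln (a k ^ 2 / 2))).
      { apply (is_lim_seq_continuous ln); trivial.
        apply continuity_pt_filterlim, @ex_derive_continuous. eexists. now apply is_derive_ln'. }
      destruct (lim_seq_ev _ _ i 1 Rlt_0_1) as [N1 hN1].
      apply (bounded_over_inf (fun n => ln (rhof h g g1 (lam n) (U n) (sk k n))) _
        (Rabs (ln (a k ^ 2 / 2)) + 1) N1); [|exact hgmu].
      intros n hn. specialize (hN1 n hn).
      assert (j := Rabs_triang (ln (rhof h g g1 (lam n) (U n) (sk k n)) - ln (a k ^ 2 / 2)) (ln (a k ^ 2 / 2))).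
      replace (ln (rhof h g g1 (lam n) (U n) (sk k n)) - ln (a k ^ 2 / 2) + ln (a k ^ 2 / 2))
        with (ln (rhof h g g1 (lam n) (U n) (sk k n))) in j by ring. lra. }
    assert (hlh : is_lim_seq (fun n => ln (h (exp (sk k n))) / g (mu n)) 0).
    { apply (bounded_over_inf (fun n => ln (h (exp (sk k n)))) _ (Rabs (ln hm) + Rabs (ln hM)) 0); [|exact hgmu].
      intros n _. assert (hhm := weight_hm HW).
      assert (i := weight_bounds HW (exp (sk k n)) (exp_neg_lt1 _ (proj1 (hsk' k) n))).
      assert (ln hm <= ln (h (exp (sk k n)))) by (apply ln_le; lra).
      assert (ln (h (exp (sk k n))) <= ln hM) by (apply ln_le; lra).
      assert (i1 := Rle_abs (ln hM)). assert (i2 := Rle_abs (- ln hm)). rewrite Rabs_Ropp in i2.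
      assert (i3 := Rabs_pos (ln hM)). assert (i4 := Rabs_pos (ln hm)).
      apply Rabs_le_between. lra. }
    assert (hlg : is_lim_seq (fun n => ln (g1 (U n (sk k n))) / g (mu n)) 0).
    { destruct (lim_seq_ev _ _ hl1 (eta k / 2) ltac:(lra)) as [N1 hN1].
      destruct (inf_seq_ev _ hgmu (2 * Rabs (g (t0 + 1)) / eta k)) as [N2 hN2].
      apply (ln_g1_over_g_lim HG hmu (fun n => U n (sk k n)) (t0 + 1) (N + N1 + N2)); [lra|].
      intros n hn. specialize (hN n ltac:(lia)). specialize (hN1 n ltac:(lia)). specialize (hN2 n ltac:(lia)).
      split; [|lra]. apply (g_le_inv HG); [lra|lra|]. apply Rabs_def2 in hN1.
      assert (hp : 0 <= 2 * Rabs (g (t0 + 1)) / eta k).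
      { apply Rmult_le_pos; [assert (i := Rabs_pos (g (t0 + 1))); lra|left; apply Rinv_0_lt_compat; lra]. }
      assert (hm' : eta k / 2 * (2 * Rabs (g (t0 + 1)) / eta k)
         <= g (U n (sk k n)) / g (mu n) * g (mu n)) by (apply Rmult_le_compat; lra).
      replace (eta k / 2 * (2 * Rabs (g (t0 + 1)) / eta k)) with (Rabs (g (t0 + 1))) in hm' by (field; lra).
      replace (g (U n (sk k n)) / g (mu n) * g (mu n)) with (g (U n (sk k n))) in hm' by (field; lra).
      assert (i := Rle_abs (g (t0 + 1))). lra. }
    (* Solve the formula of [ln_rho] for [- s] and divide by [g mu]: every term vanishes in the
       limit except [g (U)], which contributes [eta k]. *)
    assert (i1 := is_lim_seq_plus' _ _ _ _ hlam0 hlh).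
    assert (i2 := is_lim_seq_plus' _ _ _ _ i1 hl1).
    assert (i3 := is_lim_seq_plus' _ _ _ _ i2 hlg).
    assert (i4 := is_lim_seq_minus' _ _ _ _ i3 hlr).
    assert (i5 := is_lim_seq_mult' _ _ _ _ i4 (is_lim_seq_const (1 / 2))).
    replace (eta k / 2) with ((0 + 0 + eta k + 0 - 0) * (1 / 2)) by field.
    revert i5. apply is_lim_seq_ext_loc.
    destruct (inf_seq_ev _ hgmu 0) as [N2 hN2].
    exists (N + N2)%nat. intros n hn. specialize (hN n ltac:(lia)). specialize (hN2 n ltac:(lia)).
    rewrite (ln_rho HG HW (HS n)); [|apply (hsk' k)|lra].
    assert (e : ln (1 / exp (sk k n)) = - sk k n).
    { unfold Rdiv. rewrite Rmult_1_l, ln_Rinv, ln_exp by apply exp_pos. reflexivity. }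
    rewrite e.
    field. lra.
Qed.
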